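(* Let $\psi_1,\dots,\psi_m$ be contracting similarities of $\mathbb{R}$ with ratios $r_1,\dots,r_m\in(0,1)$ such that the intervals $\psi_i[0,1]$ are disjoint and ordered, that is $0=\psi_1(0)<\psi_1(1)<\psi_2(0)<\cdots<\psi_m(0)<\psi_m(1)=1$. Let $F\subseteq[0,1]$ be the associated self-similar set, i.e. the unique non-empty compact set with $F=\bigcup_{i=1}^m\psi_i(F)$, which satisfies the lacunarity condition with some constant $\lambda\in(0,1]$. Let $p_1,\dots,p_m>0$ with $\sum_{i=1}^m p_i=1$, and let $\mu$ be the self-similar probability measure on $F$, i.e. the unique Borel probability measure satisfying $\mu(A)=\sum_{i=1}^m p_i\,\mu(\psi_i^{-1}(A))$ for all Borel sets $A$. Let $q\in\mathbb{R}$, $a\ge2/\lambda$ and $G\equiv G_{a,\mu}$. Then $\beta=\beta(q)$ is the solution of $$\sum_{i=1}^m p_i^{q}r_i^{\beta}=1.$$ Moreover, for all $f\in C(F)$ the operator $\xi(f)G^q|D|^{-\beta(q)}$ is measurable, with common Dixmier trace value (noncommutative integral) $$\tau_\omega\big(\xi(f)G^q|D|^{-\beta(q)}\big)=c\int_F f\,d\nu,$$ where $\nu$ is the probability measure on $F$ satisfying $$\nu(A)=\sum_{i=1}^m p_i^{q}r_i^{\beta}\,\nu(\psi_i^{-1}(A))$$ for all Borel sets $A$, and $$c=\frac{2r_0}{\sum_{i=1}^m p_i^{q}r_i^{\beta}\log\big(1/(p_i^{q}r_i^{\beta})\big)},$$ where, with $E_i=[\psi_i(1),\psi_{i+1}(0)]$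 $(1\le i\le m-1)$ the gaps between consecutive basic intervals, $$r_0=\sum_{i=1}^{m}\ \sum_{I_n\subseteq\psi_i[0,1]}|I_n|^{\beta}\Big(\mu(\overline{I}_n^{\,a})^{q}-p_i^{q}\,\mu\big(\psi_i^{-1}(\overline{I}_n^{\,a})\big)^{q}\Big)+\sum_{i=1}^{m-1}|E_i|^{\beta}\mu(\overline{E}_i^{\,a})^{q}$$ (a sum with only finitely many non-zero terms), and $\beta=\beta(q)$ throughout.
   Context: The set $F$ is a compact subset of $[0,1]$ of Lebesgue measure $0$ containing $0$ and $1$, and is the complement in $[0,1]$ of a countable family $\{I_n\}$ of disjoint open intervals $I_n=(b_n^-,b_n^+)$ (the complementary intervals), ordered so that $|I_1|\ge|I_2|\ge\cdots>0$, where $|I|$ denotes length. $F$ satisfies the lacunarity condition with lacunarity constant $0<\lambda\le 1$ if for all $x\in F$ and $0<r\le 1$ the interval $B(x,r)$ (centred at $x$, of length $2r$) contains a complementary interval of length at least $\lambda r$; every self-similar set as in the claim satisfies it for some $\lambda$. For a bounded interval $B$ with endpoints $s<t$ and $a\ge 0$, $\overline{B}^{\,a}=[\,s-\tfrac12 a(t-s),\ t+\tfrac12 a(t-s)\,]$; $\overline{I}_n^{\,a}$, $\overline{E}_i^{\,a}$ are the enlargements of $I_n$, $E_i$. The measure $\mu$ is regarded as a measure on $\mathbb{R}$ (giving zero mass to $\mathbb{R}\setminus F$). For $r>0$, $\mathcal{B}_r=\{[mr,(m+1)r]:m\in\mathbb{Z}\}$ and $\mathcal{B}_r^*=\{B\in\mathcal{B}_r:\mu(B)>0\}$.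 The moment function is $$\beta(q)=\inf\Big\{\beta:\limsup_{r\to0}r^{\beta}\sum_{B\in\mathcal{B}_r^*}\mu(\overline{B}^{\,b})^{q}=0\Big\}=\sup\Big\{\beta:\limsup_{r\to0}r^{\beta}\sum_{B\in\mathcal{B}_r^*}\mu(\overline{B}^{\,b})^{q}=\infty\Big\},$$ where $b>0$; its value does not depend on the choice of $b>0$. Spectral triple: $A=C(F)$ is the algebra of continuous complex-valued functions on $F$, and $H=\ell^2\big(\bigcup_{n}\{b_n^-,b_n^+\}\big)$, whose elements are written $\binom{x_i}{y_i}_{i\in\mathbb{N}}$ with $x_i,y_i$ the values at $b_i^-,b_i^+$. The representation $\xi$ of $A$ on $H$ is $\xi(f)\binom{x_i}{y_i}_{i}=\binom{f(b_i^-)x_i}{f(b_i^+)y_i}_{i}$, and $D=\bigoplus_{n}\frac1{|I_n|}\begin{pmatrix}0&1\\1&0\end{pmatrix}$, so $|D|^{-\beta}$ acts on the $n$-th two-dimensional block as multiplication by $|I_n|^{\beta}$. The operator $G=G_{a,\mu}$ acts on the $n$-th block as $\begin{pmatrix}g(b_n^-)&0\\0&g(b_n^+)\end{pmatrix}$ with $g(b_n^-)=g(b_n^+)=\mu(\overline{I}_n^{\,a})>0$. Thus $G^q|D|^{-\beta}$ is the diagonal operator acting on the $n$-th block as multiplication by $\mu(\overline{I}_n^{\,a})^{q}|I_n|^{\beta}$. For a compact operator $T$ on $H$, $\sigma_k(T)$ is the $k$-th largest eigenvalue of $|T|=(T^*T)^{1/2}$ (with multiplicity). With $K(H)$ the compact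 operators on $H$, the Dixmier ideal is $\mathcal{L}^{1,\infty}(H)=\{T\in K(H):\limsup_{N\to\infty}\frac{\sum_{k=1}^N\sigma_k(T)}{\log N}<\infty\}$. A Dixmier trace is a positive linear functional $\tau_\omega$ on $\mathcal{L}^{1,\infty}(H)$ given on positive $T$ by $\tau_\omega(T)=\omega\text{-}\lim\frac{\sum_{k=1}^N\sigma_k(T)}{\log N}$, where $\omega$ is a state on $\ell^\infty$ (a positive linear functional of norm $1$, whose value on $(a_N)$ is written $\omega\text{-}\lim a_N$), such that $\tau_\omega$ is a singular trace (a unitarily invariant trace vanishing on finite rank operators, with $\tau_\omega(S)\le\tau_\omega(T)$ whenever $S,T$ are positive and $\sigma_i(S)\le\sigma_i(T)$ for all but finitely many $i$) and $\liminf_{N}\frac{\sum_{k\le N}\sigma_k(T)}{\log N}\le\tau_\omega(T)\le\limsup_{N}\frac{\sum_{k\le N}\sigma_k(T)}{\log N}$ for positive $T$. An operator $T\in\mathcal{L}^{1,\infty}(H)$ is measurable if $\tau_\omega(T)$ is independent of $\omega$ (for positive $T$: if $\lim_{N\to\infty}\frac{\sum_{k=1}^N\sigma_k(T)}{\log N}$ exists); the common value is the noncommutative integral of $T$. *)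

(* Defs.v *)
(* MathComp-Analysis; the base field is an arbitrary realType [R] and the
   complex numbers are [R[i]]. *)
From HB Require Import structures.
From mathcomp Require Import all_boot all_order all_algebra.
From mathcomp Require Import all_classical all_reals all_analysis.
From mathcomp Require Import complex ring.

Set Implicit Arguments.
Unset Strict Implicit.
Unset Printing Implicit Defensive.

Import Order.TTheory GRing.Theory Num.Theory numFieldNormedType.Exports.
Import Normc.

Local Open Scope classical_set_scope.
Local Open Scope complex_scope.
Local Open Scope ring_scope.

(** * The fractal and its measures *)

Section Fractal.
Context {R : realType}.
Implicit Types (F : set R) (bm bp : nat -> R).

Definition similarity (r : R) (g : R -> R) : Prop :=
  forall x y, `|g x - g y| = r * `|x - y|.

(* 0 = psi_1(0) < psi_1(1) < psi_2(0) < ... < psi_m(0) < psi_m(1) = 1, the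
   maps being indexed by 'I_m.+1; the (m.+1).-1 = m consecutive pairs are
   indexed by 'I_m through [lidx] and [ridx]. *)
Definition lidx (m : nat) (i : 'I_m) : 'I_m.+1 := widen_ord (leqnSn m) i.
Definition ridx (m : nat) (i : 'I_m) : 'I_m.+1 := lift ord0 i.

Definition ordered_pieces (m : nat) (psi : 'I_m.+1 -> R -> R) : Prop :=
  [/\ psi ord0 0 = 0,
      psi ord_max 1 = 1,
      forall i, psi i 0 < psi i 1
    & forall i : 'I_m, psi (lidx i) 1 < psi (ridx i) 0].

Definition selfsimilar_set (m : nat) (psi : 'I_m -> R -> R) F : Prop :=
  [/\ F !=set0, compact F & F = \bigcup_i (psi i @` F)].

(* I_n = ]bm n, bp n[ *)
Definition complementary_intervals F bm bp : Prop :=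
  [/\ forall n, bm n < bp n,
      trivIset setT (fun n => `]bm n, bp n[%classic),
      `[0, 1]%classic `\` F = \bigcup_n `]bm n, bp n[%classic
    & forall n k, (n <= k)%N -> bp k - bm k <= bp n - bm n].

Definition lacunary F bm bp (lambda : R) : Prop :=
  forall x r, F x -> 0 < r <= 1 ->
    exists n, `]bm n, bp n[%classic `<=` ball x r /\
              lambda * r <= bp n - bm n.

(* A probability measure on F is a Borel probability measure on R giving
   mass 1 to F. *)
Definition selfsimilar_measure (m : nat) F (psi : 'I_m -> R -> R)
    (w : 'I_m -> R) (mu : probability (measurableTypeR R) R) : Prop :=
  mu F = 1%E /\
  forall A : set (measurableTypeR R), measurable A ->
    mu A = (\sum_(i < m) (w i)%:E * mu (psi i @^-1` A))%E.

(* enlargement of a bounded interval with endpoints s < t *)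
Definition enlarge (a s t : R) : set R :=
  `[s - a / 2 * (t - s), t + a / 2 * (t - s)]%classic.

Definition mesh (r : R) (k : int) : set R :=
  `[k%:~R * r, (k + 1)%:~R * r]%classic.

Definition moment_sum (mu : probability (measurableTypeR R) R) (b q r : R)
    : \bar R :=
  \esum_(k in [set k : int | (0 < mu (mesh r k))%E])
     (fine (mu (enlarge b (k%:~R * r) ((k + 1)%:~R * r))) `^ q)%:E.

Definition moment_limsup (mu : probability (measurableTypeR R) R)
    (b q beta : R) : \bar R :=
  limf_esup (fun r : R => (r `^ beta)%:E * moment_sum mu b q r)%E 0^'+.

(* [beta] is the value at [q] of the moment function: both the infimum and the
   supremum (taken in the extended reals) equal [beta], for every b > 0. *)
Definition is_moment (mu : probability (measurableTypeR R) R) (q beta : R)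
    : Prop :=
  forall b, 0 < b ->
    ereal_inf [set t%:E | t in [set t | moment_limsup mu b q t = 0%E]]
      = beta%:E /\
    ereal_sup [set t%:E | t in [set t | moment_limsup mu b q t = +oo%E]]
      = beta%:E.

(* integral over F of a complex-valued function *)
Definition cintegral (nu : probability (measurableTypeR R) R) F
    (f : R -> R[i]) : R[i] :=
  (\int[nu]_(x in F) complex.Re (f x))%R +i*
  (\int[nu]_(x in F) complex.Im (f x))%R.

Definition r0_term (m : nat) (psi : 'I_m.+1 -> R -> R) (p : 'I_m.+1 -> R)
    bm bp (mu : probability (measurableTypeR R) R) (a q beta : R)
    (i : 'I_m.+1) (n : nat) : R :=
  let J := enlarge a (bm n) (bp n) in
  (bp n - bm n) `^ beta *
    (fine (mu J) `^ q - p i `^ q * fine (mu (psi i @^-1` J)) `^ q).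

Definition r0_range (m : nat) (psi : 'I_m.+1 -> R -> R) bm bp
    (i : 'I_m.+1) : set nat :=
  [set n | `]bm n, bp n[%classic `<=` psi i @` `[0, 1]%classic].

(* The inner sum over n is a finitely supported sum; it would be 0 if its
   support were infinite. *)
Definition r0 (m : nat) (psi : 'I_m.+1 -> R -> R) (p : 'I_m.+1 -> R)
    bm bp (mu : probability (measurableTypeR R) R) (a q beta : R) : R :=
  \sum_(i < m.+1) \sum_(n \in r0_range psi bm bp i)
      r0_term psi p bm bp mu a q beta i n +
  \sum_(i < m) (psi (ridx i) 0 - psi (lidx i) 1) `^ beta *
      fine (mu (enlarge a (psi (lidx i) 1) (psi (ridx i) 0))) `^ q.

End Fractal.

(** * The Hilbert space *)

(* (n, false) stands for the endpoint b_n^- and (n, true) for b_n^+ *)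
Definition site : Type := (nat * bool)%type.
HB.instance Definition _ := Choice.on site.

Section Ell2.
Context {R : realType}.

Definition sqsum (x : site -> R[i]) : \bar R :=
  \esum_(j in [set: site]) ((normc (x j)) ^+ 2)%:E.

Definition sqsummable : {pred (site -> R[i])} :=
  mem [set x | (sqsum x < +oo)%E].

Let normc_sqr (z : R[i]) :
  normc z ^+ 2 = complex.Re z ^+ 2 + complex.Im z ^+ 2.
Proof. by case: z => u v /=; rewrite sqr_sqrtr // addr_ge0 // sqr_ge0. Qed.

Let normc_sqrD (z w : R[i]) :
  normc (z + w) ^+ 2 <= 2 * normc z ^+ 2 + 2 * normc w ^+ 2.
Proof.
rewrite !normc_sqr; case: z w => [a b] [c d] /=.
rewrite -subr_ge0.
have -> : 2 * (a ^+ 2 + b ^+ 2) + 2 * (c ^+ 2 + d ^+ 2) -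
  ((a + c) ^+ 2 + (b + d) ^+ 2) = (a - c) ^+ 2 + (b - d) ^+ 2 by ring.
by rewrite addr_ge0 // sqr_ge0.
Qed.

Let esumZ_lty (k : R) (f : site -> R) : 0 <= k -> (forall j, 0 <= f j) ->
  (\esum_(j in [set: site]) (f j)%:E < +oo ->
   \esum_(j in [set: site]) (k * f j)%:E < +oo)%E.
Proof.
move=> k0 f0 fy.
have s0 : (0 <= \esum_(j in [set: site]) (f j)%:E)%E.
  by apply: esum_ge0 => j _; rewrite lee_fin.
apply: (@le_lt_trans _ _ (k%:E * \esum_(j in [set: site]) (f j)%:E)%E).
  apply: ge_ereal_sup => _ [A AT <-].
  have -> : (\sum_(x \in A) (k * f x)%:E = k%:E * \sum_(x \in A) (f x)%:E)%E.
    rewrite ge0_mule_fsumr; last by move=> j; rewrite lee_fin.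
    by apply: eq_fsbigr => j _; rewrite EFinM.
  apply: lee_wpmul2l; first by rewrite lee_fin.
  by apply: ereal_sup_ubound; exists A.
by apply: lte_mul_pinfty => //; rewrite ge0_fin_numE.
Qed.

Lemma sqsummable_submod_closed : submod_closed sqsummable.
Proof.
split=> [|a x y]; rewrite !inE /sqsum /=.
  rewrite esum1 ?ltry // => j _.
  have h : (normc (0 : R[i]) ^+ 2)%:E = 0%E by rewrite normc0 expr0n.
  exact: h.
move=> xy yy.
apply: (@le_lt_trans _ _ (\esum_(j in [set: site])
   ((2 * normc a ^+ 2 * normc (x j) ^+ 2)%:E +
    (2 * normc (y j) ^+ 2)%:E))%E).
  apply: le_esum => j _; rewrite -EFinD lee_fin.
  rewrite (le_trans (normc_sqrD _ _)) // lerD2r -mulrA ler_wpM2l //.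
  by rewrite normcM exprMn.
rewrite esumD; last 2 first.
- by move=> j _; rewrite lee_fin; do ![exact: sqr_ge0|exact: ler0n|apply: mulr_ge0].
- by move=> j _; rewrite lee_fin; do ![exact: sqr_ge0|exact: ler0n|apply: mulr_ge0].
by apply: lte_add_pinfty; apply: esumZ_lty => // *;
  do ![exact: sqr_ge0|exact: ler0n|apply: mulr_ge0].
Qed.

HB.instance Definition _ :=
  GRing.isSubmodClosed.Build _ _ sqsummable sqsummable_submod_closed.

Record ell2 := Ell2 {
  ell2_fun :> site -> R[i];
  ell2P : ell2_fun \in sqsummable }.
HB.instance Definition _ := [isSub for ell2_fun].
HB.instance Definition _ := [Choice of ell2 by <:].
HB.instance Definition _ := [SubChoice_isSubLmodule of ell2 by <:].

Definition ell2_norm (x : ell2) : R := Num.sqrt (fine (sqsum x)).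

Definition ip (x y : ell2) : R[i] :=
  limn (fun N => \sum_(n < N) \sum_(b : bool)
    x (val n, b) * conjc (y (val n, b)) : R[i]^o).

End Ell2.
Arguments ell2 : clear implicits.

(** * Operators, singular values and Dixmier traces *)

Section Operators.
Context {R : realType}.
Local Notation H := (ell2 R).
Implicit Types (S T A U V : H -> H).

Definition bounded_op T : Prop :=
  linear T /\ exists M : R, forall x, ell2_norm (T x) <= M * ell2_norm x.

Definition compact_op T : Prop :=
  linear T /\
  forall u : nat -> H, (exists M : R, forall n, ell2_norm (u n) <= M) ->
    exists (phi : nat -> nat) (y : H),
      {homo phi : n k / (n < k)%N} /\
      (fun n => ell2_norm (T (u (phi n)) - y)) @ \oo --> (0 : R).

Definition finite_rank_op T : Prop :=
  bounded_op T /\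
  exists (n : nat) (v : 'I_n -> H),
    forall x, exists c : 'I_n -> R[i], T x = \sum_(i < n) c i *: v i.

Definition adjoint_op T S : Prop := forall x y, ip (T x) y = ip x (S y).

(* The order of R[i] is used: 0 <= z means that z is real and nonnegative. *)
Definition positive_op T : Prop := bounded_op T /\ forall x, 0 <= ip (T x) x.

Definition unitary_op U V : Prop :=
  [/\ linear U, adjoint_op U V, cancel U V & cancel V U].

(* A = |T|, the positive square root of T^* T *)
Definition abs_op T A : Prop :=
  positive_op A /\
  exists2 S, adjoint_op T S & forall x, A (A x) = S (T x).

Definition orthonormal (n : nat) (v : 'I_n -> H) : Prop :=
  forall i j, ip (v i) (v j) = (i == j)%:R.

(* The (k+1)-st largest eigenvalue of |T| with multiplicity: the largest t such
   that |T| has k+1 orthonormal eigenvectors with eigenvalues at least t.  The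
   numbering starts at 0, so [sing T k] is sigma_(k+1)(T). *)
Definition sing T (k : nat) : R :=
  sup [set t : R | 0 <= t /\
    exists A (v : 'I_k.+1 -> H) (l : 'I_k.+1 -> R),
      [/\ abs_op T A, orthonormal v
        & forall i, A (v i) = (l i)%:C *: v i /\ t <= l i]].

(* (sigma_1(T) + ... + sigma_N(T)) / log N, for N = N' + 2, which avoids the
   division by log 1; the sequences fed to a state are thus indexed by N'. *)
Definition log_average T (N' : nat) : R :=
  (\sum_(k < N'.+2) sing T k) / ln (N'.+2%:R).

Definition dixmier_ideal T : Prop :=
  compact_op T /\ (limn_esup (EFin \o log_average T) < +oo)%E.

Definition linf (u : nat -> R) : Prop := exists M : R, forall n, `|u n| <= M.

Definition state (omega : (nat -> R) -> R) : Prop :=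
  [/\ forall a u v, linf u -> linf v ->
        omega (fun n => a * u n + v n) = a * omega u + omega v,
      forall u, linf u -> (forall n, 0 <= u n) -> 0 <= omega u
    & sup [set `|omega u| | u in [set u | forall n, `|u n| <= 1]] = 1].

(* Only the restriction of [tau] to the Dixmier ideal is constrained. *)
Record dixmier_trace (omega : (nat -> R) -> R) (tau : (H -> H) -> R[i])
  : Prop :=
  DixmierTrace {
    dixmier_state : state omega;
    dixmier_linear : forall a S T, dixmier_ideal S -> dixmier_ideal T ->
      tau (fun x => a *: S x + T x) = a * tau S + tau T;
    dixmier_positive : forall T, dixmier_ideal T -> positive_op T -> 0 <= tau T;
    dixmier_omega : forall T, dixmier_ideal T -> positive_op T ->
      tau T = (omega (log_average T))%:C;
    dixmier_unitary : forall U V T, unitary_op U V -> dixmier_ideal T ->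
      tau (U \o T \o V) = tau T;
    dixmier_finite_rank : forall T, finite_rank_op T -> tau T = 0;
    dixmier_monotone : forall S T, dixmier_ideal S -> dixmier_ideal T ->
      positive_op S -> positive_op T ->
      (exists k0, forall k, (k0 <= k)%N -> sing S k <= sing T k) ->
      tau S <= tau T;
    dixmier_bounds : forall T, dixmier_ideal T -> positive_op T ->
      (limn_einf (EFin \o log_average T) <= (omega (log_average T))%:E
         <= limn_esup (EFin \o log_average T))%E }.

(* [T] is measurable with noncommutative integral [z]: every Dixmier trace takes
   the value [z] at [T] and, for positive T, the logarithmic averages of the
   singular values converge, necessarily to the same value. *)
Definition has_nc_integral T (z : R[i]) : Prop :=
  [/\ dixmier_ideal T,
      forall omega tau, dixmier_trace omega tau -> tau T = z
    & positive_op T -> log_average T @ \oo --> complex.Re z].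

Definition measurable_op T : Prop := exists z, has_nc_integral T z.

(* Diagonal operator.  If multiplication by [d] takes [x] out of l^2 the value
   is set to 0; for bounded [d], where the operator is everywhere defined, this
   does not happen. *)
Definition diag_op (d : site -> R[i]) (x : H) : H :=
  insubd (0 : H) ((fun j => d j * x j) : site -> R[i]).

Definition endpoint (bm bp : nat -> R) (j : site) : R :=
  if j.2 then bp j.1 else bm j.1.

Definition xi (bm bp : nat -> R) (f : R -> R[i]) : H -> H :=
  diag_op (fun j => f (endpoint bm bp j)).

(* G^q |D|^(-beta), as one operator: for negative q or beta one of the factors
   alone is unbounded.  D has blocks |I_n|^-1 (0 1; 1 0), whose absolute value is |I_n|^-1
   times the identity. *)
Definition GqD (bm bp : nat -> R) (mu : probability (measurableTypeR R) R)
    (a q beta : R) : H -> H :=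
  diag_op (fun j =>
    (fine (mu (enlarge a (bm j.1) (bp j.1))) `^ q *
     (bp j.1 - bm j.1) `^ beta)%:C).

End Operators.

(* Main.v *)
(* Put d(I) = mu(I^a)^q |I|^beta for a complementary interval I.  For all but
   finitely many I one has d(psi_i I) = w_i d(I), so the sum Z(s) of the
   eigenvalues of G^q |D|^(-beta) that are at least exp(-s) satisfies
   Z(s) = sum_i w_i Z(s - l_i) + 2 r_0 for large s, where l_i = ln (1 / w_i).
   Since sum_i w_i = 1, subtracting the linear solution c s leaves a function
   whose values are averages of earlier values, hence Z(s) = c s + O(1) and no
   renewal theorem is needed.  Cutting the eigenvalues at a level t instead of
   after N terms changes the sum by at most N t, which turns this into the
   convergence of the logarithmic averages to c.  A continuous f >= 0 is squeezed
   between constants on the pieces of generation k, giving c times a limit of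
   iterated weighted averages of f, which is the integral of f against nu; the
   general case follows by linearity of the trace.  The same propagation of bounds,
   applied to the mesh sums over all shifted meshes at once (this family is stable
   under the maps psi_i), shows that they are comparable to r^(-beta). *)
Require Import Defs.
From HB Require Import structures.
From mathcomp Require Import all_boot all_order all_algebra.
From mathcomp Require Import all_classical all_reals all_analysis.
From mathcomp Require Import measurable_realfun complex ring lra.

Set Implicit Arguments.
Unset Strict Implicit.
Unset Printing Implicit Defensive.

Import Order.TTheory GRing.Theory Num.Theory numFieldNormedType.Exports.

Local Open Scope classical_set_scope.
Local Open Scope complex_scope.
Local Open Scope ring_scope.

(** * Sums with finite support and induction on scales *)

(** The scaling of d rests on one geometric fact: distinct pieces lie a positive distance apart. The
    enlargement of a short interval [psi i I] therefore misses all other pieces, and on such a set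
    mu is p_i times its pull-back. The same distance makes the recursion for fine meshes exact.
    Since q may be negative, masses must also be bounded from below; self-similarity gives a uniform
    lower bound for balls of fixed radius centred on F. Sums run over sites, not intervals: this is
    where f is evaluated, and the two sites of an interval produce the 2 in c. The renewal argument
    sees only a countable set with injections. It is well founded because intervals are numbered by
    decreasing length, so each psi_i raises the number. The limit of the iterated averages of f is
    defined without a measure; it supplies the value of the trace, and is compared with a given nu
    only at the end. Singular values see only |f|. For complex f the logarithmic averages thus
    converge to c times the mean of |f|, which yields membership in the ideal but not the trace. *)

Lemma finite_set_ub (R : realType) (T : choiceType) (A : set T) (f : T -> R) :
  finite_set A -> exists2 C, 0 < C & forall x, A x -> f x <= C.
Proof.
case/finite_seqP => s ->; elim: s => [|a s [C C0 IH]]; first by exists 1.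
exists (C + `|f a|); first by rewrite ltr_wpDr.
move=> x; rewrite /= inE => /orP[/eqP -> | xs].
  by rewrite (le_trans (ler_norm _)) // lerDr ltW.
by rewrite (le_trans (IH x xs)) // lerDl.
Qed.

Lemma finite_set_lb (R : realType) (T : choiceType) (A : set T) (f : T -> R) :
  finite_set A -> (forall x, 0 < f x) ->
  exists2 c, 0 < c & forall x, A x -> c <= f x.
Proof.
move=> Afin f0; have [C C0 CP] := finite_set_ub (fun x => (f x)^-1) Afin.
exists C^-1; first by rewrite invr_gt0.
by move=> x /CP h; rewrite -[leRHS]invrK lef_pV2 // posrE ?invr_gt0.
Qed.

Lemma ord_ub (R : realType) (n : nat) (f : 'I_n -> R) :
  exists2 C, 0 < C & forall i, f i <= C.
Proof.
have [C C0 CP] := finite_set_ub f (@finite_finset _ [set: 'I_n]).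
by exists C => // i; apply: CP.
Qed.

Lemma ord_lt1_ub (R : realType) (n : nat) (f : 'I_n -> R) :
  (forall i, 0 < f i < 1) -> exists2 rho, 0 < rho < 1 & forall i, f i <= rho.
Proof.
move=> f01; have [C C0 CP] := ord_ub (fun i => (1 - f i)^-1).
have P i : C^-1 <= 1 - f i.
  have /andP[_ fi1] := f01 i.
  by rewrite -[leRHS]invrK lef_pV2 ?posrE ?invr_gt0 ?subr_gt0.
(* The maximum with [1 / 2] keeps [rho] positive even when the index type is empty. *)
exists (Num.max (1 - C^-1) (1 / 2)).
  rewrite lt_max gt_max ltrBlDr ltrDl invr_gt0 C0.
  by rewrite [0 < 1 / 2]divr_gt0 // orbT /=; lra.
by move=> i; rewrite le_max; have := P i => h; apply/orP; left; lra.
Qed.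

Lemma expr_lt_eps (R : realType) (rho eps : R) : 0 < rho < 1 -> 0 < eps ->
  exists n, rho ^+ n < eps.
Proof.
move=> /andP[r0 r1] e0.
have /cvgrPdist_lt /(_ _ e0) [N _ /(_ N (leqnn _))] :
    (fun n => rho ^+ n) @ \oo --> (0 : R).
  by apply: cvg_expr; rewrite ger0_norm // ltW.
by rewrite /= sub0r normrN ger0_norm ?exprn_ge0 // ?ltW //; exists N.
Qed.

(** Each division by some [r i] enlarges [t] by a factor at least [1 / rho], so boundedly many
    divisions bring a given [t] up to [t0]; the bound on [t0 / r i] prevents a division that starts
    below [t0] from passing [u]. It serves for eigenvalue levels (with ratios [w i]) and for mesh
    sizes (with ratios [r i]). *)
Lemma scale_induction (R : realType) (n : nat) (r : 'I_n -> R) (t0 u : R)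
    (P : R -> Prop) :
  (forall i, 0 < r i < 1) -> 0 < t0 -> (forall i, t0 / r i <= u) ->
  (forall t, t0 <= t <= u -> P t) ->
  (forall t, 0 < t < t0 -> (forall i, P (t / r i)) -> P t) ->
  forall t, 0 < t <= u -> P t.
Proof.
move=> r01 t00 ru P0 PS t /andP[tp tu].
have [rho rho01 rhoP] := ord_lt1_ub r01; have /andP[rho0 rho1] := rho01.
have key k : forall t, t0 * rho ^+ k <= t <= u -> P t.
  elim: k => [|k IH] {tp tu} {}t; first by rewrite expr0 mulr1 => /P0.
  case/andP=> lt tu; have [tt0 | tt0] := leP t0 t; first by apply: P0; rewrite tt0.
  have tp : 0 < t by apply: lt_le_trans lt; rewrite mulr_gt0 ?exprn_gt0.
  apply: PS; first by rewrite tp.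
  move=> i; apply: IH; have /andP[ri0 ri1] := r01 i; apply/andP; split.
    rewrite ler_pdivlMr // (le_trans _ lt) // exprSr mulrA.
    by rewrite ler_wpM2l ?rhoP // mulr_ge0 ?exprn_ge0 // ltW.
  apply: le_trans (ru i).
  by rewrite ler_wpM2r ?invr_ge0 ?(ltW tt0) ?(ltW ri0).
have [k kP] := expr_lt_eps rho01 (divr_gt0 tp t00).
by apply: (key k); rewrite tu andbT mulrC -ler_pdivlMr // ltW.
Qed.

Section FiniteSupportSums.
Context {R : realType} {T : choiceType}.
Implicit Types (h : T -> R) (S : set T).

Lemma fsum_widen h S : (forall x, ~ S x -> h x = 0) ->
  \sum_(x \in [set: T]) h x = \sum_(x \in S) h x.
Proof. by move=> hS; apply/esym/fsbig_widen => // x [_ /hS]. Qed.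

(** A sum with infinite support is 0 by convention, so additivity can fail without the finiteness
    assumptions. With them, all three sums are taken over the union of the supports. *)
Lemma fsumB h h' : finite_set [set x | h x != 0] ->
  finite_set [set x | h' x != 0] ->
  \sum_(x \in [set: T]) (h x - h' x) =
  \sum_(x \in [set: T]) h x - \sum_(x \in [set: T]) h' x.
Proof.
move=> hf hf'; set S := [set x | h x != 0] `|` [set x | h' x != 0].
have Sfin : finite_set S by rewrite finite_setU.
have E (k : T -> R) : (forall x, ~ S x -> k x = 0) ->
  \sum_(x \in [set: T]) k x =
    \sum_(x <- finmap.enum_fset (fset_set S)) k x.
  by move=> kS; rewrite (fsum_widen kS) fsbig_finite.
have hS x : ~ S x -> h x = 0.
  by move=> nS; apply/eqP/negPn/negP => hx; apply: nS; left.
have hS' x : ~ S x -> h' x = 0.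
  by move=> nS; apply/eqP/negPn/negP => hx; apply: nS; right.
rewrite !E //; last by move=> x nS; rewrite hS // hS' // subr0.
by rewrite sumrB.
Qed.

Lemma fsumZ a h : finite_set [set x | h x != 0] ->
  \sum_(x \in [set: T]) (a * h x) = a * \sum_(x \in [set: T]) h x.
Proof.
move=> hf; rewrite full_fsbig_distrr //.
by apply: sub_finite_set hf => x [_ /= /eqP].
Qed.

Lemma ler_fsum h h' : finite_set [set x | h x != 0] ->
  finite_set [set x | h' x != 0] -> (forall x, h x <= h' x) ->
  \sum_(x \in [set: T]) h x <= \sum_(x \in [set: T]) h' x.
Proof.
move=> hf hf' hh'; rewrite -subr_ge0 -fsumB //.
by apply: fsumr_ge0 => x _; rewrite subr_ge0.
Qed.

End FiniteSupportSums.

(** * Renewal of eigenvalue sums *)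

(** A hard threshold: a value is dropped or kept whole, never truncated at [t]. Summed over the
    sites it gives the sum of the eigenvalues that are at least [t]. *)
Definition cut {R : realType} (t x : R) : R := if t <= x then x else 0.

Section Cut.
Context {R : realType}.
Implicit Types t x y : R.

Lemma cut_ge0 t x : 0 <= x -> 0 <= cut t x.
Proof. by rewrite /cut; case: ifP. Qed.

Lemma cut_le t x : 0 <= x -> cut t x <= x.
Proof. by rewrite /cut; case: ifP. Qed.

Lemma cut_neq0 t x : cut t x != 0 -> t <= x.
Proof. by rewrite /cut; case: ifP => // _; rewrite eqxx. Qed.

Lemma cut_id t x : t <= x -> cut t x = x.
Proof. by rewrite /cut => ->. Qed.

Lemma ler_cut t x y : 0 <= x -> x <= y -> cut t x <= cut t y.
Proof.
move=> x0 xy; rewrite /cut; have [tx|_] := leP t x; first by rewrite (le_trans tx).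
by case: ifP => _ //; apply: le_trans xy.
Qed.

Lemma ler_cutl t s x : 0 <= x -> t <= s -> cut s x <= cut t x.
Proof.
move=> x0 ts; rewrite /cut; have [sx|_] := leP s x; first by rewrite (le_trans ts).
by case: ifP.
Qed.

(** Trading a factor for a change of level is what turns the scaling of [d] under [kap i] into a
    renewal equation. *)
Lemma cutM a t x : 0 < a -> cut t (a * x) = a * cut (t / a) x.
Proof.
by move=> a0; rewrite /cut ler_pdivrMr // [x * a]mulrC; case: ifP; rewrite ?mulr0.
Qed.

End Cut.

(** * Decay of a function that contracts along a family of maps *)

Section RecursiveDecay.
Context {R : realType} {T : choiceType} {n : nat}.
Context (kap : 'I_n -> T -> T) (w : 'I_n -> R) (d : T -> R) (X : set T).
Context (w01 : forall i, 0 < w i < 1) (d0 : forall x, 0 < d x).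
Context (Xfin : finite_set X) (rank : T -> nat).
Context (rankP : forall i x, (rank x < rank (kap i x))%N).
Context (regular : forall x, ~ X x -> exists i y, x = kap i y /\ d x = w i * d y).

(** Outside [X] a value is smaller than the value at a predecessor of lower [rank]. Going back must
    end in [X], so a bound on [X] is a bound everywhere. *)
Lemma decay_bounded : exists2 C, 0 < C & forall x, d x <= C.
Proof.
have [C C0 CP] := finite_set_ub d Xfin; exists C => //.
suff key k : forall x, (rank x < k)%N -> d x <= C by move=> x; apply: key (ltnSn _).
elim: k => [//|k IH] x xk.
have [/CP // | nx] := pselect (X x).
have [i [y [xE ->]]] := regular nx.
have yk : (rank y < k)%N.
  by have := rankP i y; rewrite -xE => /leq_trans; apply; rewrite -ltnS.
apply: le_trans (IH y yk); rewrite ger_pMl //.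
by case/andP: (w01 i) => _ /ltW.
Qed.

(** Outside [X], a value above [C * rho ^+ k.+1] has a predecessor with value above [C * rho ^+ k].
    Each generation thus adds only images of a finite set. *)
Lemma decay_vanish t : 0 < t -> finite_set [set x | t <= d x].
Proof.
move=> t0; have [C C0 CP] := decay_bounded.
have [rho rho01 rhoP] := ord_lt1_ub w01.
have [rho0 _] := andP rho01.
suff key k : finite_set [set x | C * rho ^+ k < d x].
  have [k kP] := expr_lt_eps rho01 (divr_gt0 t0 C0).
  apply: sub_finite_set (key k) => x /=; apply: lt_le_trans.
  by rewrite mulrC -ltr_pdivlMr.
elim: k => [|k IH].
  by apply: sub_finite_set (finite_set0 T) => x /=; rewrite expr0 mulr1 ltNge CP.
apply: (@sub_finite_set _ _ (X `|`
  \bigcup_i (kap i @` [set x | C * rho ^+ k < d x]))); last first.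
  rewrite finite_setU; split=> //; apply: bigcup_finite => // i _.
  exact: finite_image.
move=> x /= xk; have [|nx] := pselect (X x); first by left.
have [i [y [xE dx]]] := regular nx; right; exists i => //; exists y => //=.
have /andP[wi0 _] := w01 i.
rewrite -(ltr_pM2l wi0) -dx; apply: le_lt_trans xk.
by rewrite exprSr mulrA mulrC ler_wpM2l // mulr_ge0 ?exprn_ge0 // ltW.
Qed.

End RecursiveDecay.

Section Renewal.
Context {R : realType} {T : choiceType} {n : nat}.

(** What remains of the sites once geometry and measure are forgotten. [Z] will be the endpoints of
    the gaps between neighbouring pieces, and [renewal_fin] the statement that the exact scaling of
    [d] has finitely many exceptions. [renewal_rank] excludes infinite backward chains. *)
Record renewal (kap : 'I_n -> T -> T) (w : 'I_n -> R) (d : T -> R) (Z : set T)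
    : Prop := Renewal {
  renewal_w01 : forall i, 0 < w i < 1;
  renewal_w1 : \sum_i w i = 1;
  renewal_inj : forall i j x y, kap i x = kap j y -> i = j /\ x = y;
  renewal_finZ : finite_set Z;
  renewal_cover : forall x, ~ Z x <-> exists i y, x = kap i y;
  renewal_d0 : forall x, 0 < d x;
  renewal_fin : forall i, finite_set [set x | d (kap i x) != w i * d x];
  renewal_rank : exists rank : T -> nat,
    forall i x, (rank x < rank (kap i x))%N }.

Context (kap : 'I_n -> T -> T) (w : 'I_n -> R) (d : T -> R) (Z : set T).
Context (rn : renewal kap w d Z).
Implicit Types (u : T -> R).

Let w0 i : 0 < w i. Proof. by case/andP: (renewal_w01 rn i). Qed.
Let d0 := renewal_d0 rn.

Let irregular : set T :=
  Z `|` \bigcup_i (kap i @` [set x | d (kap i x) != w i * d x]).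

Let irregular_fin : finite_set irregular.
Proof.
rewrite finite_setU; split; first exact: renewal_finZ rn.
apply: bigcup_finite => // i _.
exact/finite_image/(renewal_fin rn).
Qed.

Let regular x : ~ irregular x -> exists i y, x = kap i y /\ d x = w i * d y.
Proof.
move=> nx; have /(renewal_cover rn) [i [y xE]] : ~ Z x by move=> Zx; apply: nx; left.
exists i, y; split=> //; apply/eqP/negPn/negP => ne; apply: nx; right.
by exists i => //; exists y => //=; rewrite -xE.
Qed.

Lemma renewal_vanish t : 0 < t -> finite_set [set x | t <= d x].
Proof.
have [rank rankP] := renewal_rank rn.
exact: (decay_vanish (renewal_w01 rn) d0 irregular_fin rankP regular).
Qed.

Definition bounded_weight u := exists2 C, 0 < C & forall x, 0 <= u x <= C.

(** For [u = 1] and [t = exp (- s)] this is the [Z(s)] of the overview. In the application [u] is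
    the absolute value of f at the endpoints. *)
Definition tail_sum u t := \sum_(x \in [set: T]) cut t (u x * d x).

Lemma bounded_weight_kap u i : bounded_weight u -> bounded_weight (u \o kap i).
Proof. by case=> C C0 CP; exists C => // x; apply: CP. Qed.

Lemma weighted_vanish u t : bounded_weight u -> 0 < t ->
  finite_set [set x | t <= u x * d x].
Proof.
case=> C C0 CP t0; apply: sub_finite_set (renewal_vanish (divr_gt0 t0 C0)).
move=> x /= /le_trans tx; rewrite ler_pdivrMr // mulrC; apply: tx.
by apply: ler_wpM2r; [exact: ltW|case/andP: (CP x)].
Qed.

Lemma cut_fin u t : bounded_weight u -> 0 < t ->
  finite_set [set x | cut t (u x * d x) != 0].
Proof.
by move=> ub /(weighted_vanish ub); apply: sub_finite_set => x /= /cut_neq0.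
Qed.

(** The type is the disjoint union of [Z] and of the ranges of the injections [kap i]; hence, for
    each [x], exactly one term of the decomposition [E] below can be non-zero. *)
Lemma kap_sum (h : T -> R) : finite_set [set x | h x != 0] ->
  \sum_(x \in [set: T]) h x =
  \sum_(x \in Z) h x + \sum_i \sum_(x \in [set: T]) h (kap i x).
Proof.
move=> hf; set S := [set x | h x != 0].
have hS x : ~ S x -> h x = 0.
  by move=> nS; apply/eqP/negPn/negP => hx; apply: nS.
pose g i x := if x \in range (kap i) then h x else 0.
have E x : h x = (if x \in Z then h x else 0) + \sum_i g i x.
  have [Zx | nZ] := pselect (Z x).
    rewrite mem_set // big1 ?addr0 // => i _; rewrite /g memNset // => -[y _ yx].
    by have /(_ Zx) := (renewal_cover rn x).2 (ex_intro _ i (ex_intro _ y (esym yx))).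
  rewrite memNset // add0r; have /(renewal_cover rn) [i [y xE]] := nZ.
  rewrite (bigD1 i) //= /g mem_set; last by exists y.
  rewrite big1 ?addr0 // => j ji; rewrite memNset // => -[z _].
  by rewrite xE => /(renewal_inj rn) [jE _]; rewrite jE eqxx in ji.
have -> : \sum_(x \in [set: T]) h x =
    \sum_(x <- finmap.enum_fset (fset_set S)) h x.
  by rewrite (fsum_widen hS) fsbig_finite.
rewrite (eq_bigr _ (fun x _ => E x)) big_split exchange_big /=; congr (_ + _).
  rewrite -fsbig_finite // -[LHS]fsum_widen //.
    rewrite [RHS]fsbig_mkcond /=; apply: eq_fsbigr => x _.
    by rewrite /patch; case: ifP.
  by move=> x /hS ->; case: ifP.
apply: eq_bigr => i _; rewrite -fsbig_finite // -fsum_widen; last first.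
  by move=> x /hS hx; rewrite /g hx; case: ifP.
rewrite -(@fsbig_image _ _ _ _ _ [set: T] (kap i) h); last first.
  by move=> x y _ _ /(renewal_inj rn) [].
by rewrite [RHS]fsbig_mkcond.
Qed.

(** The error of replacing [d (kap i x)] by [w i * d x] under the threshold; it is 0 wherever the
    scaling is exact. *)
Let defect u t i x :=
  cut t (u (kap i x) * d (kap i x)) - cut t (u (kap i x) * (w i * d x)).

Let tail_sum_rec u t : bounded_weight u -> 0 < t ->
  tail_sum u t = \sum_i w i * tail_sum (u \o kap i) (t / w i) +
    (\sum_(x \in Z) cut t (u x * d x) +
     \sum_i \sum_(x \in [set: T]) defect u t i x).
Proof.
move=> ub t0; rewrite {1}/tail_sum kap_sum; last exact: cut_fin.
rewrite addrCA; congr (_ + _); rewrite -big_split /=; apply: eq_bigr => i _.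
have ti : 0 < t / w i by rewrite divr_gt0.
have cE x : cut t (u (kap i x) * (w i * d x)) =
    w i * cut (t / w i) ((u \o kap i) x * d x).
  by rewrite mulrCA cutM.
have cf := cut_fin (bounded_weight_kap i ub) ti.
rewrite /defect fsumB; first last.
- apply: sub_finite_set cf => x /=; rewrite cE.
  by apply: contra_neq => ->; rewrite mulr0.
- have := cut_fin ub t0; apply: finite_preimage.
  by move=> x y _ _ /(renewal_inj rn) [].
rewrite [RHS]addrC -[LHS](subrK (w i * tail_sum (u \o kap i) (t / w i))).
congr (_ - _ + _); rewrite /tail_sum -fsumZ //.
by apply: eq_fsbigr => x _; rewrite cE.
Qed.

Let defect_le u t i x : bounded_weight u ->
  `|defect u t i x| <= u (kap i x) * (d (kap i x) + w i * d x).
Proof.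
case=> C C0 CP; have /andP[u0 _] := CP (kap i x).
have a0 : 0 <= u (kap i x) * d (kap i x) by rewrite mulr_ge0 // ltW.
have b0 : 0 <= u (kap i x) * (w i * d x) by rewrite !mulr_ge0 // ltW.
rewrite mulrDr /defect (le_trans (ler_normB _ _)) // lerD //.
  by rewrite ger0_norm ?cut_ge0 // cut_le.
by rewrite ger0_norm ?cut_ge0 // cut_le.
Qed.

(** Both sources of error, [Z] and the exceptions to the scaling, are finite, and [cut] never
    exceeds a non-negative argument. So the error is bounded by finite sums in which [t] does not
    occur. *)
Lemma tail_sum_rec_bounded u : bounded_weight u -> exists K, forall t, 0 < t ->
  `|tail_sum u t - \sum_i w i * tail_sum (u \o kap i) (t / w i)| <= K.
Proof.
move=> ub; have [C C0 CP] := ub.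
pose X i := [set x | d (kap i x) != w i * d x].
exists (\sum_(x \in Z) u x * d x +
  \sum_i \sum_(x \in X i) u (kap i x) * (d (kap i x) + w i * d x)) => t t0.
rewrite tail_sum_rec // [X in X - _]addrC addrK (le_trans (ler_normD _ _)) //.
apply: lerD.
  rewrite !fsbig_finite; [|exact: renewal_finZ rn..].
  rewrite (le_trans (ler_norm_sum _ _ _)) //; apply: ler_sum => x _.
  have h0 : 0 <= u x * d x by rewrite mulr_ge0 ?(ltW (d0 x)) //; case/andP: (CP x).
  by rewrite ger0_norm ?cut_ge0 // cut_le.
rewrite (le_trans (ler_norm_sum _ _ _)) //; apply: ler_sum => i _.
rewrite (@fsum_widen _ _ _ (X i)); last first.
  move=> x nX; rewrite /defect.
  have -> : d (kap i x) = w i * d x by apply/eqP/negPn/negP.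
  by rewrite subrr.
rewrite !fsbig_finite; [|exact: renewal_fin rn i..].
rewrite (le_trans (ler_norm_sum _ _ _)) //; apply: ler_sum => x _.
exact: defect_le.
Qed.

Definition renewal_mass : R := \sum_(x \in Z) d x +
  \sum_i \sum_(x \in [set: T]) (d (kap i x) - w i * d x).

(** The slope for which [c s] solves the equation of the overview: since the weights sum to 1,
    inserting it leaves [c * \sum_i w i * l_i = renewal_mass] with [l_i = ln (1 / w i)]. *)
Definition renewal_rate : R := renewal_mass / \sum_i w i * ln (1 / w i).

Lemma bounded_weight_cst b : 0 <= b -> bounded_weight (fun=> b).
Proof.
move=> b0; exists (b + 1) => [|_]; first by rewrite ltr_wpDl.
by rewrite b0 lerDl ler01.
Qed.

(** Once [t] is below [d] on [Z] and below both terms of each non-zero defect, the threshold no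
    longer acts on these finitely many values, and the error term is the constant [renewal_mass]. *)
Let tail_sum_rec_exact : exists2 t0, 0 < t0 & forall t, 0 < t <= t0 ->
  tail_sum (fun=> 1) t =
  \sum_i w i * tail_sum (fun=> 1) (t / w i) + renewal_mass.
Proof.
have [c1 c10 c1P] := finite_set_lb (renewal_finZ rn) d0.
have /boolp.choice [c2 c2P] : forall i, exists c2, 0 < c2 /\
    forall x, d (kap i x) != w i * d x -> c2 <= d (kap i x).
  move=> i.
  have [c ? cP] := finite_set_lb (renewal_fin rn i) (fun x => d0 (kap i x)).
  by exists c; split => // x; apply: cP.
have /boolp.choice [c3 c3P] : forall i, exists c3, 0 < c3 /\
    forall x, d (kap i x) != w i * d x -> c3 <= w i * d x.
  move=> i.
  have [c ? cP] := finite_set_lb (renewal_fin rn i) (fun x => mulr_gt0 (w0 i) (d0 x)).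
  by exists c; split => // x; apply: cP.
have all0 A : finite_set A -> forall f : 'I_n -> R, (forall i, 0 < f i) ->
    exists2 c, 0 < c & forall i, A i -> c <= f i.
  by move=> Af f f0; apply: finite_set_lb.
have [b2 b20 b2P] := all0 _ (@finite_finset _ [set: 'I_n]) c2 (fun i => (c2P i).1).
have [b3 b30 b3P] := all0 _ (@finite_finset _ [set: 'I_n]) c3 (fun i => (c3P i).1).
exists (Num.min c1 (Num.min b2 b3)); first by rewrite !lt_min c10 b20 b30.
move=> t; rewrite !le_min => /and4P[t0 tc1 tb2 tb3].
rewrite tail_sum_rec //; last exact: bounded_weight_cst.
congr (_ + (_ + _)).
  apply: eq_fsbigr => x /set_mem xZ.
  by rewrite mul1r cut_id // (le_trans tc1) // c1P.
apply: eq_bigr => i _; apply: eq_fsbigr => x _; rewrite /defect !mul1r.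
have [-> | ne] := eqVneq (d (kap i x)) (w i * d x); first by rewrite !subrr.
rewrite !cut_id //.
  by rewrite (le_trans tb3) // (le_trans (b3P i I)) // (c3P i).2.
by rewrite (le_trans tb2) // (le_trans (b2P i I)) // (c2P i).2.
Qed.

Let entropy_gt0 : (0 < n)%N -> 0 < \sum_i w i * ln (1 / w i).
Proof.
move=> n0; rewrite (bigD1 (Ordinal n0)) //= ltr_pwDl //.
  rewrite mulr_gt0 // ln_gt0 // ltr_pdivlMr // mul1r.
  by case/andP: (renewal_w01 rn (Ordinal n0)).
apply: sumr_ge0 => i _; rewrite mulr_ge0 ?ltW // ln_gt0 // ltr_pdivlMr // mul1r.
by case/andP: (renewal_w01 rn i).
Qed.

Let n_gt0 : (0 < n)%N.
Proof.
have := renewal_w1 rn; case: {+}n w => // w'.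
by rewrite big_ord0 => /esym/eqP; rewrite oner_eq0.
Qed.

Lemma tail_sum_ge0 u t : bounded_weight u -> 0 <= tail_sum u t.
Proof.
case=> C _ CP; apply: fsumr_ge0 => x _; apply: cut_ge0.
by rewrite mulr_ge0 // ?(ltW (d0 x)) //; case/andP: (CP x).
Qed.

Lemma tail_sum_le u v t : bounded_weight u -> bounded_weight v -> 0 < t ->
  (forall x, u x <= v x) -> tail_sum u t <= tail_sum v t.
Proof.
move=> ub vb t0 uv; apply: ler_fsum; [exact: cut_fin..|] => x.
case: ub => C _ CP; case/andP: (CP x) => u0 _.
apply: ler_cut; first by rewrite mulr_ge0 // ltW.
by apply: ler_wpM2r; [exact: ltW|exact: uv].
Qed.

Lemma tail_sum_decr u s t : bounded_weight u -> 0 < s -> s <= t ->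
  tail_sum u t <= tail_sum u s.
Proof.
move=> ub s0 st; apply: ler_fsum; [|exact: cut_fin|].
  by apply: cut_fin => //; apply: lt_le_trans st.
move=> x; case: ub => C _ CP; case/andP: (CP x) => u0 _.
by apply: ler_cutl => //; rewrite mulr_ge0 // ltW.
Qed.

(* With [t = exp (- s)] and [w i = exp (- l i)] the difference with the linear
   solution satisfies [Y s = sum_i w_i Y (s - l_i)] for large [s], so a bound on
   an initial segment propagates. *)
Lemma tail_sum1_asymp U : exists K, forall t, 0 < t <= U ->
  `|tail_sum (fun=> 1) t + renewal_rate * ln t| <= K.
Proof.
have [t0 t00 t0P] := tail_sum_rec_exact.
have [C C0 CP] := ord_ub (fun i => t0 / w i).
have b1 : bounded_weight (fun=> 1 : R) by exact: bounded_weight_cst.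
(* [V] dominates every [t0 / w i], as induction on scales requires, and [U], up to which the bound
   is claimed. *)
pose V := Num.max C U.
pose K := tail_sum (fun=> 1) t0 +
  `|renewal_rate| * (`|ln t0| + `|ln V|).
exists K => t /andP[tp tU].
have V0 : 0 < V by rewrite lt_max C0.
suff : forall s, 0 < s <= V -> `|tail_sum (fun=> 1) s + renewal_rate * ln s| <= K.
  by apply; rewrite tp /V le_max tU orbT.
apply: (scale_induction (renewal_w01 rn) t00) => {tp tU t} [i | t /andP[tt0 tV] | ].
- by rewrite le_max CP.
- have tp : 0 < t by apply: lt_le_trans tt0.
  rewrite (le_trans (ler_normD _ _)) // lerD //.
    by rewrite ger0_norm ?tail_sum_ge0 // tail_sum_decr.
  rewrite normrM ler_wpM2l //.
  have : ln t0 <= ln t by rewrite ler_ln.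
  have : ln t <= ln V by rewrite ler_ln.
  move: (ler_norm (ln V)) (ler_norm (- ln t0)); rewrite normrN => *.
  by rewrite ler_norml; apply/andP; split; have := normr_ge0 (ln V);
    have := normr_ge0 (ln t0); lra.
move=> t /andP[tp tt0] IH.
have E : tail_sum (fun=> 1) t + renewal_rate * ln t =
    \sum_i w i * (tail_sum (fun=> 1) (t / w i) + renewal_rate * ln (t / w i)).
  rewrite (t0P t); last by rewrite tp ltW.
  under [RHS]eq_bigr do rewrite mulrDr.
  rewrite big_split /= -addrA; congr (_ + _).
  have -> : renewal_mass = renewal_rate * \sum_i w i * ln (1 / w i).
    by rewrite /renewal_rate divfK // gt_eqF // entropy_gt0.
  have lnE : ln t = \sum_i w i * ln t by rewrite -mulr_suml (renewal_w1 rn) mul1r.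
  rewrite -mulrDr [in LHS]lnE -big_split /=.
  rewrite mulr_sumr; apply: eq_bigr => i _.
  by rewrite div1r lnV ?posrE // ln_div ?posrE //; ring.
rewrite E (le_trans (ler_norm_sum _ _ _)) // -[leRHS]mul1r -[X in _ <= X * _](renewal_w1 rn).
rewrite mulr_suml; apply: ler_sum => i _.
by rewrite normrM gtr0_norm // ler_pM2l.
Qed.

(** A constant weight [b > 0] is a change of level by [cutM], and [ln (t / b)] differs from [ln t]
    by a constant. For [b = 0] the sum is empty because [t] is positive. *)
Let tail_sum_cst_asymp b U : 0 <= b -> exists K, forall t, 0 < t <= U ->
  `|tail_sum (fun=> b) t + renewal_rate * b * ln t| <= K.
Proof.
rewrite le_eqVlt => /orP[/eqP <- | b0].
  exists 0 => t /andP[t0 _]; rewrite mulr0 mul0r addr0 /tail_sum fsbig1 ?normr0 //.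
  by move=> x _; rewrite mul0r /cut leNgt t0.
have [K KP] := tail_sum1_asymp (U / b).
exists (b * (K + `|renewal_rate * ln b|)) => t /andP[t0 tU].
have tb0 : 0 < t / b by rewrite divr_gt0.
have -> : tail_sum (fun=> b) t = b * tail_sum (fun=> 1) (t / b).
  rewrite /tail_sum -fsumZ; last by apply: cut_fin => //; exact: bounded_weight_cst.
  by apply: eq_fsbigr => x _; rewrite mul1r cutM.
have -> : b * tail_sum (fun=> 1) (t / b) + renewal_rate * b * ln t =
   b * ((tail_sum (fun=> 1) (t / b) + renewal_rate * ln (t / b)) +
       renewal_rate * ln b).
  by rewrite ln_div ?posrE //; ring.
rewrite normrM gtr0_norm // ler_pM2l // (le_trans (ler_normD _ _)) // lerD2r.
by apply: KP; rewrite tb0 ler_pM2r ?invr_gt0.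
Qed.

(** The sum over all words of length [k] of the product of the weights times the value of [u] at the
    image of [x0] under the word. *)
Fixpoint wavg (x0 : T) (k : nat) (u : T -> R) : R :=
  if k is k'.+1 then \sum_i w i * wavg x0 k' (u \o kap i) else u x0.

(** On every piece of generation [k], [u] stays within [eps] of its value at the image of [x0] in
    that piece. *)
Fixpoint level_osc (x0 : T) (k : nat) (u : T -> R) (eps : R) : Prop :=
  if k is k'.+1 then forall i, level_osc x0 k' (u \o kap i) eps
  else forall x, `|u x - u x0| <= eps.

(** At level 0 the weight is squeezed between two constants. Each further level costs a bounded
    error, while the coefficient of [ln t] is averaged with total weight 1, so its error [eps] does
    not accumulate. [U] is arbitrary because the recursion passes from [t <= U] to
    [t / w i <= U / w i]. *)
Lemma tail_sum_asymp x0 k u eps U : bounded_weight u -> 0 <= eps ->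
  level_osc x0 k u eps ->
  exists K, forall t, 0 < t <= U ->
  `|tail_sum u t + renewal_rate * wavg x0 k u * ln t|
    <= `|renewal_rate| * eps * `|ln t| + K.
Proof.
move=> ub e0; elim: k u ub U => [|k IH] u ub U /=.
  move=> uosc; set v := u x0.
  have v0 : 0 <= v by case: ub => C _ /(_ x0) /andP[].
  (* The lower constant is cut off at 0 because weights have to be non-negative. *)
  pose a := Num.max (v - eps) 0.
  have a0 : 0 <= a by rewrite le_max lexx orbT.
  have b0 : 0 <= v + eps by rewrite addr_ge0.
  have [K1 K1P] := tail_sum_cst_asymp U a0.
  have [K2 K2P] := tail_sum_cst_asymp U b0.
  exists (K1 + K2) => t tU; have /andP[t0 _] := tU.
  have := K2P t tU; have := K1P t tU; rewrite !ler_norml => /andP[h1 _] /andP[_ h2].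
  have K10 : 0 <= K1 by apply: le_trans (K1P t tU).
  have K20 : 0 <= K2 by apply: le_trans (K2P t tU).
  have l1 : tail_sum (fun=> a) t <= tail_sum u t.
    apply: tail_sum_le => //; first exact: bounded_weight_cst.
    move=> x; rewrite ge_max; case: (ub) => C _ /(_ x) /andP[-> _]; rewrite andbT.
    by have := uosc x; rewrite ler_norml => /andP[+ _]; rewrite /v => ?; lra.
  have l2 : tail_sum u t <= tail_sum (fun=> v + eps) t.
    apply: tail_sum_le => //; first exact: bounded_weight_cst.
    by move=> x; have := uosc x; rewrite ler_norml => /andP[_]; rewrite /v => ?; lra.
  have dist c' : `|c' - v| <= eps ->
      `|renewal_rate * c' * ln t - renewal_rate * v * ln t| <=
      `|renewal_rate| * eps * `|ln t|.
    move=> h; rewrite -mulrBl -mulrBr !normrM.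
    by rewrite ler_wpM2r // ler_wpM2l.
  have /dist : `|a - v| <= eps.
    by rewrite /a; case: (leP (v - eps) 0) => ?; rewrite ler_norml; lra.
  have /dist : `|v + eps - v| <= eps by rewrite addrC addKr ger0_norm.
  rewrite !ler_norml => /andP[g1 g2] /andP[g3 g4].
  by apply/andP; split; lra.
move=> uosc; have [K0 K0P] := tail_sum_rec_bounded ub.
have /boolp.choice [K KP] : forall i, exists K, forall t, 0 < t <= U / w i ->
   `|tail_sum (u \o kap i) t + renewal_rate * wavg x0 k (u \o kap i) * ln t|
    <= `|renewal_rate| * eps * `|ln t| + K.
  move=> i; by apply: IH; [exact: bounded_weight_kap | exact: uosc].
exists (K0 + \sum_i w i * (`|renewal_rate * wavg x0 k (u \o kap i) * ln (w i)| +
  `|renewal_rate| * eps * `|ln (w i)| + K i)) => t /andP[t0 tU].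
have E : tail_sum u t +
    renewal_rate * (\sum_i w i * wavg x0 k (u \o kap i)) * ln t =
  (tail_sum u t - \sum_i w i * tail_sum (u \o kap i) (t / w i)) +
  \sum_i w i * ((tail_sum (u \o kap i) (t / w i) +
       renewal_rate * wavg x0 k (u \o kap i) * ln (t / w i)) +
       renewal_rate * wavg x0 k (u \o kap i) * ln (w i)).
  rewrite mulr_sumr mulr_suml -[RHS]addrA; congr (_ + _).
  rewrite -sumrN -big_split /=; apply: eq_bigr => i _.
  by rewrite ln_div ?posrE //; ring.
rewrite E (le_trans (ler_normD _ _)) // addrCA lerD ?K0P //.
rewrite (le_trans (ler_norm_sum _ _ _)) //.
rewrite -[`|renewal_rate| * eps * _]mul1r -[X in _ <= X * _ + _](renewal_w1 rn).
rewrite mulr_suml -big_split /=.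
apply: ler_sum => i _; rewrite normrM gtr0_norm // -mulrDr ler_pM2l //.
rewrite (le_trans (ler_normD _ _)) // addrCA [leRHS]addrC addrA.
have tw : 0 < t / w i <= U / w i by rewrite divr_gt0 // ler_pM2r ?invr_gt0.
have := KP i _ tw.
have : `|ln (t / w i)| <= `|ln t| + `|ln (w i)|.
  by rewrite ln_div ?posrE // ler_normB.
move=> /(ler_wpM2l (mulr_ge0 (normr_ge0 renewal_rate) e0)).
rewrite mulrDr; set X := _ * ln (t / w i); move: X => X.
by lra.
Qed.

End Renewal.

(** * Iterated weighted means and logarithmic averages *)

Section WeightedMean.
Context {R : realType} {T : choiceType} {n : nat}.
Context (kap : 'I_n -> T -> T) (w : 'I_n -> R) (x0 : T).
Context (w0 : forall i, 0 <= w i) (w1 : \sum_i w i = 1).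
Implicit Types u v : T -> R.
Local Notation wavg := (wavg kap w x0).
Local Notation level_osc := (level_osc kap x0).

Lemma weighted_dist (a b : 'I_n -> R) e :
  (forall i, `|a i - b i| <= e) ->
  `|\sum_i w i * a i - \sum_i w i * b i| <= e.
Proof.
move=> ab; rewrite -sumrB (le_trans (ler_norm_sum _ _ _)) //.
rewrite -[leRHS]mul1r -w1 mulr_suml; apply: ler_sum => i _.
by rewrite -mulrBr normrM ger0_norm // ler_wpM2l.
Qed.

Lemma wavg_dist j u (v : R) e : (forall x, `|u x - v| <= e) -> `|wavg j u - v| <= e.
Proof.
elim: j u => [|j IH] u uv //=.
rewrite -[v]mul1r -w1 mulr_suml; apply: weighted_dist => i.
by apply: IH => x; apply: uv.
Qed.

(** Averaging further inside pieces on which [u] varies by at most [e] cannot move the mean by more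
    than [e]; this is the Cauchy property of the averages. *)
Lemma wavg_level_osc k j u e : level_osc k u e ->
  `|wavg (k + j) u - wavg k u| <= e.
Proof.
elim: k u => [|k IH] u /=; first exact: wavg_dist.
by move=> uosc; apply: weighted_dist => i; apply: IH.
Qed.

Lemma wavg_lincomb a u v k :
  wavg k (fun x => a * u x + v x) = a * wavg k u + wavg k v.
Proof.
elim: k u v => [|k IH] u v //=.
rewrite mulr_sumr -big_split /=; apply: eq_bigr => i _.
by rewrite (IH (u \o kap i) (v \o kap i)); ring.
Qed.

Definition vanishing_osc u := forall e, 0 < e -> exists k, level_osc k u e.

Lemma wavg_cvg u : vanishing_osc u -> cvgn (fun k => wavg k u).
Proof.
move=> uv; apply/cauchy_cvgP/cauchy_exP => e e0.
have [k ku] := uv _ (divr_gt0 e0 (ltr0n _ 2)).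
exists (wavg k u); exists k => // i ki.
have := wavg_level_osc (i - k) ku; rewrite subnKC // distrC /ball /= => hi.
by apply: le_lt_trans hi _; rewrite ltr_pdivrMr // ltr_pMr // ltr1n.
Qed.

(** The integral of [u] in discrete form, defined with no measure at hand; [mean_integral]
    identifies it with the integral against any self-similar measure with weights [w]. *)
Definition wmean u := limn (fun k => wavg k u).

Lemma wmean_dist k u e : 0 < e -> vanishing_osc u -> level_osc k u e ->
  `|wavg k u - wmean u| <= e.
Proof.
move=> e0 uv ku; have uc := wavg_cvg uv.
have near_k : \forall j \near \oo, `|wavg j u - wavg k u| <= e.
  exists k => // j kj; rewrite -(subnKC kj); exact: wavg_level_osc.
have ->  : `|wavg k u - wmean u| = limn (fun j => `|wavg j u - wavg k u|).
  rewrite distrC; apply/esym/cvg_lim => //.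
  by apply: cvg_norm; apply: cvgB => //; exact: cvg_cst.
apply: limr_le => //.
by apply: is_cvg_norm; apply: is_cvgB => //; exact: is_cvg_cst.
Qed.

Lemma wmean_lincomb a u v : vanishing_osc u -> vanishing_osc v ->
  wmean (fun x => a * u x + v x) = a * wmean u + wmean v.
Proof.
move=> uv vv; apply/cvg_lim => //.
under eq_fun do rewrite wavg_lincomb.
apply: cvgD; last exact: wavg_cvg.
by apply: cvgM; [exact: cvg_cst | exact: wavg_cvg].
Qed.

End WeightedMean.

Lemma tail_sum_wmean (R : realType) (T : choiceType) (n : nat)
    (kap : 'I_n -> T -> T) (w : 'I_n -> R) (d : T -> R) (Z : set T) (x0 : T)
    (u : T -> R) :
  renewal kap w d Z -> bounded_weight u -> vanishing_osc kap x0 u ->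
  forall e, 0 < e -> exists K, forall t, 0 < t <= 1 ->
    `|tail_sum d u t - renewal_rate kap w d Z * wmean kap w x0 u * - ln t|
      <= e * - ln t + K.
Proof.
move=> rn ub uv e e0; set c := renewal_rate kap w d Z.
have d0 : 0 < `|c| + 1 by rewrite ltr_wpDl.
(* Two errors of size [|c| * e'] occur, one from the oscillation and one from replacing [wavg] by
   its limit. The added 1 guards against [c = 0]. *)
pose e' := e / (2 * (`|c| + 1)).
have e'0 : 0 < e' by rewrite divr_gt0 // mulr_gt0.
have [k ku] := uv _ e'0.
have [K KP] := tail_sum_asymp rn 1 ub (ltW e'0) ku.
exists K => t t01; have := KP t t01; rewrite -/c; have /andP[t0 t1] := t01.
have lt : 0 <= - ln t by rewrite oppr_ge0 ln_le0.
have -> : `|ln t| = - ln t by rewrite ler0_norm // -oppr_ge0.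
have w0 i : 0 <= w i by case/andP: (renewal_w01 rn i) => /ltW.
have := wmean_dist w0 (renewal_w1 rn) e'0 uv ku.
move: (wavg _ _ _ _ _) (wmean _ _ _ _) lt => a b lt ab h.
have : `|c * (a - b) * - ln t| <= `|c| * e' * - ln t.
  by rewrite !normrM [X in _ * X]ger0_norm // ler_wpM2r // ler_wpM2l.
have : 2 * (`|c| * e') * - ln t <= e * - ln t.
  rewrite ler_wpM2r // /e' invfM.
  have -> : 2 * (`|c| * (e * (2^-1 * (`|c| + 1)^-1))) = e * (`|c| / (`|c| + 1)).
    by field; rewrite gt_eqF.
  by rewrite ger_pMr // ler_pdivrMr // mul1r lerDl.
move=> g1; rewrite ler_norml => /andP[g2 g3]; move: h.
rewrite !ler_norml => /andP[h1 h2].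
by apply/andP; split; lra.
Qed.

(** * From sums cut at a level to sums of the first N terms *)

Section Rearrangement.
Context {R : realType} {T : choiceType}.
Implicit Types (h : T -> R) (s : nat -> R).

(* The last clause is strict so that a supremum such as [sing] satisfies it
   whether or not it is attained. *)
Definition rearranged h s : Prop :=
  [/\ forall k, 0 <= s k,
      forall k t, 0 <= t -> (exists e : 'I_k.+1 -> T,
        injective e /\ forall i, t <= h (e i)) -> t <= s k
    & forall k t, 0 < t < s k -> exists e : 'I_k.+1 -> T,
        injective e /\ forall i, t <= h (e i)].

(** [a] is the number of points with [h] at least [t]; listed in decreasing order of [h], their
    values are exactly [s 0], ..., [s (a - 1)]. The first clause bounds [a] by the cut sum. *)
Lemma rearranged_sum h s t : rearranged h s -> 0 < t ->
  finite_set [set x | t <= h x] -> exists a : nat,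
  [/\ a%:R * t <= \sum_(x \in [set: T]) cut t (h x),
      \sum_(k < a) s k = \sum_(x \in [set: T]) cut t (h x)
    & forall k, (a <= k)%N -> s k <= t].
Proof.
move=> [s0 s1 s2] t0 Afin; set A := [set x | t <= h x] in Afin *.
pose l := sort (fun x y => h y <= h x) (finmap.enum_fset (fset_set A)).
have l_uniq : uniq l by rewrite sort_uniq finmap.fset_uniq.
have lA x : (x \in l) = (t <= h x).
  by rewrite mem_sort in_fset_set // mem_setE.
have l_sorted : sorted (fun x y => h y <= h x) l.
  by apply: sort_sorted => x y; exact: le_total.
have tr : transitive (fun x y => h y <= h x).
  by move=> y x z yx zy; apply: le_trans yx.
have sumE : \sum_(x \in [set: T]) cut t (h x) = \sum_(x <- l) h x.
  rewrite (@fsum_widen _ _ _ A); last first.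
    by move=> x /= /negP; rewrite /cut => /negbTE ->.
  rewrite fsbig_finite // (perm_big l) /=; last by rewrite perm_sym perm_sort.
  by apply: eq_big_seq => x; rewrite lA => /cut_id.
have skE x1 k : (k < size l)%N -> s k = h (nth x1 l k).
  move=> kl; have hk : t <= h (nth x1 l k) by rewrite -lA mem_nth.
  have mono i j : (i <= j)%N -> (j < size l)%N -> h (nth x1 l j) <= h (nth x1 l i).
    move=> ij jl; apply: (sorted_leq_nth tr _ x1 l_sorted) => //=.
    by rewrite inE (leq_ltn_trans ij).
  apply/eqP; rewrite eq_le; apply/andP; split; last first.
    apply: s1; first exact: le_trans (ltW t0) hk.
    exists (fun i : 'I_k.+1 => nth x1 l i); split=> [i j /eqP|i].
      have ltl (m : 'I_k.+1) : (m < size l)%N by rewrite (leq_ltn_trans _ kl) // -ltnS.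
      by rewrite nth_uniq // => /eqP/val_inj.
    by apply: mono => //; rewrite -ltnS.
  rewrite leNgt; apply/negP => lt_k.
  pose t' := (h (nth x1 l k) + s k) / 2.
  have [e [e_inj eP]] : exists e : 'I_k.+1 -> T,
      injective e /\ forall i, t' <= h (e i).
    by apply: s2; rewrite /t'; apply/andP; split; lra.
  (* If [s k] were larger than the value at position [k], then [k + 1] distinct points would lie
     strictly above that value; only the [k] earlier positions of the sorted list are available to
     them. *)
  have : (size (map e (enum 'I_k.+1)) <= size (take k l))%N.
    apply: uniq_leq_size; first by rewrite map_inj_uniq ?enum_uniq.
    move=> _ /mapP[i _ ->].
    have ht : h (nth x1 l k) < h (e i).
      by apply: lt_le_trans (eP i); rewrite /t'; lra.
    have el : e i \in l by rewrite lA (le_trans hk) // ltW.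
    rewrite -(nth_index x1 el) in ht.
    rewrite in_take // ltnNge; apply/negP => ki.
    by move: ht; rewrite ltNge mono // index_mem.
  by rewrite size_map size_enum_ord size_takel ?ltnn // ltnW.
exists (size l); split.
- rewrite sumE mulr_natl -iter_addr_0 -count_predT -big_const_seq.
  by rewrite big_seq [leRHS]big_seq; apply: ler_sum => x; rewrite lA.
- rewrite sumE; case: (l) skE => [|x1 l'] skE; first by rewrite big_ord0 big_nil.
  rewrite (big_nth x1) big_mkord; apply: eq_bigr => i _; exact: skE.
move=> k lk; rewrite leNgt; apply/negP => tk.
have [e [e_inj eP]] := s2 k t (ltac:(by rewrite t0 tk)).
have : (size (map e (enum 'I_k.+1)) <= size l)%N.
  apply: uniq_leq_size; first by rewrite map_inj_uniq ?enum_uniq.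
  by move=> _ /mapP[i _ ->]; rewrite lA.
by rewrite size_map size_enum_ord leqNgt ltnS lk.
Qed.

(** Write M for [N.+2]. Upper bound: at level [t = 1 / M] the terms below the cut add at most
    [M * t = 1]. Lower bound: at level [t = M^(-(1-e))] the number of terms above the cut is at most
    the cut sum over [t]; the cut sum is O(log M), hence below [M * t = M^e] for large M. So all
    these terms are among the first M, and their sum is about [(1 - e) L log M]. *)
Lemma rearranged_log_average h s L : rearranged h s ->
  (forall t, 0 < t -> finite_set [set x | t <= h x]) ->
  (forall e, 0 < e -> exists K, forall t, 0 < t <= 1 ->
    `|\sum_(x \in [set: T]) cut t (h x) - L * - ln t| <= e * - ln t + K) ->
  (fun N => (\sum_(k < N.+2) s k) / ln (N.+2%:R)) @ \oo --> L.
Proof.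
move=> hs hfin hL; have [s0 _ _] := hs.
have lnN0 N : 0 < ln (N.+2%:R : R) by rewrite ln_gt0 // ltr1n.
have lnN_big B : \forall N \near \oo, B <= ln (N.+2%:R : R).
  near=> N; have : expR B <= N%:R by near: N; exact: nbhs_infty_ger.
  move=> h1; rewrite -[B]expRK ler_ln ?posrE ?expR_gt0 //.
  by rewrite (le_trans h1) // ler_nat -addn2 leq_addr.
have upper e : 0 < e -> \forall N \near \oo,
    (\sum_(k < N.+2) s k) / ln (N.+2%:R) <= L + e.
  move=> e0; have e20 : 0 < e / 2 by rewrite divr_gt0.
  have [K KP] := hL _ e20; have big := lnN_big ((K + 1) / (e / 2)).
  near=> N; rewrite ler_pdivrMr //.
  have : (K + 1) / (e / 2) <= ln (N.+2%:R : R) by near: N.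
  rewrite ler_pdivrMr // => hN.
  pose t := (N.+2%:R : R)^-1.
  have t0 : 0 < t by rewrite invr_gt0.
  have t1 : t <= 1 by rewrite invf_le1 // ler1n.
  have lt : - ln t = ln (N.+2%:R) by rewrite /t lnV ?posrE // opprK.
  have := KP t; rewrite t0 t1 lt ler_norml => /(_ isT) /andP[_ hG].
  have [a [_ sa sk]] := rearranged_sum hs t0 (hfin _ t0).
  have : \sum_(k < N.+2) s k <= \sum_(x \in [set: T]) cut t (h x) + 1.
    rewrite -sa; have Nt : N.+2%:R * t = 1 by rewrite /t mulfV.
    rewrite -!(big_mkord xpredT s).
    have [Na | /ltnW aN] := leqP N.+2 a.
      rewrite (big_cat_nat _ Na) //= -[leLHS]addr0 -addrA lerD2l addr_ge0 //.
      by apply: sumr_ge0.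
    rewrite (big_cat_nat _ aN) //= lerD2l.
    apply: (@le_trans _ _ (\sum_(a <= i < N.+2) t)).
      rewrite big_nat_cond [leRHS]big_nat_cond; apply: ler_sum => i.
      by rewrite andbT => /andP[/sk].
    rewrite sumr_const_nat -[t *+ _]mulr_natl -[leRHS]Nt ler_pM2r // ler_nat.
    exact: leq_subr.
  by move=> hS; lra.
have lower e : 0 < e < 1 -> \forall N \near \oo,
    (L - e) * (1 - e) - e <= (\sum_(k < N.+2) s k) / ln (N.+2%:R).
  move=> /andP[e0 e1].
  have [K1 K1P] := hL _ ltr01; have [K KP] := hL _ e0.
  pose B := (`|L| + 1) + `|K1|.
  (* With [X = ln (N.+2)], the first bound gives [B * X <= (e * X) ^+ 2 / 2 <= expR (e * X)], the
     second absorbs [K] into [e * X], and the third gives [1 <= X], which lets [B * X] dominate the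
     cut sum. *)
  have big := lnN_big (Num.max (2 * B / (e * e)) (Num.max (`|K| / e) 1)).
  near=> N; rewrite ler_pdivlMr //.
  have : Num.max (2 * B / (e * e)) (Num.max (`|K| / e) 1) <= ln (N.+2%:R : R).
    by near: N.
  rewrite !ge_max !ler_pdivrMr ?mulr_gt0 // => /and3P[hN1 hN2 hN3].
  set X := ln (N.+2%:R : R) in hN1 hN2 hN3 *.
  have X0 : 0 < X by exact: lt_le_trans hN3.
  pose t := expR (- ((1 - e) * X)).
  have t0 : 0 < t by rewrite expR_gt0.
  have eX : 0 <= (1 - e) * X by rewrite mulr_ge0 // ?subr_ge0 ltW.
  have t1 : t <= 1 by rewrite -expR0 ler_expR oppr_le0.
  have lt : - ln t = (1 - e) * X by rewrite /t expRK opprK.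
  have := KP t; rewrite t0 t1 lt ler_norml => /(_ isT) /andP[hG _].
  have := K1P t; rewrite t0 t1 lt ler_norml => /(_ isT) /andP[_ hG1].
  have [a [ta sa sk]] := rearranged_sum hs t0 (hfin _ t0).
  have aN : (a <= N.+2)%N.
    rewrite -(ler_nat R) -(ler_pM2r t0) (le_trans ta) //.
    have -> : N.+2%:R * t = expR (e * X).
      by rewrite -[N.+2%:R](@lnK R) ?posrE // -/X /t -expRD; congr expR; ring.
    have hB : \sum_(x \in [set: T]) cut t (h x) <= B * X.
      have := ler_norm K1; have := ler_norm L => l1 l2.
      have : L * ((1 - e) * X) <= `|L| * X.
        apply: (@le_trans _ _ (`|L| * ((1 - e) * X))); first by rewrite ler_wpM2r.
        by rewrite ler_wpM2l // ger_pMl //; lra.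
      have : `|K1| <= `|K1| * X by rewrite ler_peMr.
      have : 0 <= e * X by rewrite mulr_ge0 // ltW.
      by rewrite /B => *; nra.
    apply: (le_trans hB); apply: (@le_trans _ _ ((e * X) ^+ 2 / 2)).
      by have := ler_wpM2r (ltW X0) hN1; lra.
    have eX0 : 0 <= e * X by rewrite mulr_ge0 // ltW.
    by have := @expR_ge1Dxn R (e * X) 1 eX0; rewrite (_ : 2`!%:R = 2) //; lra.
  have hS : \sum_(x \in [set: T]) cut t (h x) <= \sum_(k < N.+2) s k.
    rewrite -sa -!(big_mkord xpredT s) (big_cat_nat _ aN) //= lerDl.
    exact: sumr_ge0.
  have : K <= e * X by rewrite mulrC (le_trans _ hN2) // ler_norm.
  by move: hS hG; lra.
apply/cvgrPdist_le => e e0.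
(* Expanding [(L - e') * (1 - e') - e'] shows a loss of at most [e' * (|L| + 2)] against [L]; the
   [1 / 2] keeps [e'] below 1. *)
pose e' := Num.min (1 / 2) (e / (`|L| + 3)).
have L3 : 0 < `|L| + 3 by rewrite ltr_wpDl.
have e'0 : 0 < e' by rewrite lt_min !divr_gt0.
have e'1 : e' < 1 by rewrite gt_min; apply/orP; left; lra.
have e'e : e' * (`|L| + 3) <= e by rewrite -ler_pdivlMr // ge_min lexx orbT.
have lowe := lower e' (ltac:(by rewrite e'0 e'1)); have uppe := upper e e0.
near=> N; rewrite distrC ler_norml; apply/andP; split; last first.
  by rewrite lerBlDl; near: N.
rewrite lerBrDl; apply: (@le_trans _ _ ((L - e') * (1 - e') - e')); last by near: N.
have : 0 <= e' * e' by rewrite mulr_ge0 // ltW.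
have := ler_norm L; have : e' * L <= e' * `|L| by rewrite ler_wpM2l ?ler_norm // ltW.
by nra.
Unshelve. all: by end_near.
Qed.

End Rearrangement.

(** * Diagonal operators *)

Section Normc.
Context {R : rcfType}.
Local Notation normc := (@Normc.normc R).
Implicit Types z w : R[i].

Lemma normc_ge0 z : 0 <= normc z.
Proof. by case: z => a b; exact: sqrtr_ge0. Qed.

Lemma normcE2 z : normc z ^+ 2 = complex.Re z ^+ 2 + complex.Im z ^+ 2.
Proof. by case: z => a b; rewrite sqr_sqrtr // addr_ge0 // sqr_ge0. Qed.

Lemma normC z : `|z| = (normc z)%:C.
Proof. by case: z => a b; rewrite normc_def. Qed.

Lemma normcJ z : normc z^*%C = normc z.
Proof. by case: z => a b /=; rewrite sqrrN. Qed.

Lemma mul_conjc z : z * z^*%C = (normc z ^+ 2)%:C.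
Proof. by rewrite -sqr_normc normC -rmorphXn. Qed.

Lemma normc_real (a : R) : normc a%:C = `|a|.
Proof. by rewrite /= expr0n addr0 sqrtr_sqr. Qed.

Lemma normc_sqrD z w : normc (z + w) ^+ 2 <= 2 * normc z ^+ 2 + 2 * normc w ^+ 2.
Proof.
rewrite !normcE2; case: z w => [a b] [c d] /=.
have := sqr_ge0 (a - c); have := sqr_ge0 (b - d); lra.
Qed.

Lemma Re_le_normc z : `|complex.Re z| <= normc z.
Proof.
rewrite -(ler_pXn2r (ltn0Sn 1)) ?nnegrE ?normc_ge0 //.
by rewrite real_normK ?num_real // normcE2 lerDl sqr_ge0.
Qed.

Lemma Im_le_normc z : `|complex.Im z| <= normc z.
Proof.
rewrite -(ler_pXn2r (ltn0Sn 1)) ?nnegrE ?normc_ge0 //.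
by rewrite real_normK ?num_real // normcE2 lerDr sqr_ge0.
Qed.

End Normc.

Section Ell2Facts.
Context {R : realType}.
Local Notation H := (ell2 R).
Local Notation normc := (@Normc.normc R).
Implicit Types (x y : H) (d : site -> R[i]).

Lemma ell2_ext x y : (forall j, x j = y j) -> x = y.
Proof. by move=> xy; apply: val_inj; apply/funext. Qed.

Lemma ell2_fun_lincomb (a : R[i]) x y j : (a *: x + y) j = a * x j + y j.
Proof. by []. Qed.

Lemma ell2_funB x y j : (x - y) j = x j - y j.
Proof. by []. Qed.

Lemma sqsum_ge0 (f : site -> R[i]) : (0 <= sqsum f)%E.
Proof. by apply: esum_ge0 => j _; rewrite lee_fin sqr_ge0. Qed.

Lemma sqsum_fin x : sqsum x \is a fin_num.
Proof. by rewrite ge0_fin_numE ?sqsum_ge0 //; have := ell2P x; rewrite inE. Qed.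

Lemma sqsum_norm x : sqsum x = (ell2_norm x ^+ 2)%:E.
Proof.
rewrite /ell2_norm sqr_sqrtr ?fineK ?sqsum_fin //.
by rewrite fine_ge0 ?sqsum_ge0.
Qed.

Lemma ell2_norm_ge0 x : 0 <= ell2_norm x.
Proof. exact: sqrtr_ge0. Qed.

Lemma sqsum_le_fin (f : site -> R[i]) (B : R) :
  (sqsum f <= B%:E)%E <->
  forall A, finite_set A -> \sum_(j \in A) normc (f j) ^+ 2 <= B.
Proof.
split=> [fB A Af | fB].
  rewrite -lee_fin; apply: le_trans fB; apply: esum_ge.
  by exists A => //; rewrite fsumEFin.
apply: ge_ereal_sup => _ [A [Af _] <-].
by rewrite fsumEFin // lee_fin; apply: fB.
Qed.

Lemma ell2_norm_le x (B : R) : 0 <= B ->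
  (forall A, finite_set A -> \sum_(j \in A) normc (x j) ^+ 2 <= B ^+ 2) ->
  ell2_norm x <= B.
Proof.
move=> B0 /sqsum_le_fin; rewrite sqsum_norm lee_fin.
by rewrite ler_pXn2r // nnegrE ?ell2_norm_ge0.
Qed.

Lemma ell2_norm_ge x A : finite_set A ->
  \sum_(j \in A) normc (x j) ^+ 2 <= ell2_norm x ^+ 2.
Proof.
move=> Af; have : (sqsum x <= (ell2_norm x ^+ 2)%:E)%E by rewrite sqsum_norm.
by move/sqsum_le_fin; apply.
Qed.

Lemma normc_le_ell2_norm x j : normc (x j) <= ell2_norm x.
Proof.
have := ell2_norm_ge x (finite_set1 j); rewrite fsbig_set1.
by rewrite ler_pXn2r // nnegrE ?normc_ge0 ?ell2_norm_ge0.
Qed.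

Definition bounded_diag d := exists2 C, 0 < C & forall j, normc (d j) <= C.

(** Boundedness makes the product square-summable, so [insubd] does not fall back on its default
    0. *)
Lemma diag_opE d x : bounded_diag d -> forall j, diag_op d x j = d j * x j.
Proof.
case=> C C0 dC j; rewrite /diag_op.
have /(insubdK (0 : H)) : ((fun j => d j * x j) : site -> R[i]) \in @sqsummable R.
  rewrite inE /=; apply: (@le_lt_trans _ _ ((C * ell2_norm x) ^+ 2)%:E); last first.
    exact: ltry.
  apply/sqsum_le_fin => A Af.
  apply: le_trans (_ : C ^+ 2 * \sum_(j \in A) normc (x j) ^+ 2 <= _).
    rewrite !fsbig_finite // mulr_sumr; apply: ler_sum => i _.
    by rewrite Normc.normcM exprMn ler_wpM2r ?sqr_ge0 // ler_pXn2r ?nnegrE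
      ?normc_ge0 // ltW.
  by rewrite exprMn ler_wpM2l ?sqr_ge0 ?ell2_norm_ge.
by move=> /(congr1 (fun f : site -> R[i] => f j)).
Qed.

Lemma diag_op_linear d : bounded_diag d -> linear (diag_op d : H -> H).
Proof.
move=> db a x y; apply: ell2_ext => j.
by rewrite ell2_fun_lincomb !diag_opE // ell2_fun_lincomb; ring.
Qed.

Lemma diag_op_norm d C x : 0 < C -> (forall j, normc (d j) <= C) ->
  ell2_norm (diag_op d x) <= C * ell2_norm x.
Proof.
move=> C0 dC; have db : bounded_diag d by exists C.
apply: ell2_norm_le; first by rewrite mulr_ge0 ?ell2_norm_ge0 // ltW.
move=> A Af; apply: le_trans (_ : C ^+ 2 * \sum_(j \in A) normc (x j) ^+ 2 <= _).
  rewrite !fsbig_finite // mulr_sumr; apply: ler_sum => i _.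
  rewrite diag_opE // Normc.normcM exprMn ler_wpM2r ?sqr_ge0 //.
  by rewrite ler_pXn2r ?nnegrE ?normc_ge0 // ltW.
by rewrite exprMn ler_wpM2l ?sqr_ge0 ?ell2_norm_ge.
Qed.

Lemma diag_op_bounded d : bounded_diag d -> bounded_op (diag_op d : H -> H).
Proof.
move=> db; split; first exact: diag_op_linear.
by case: db => C C0 dC; exists C => x; apply: diag_op_norm.
Qed.

Lemma diag_op_comp d d' : bounded_diag d -> bounded_diag d' ->
  diag_op d \o diag_op d' = diag_op (fun j => d j * d' j) :> (H -> H).
Proof.
move=> db db'; have dd' : bounded_diag (fun j => d j * d' j).
  case: db db' => [C C0 dC] [C' C'0 dC']; exists (C * C'); first exact: mulr_gt0.
  by move=> j; rewrite Normc.normcM ler_pM ?normc_ge0.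
by apply/funext => x; apply: ell2_ext => j; rewrite /= !diag_opE // mulrA.
Qed.

Definition basis_vec (k : site) : site -> R[i] := fun j => (j == k)%:R.

Lemma basis_vec_sqsummable k : basis_vec k \in @sqsummable R.
Proof.
rewrite inE /=; apply: (@le_lt_trans _ _ 1%:E); last exact: ltry.
rewrite /sqsum (_ : esum _ _ = \esum_(j in [set k]) 1%:E)%E; last first.
  rewrite [RHS]esum_mkcond; apply: eq_esum => j _; rewrite /basis_vec.
  case: eqP => [-> | ne]; first by rewrite mem_set // Normc.normc1 expr1n.
  by rewrite memNset // Normc.normc0 expr0n.
by rewrite esum_set1.
Qed.

Definition basis k : H := Ell2 (basis_vec_sqsummable k).

Lemma basisE k j : basis k j = (j == k)%:R.
Proof. by []. Qed.

(** [ip] is a [limn], meaningful only under convergence; here the partial sums are eventually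
    constant. *)
Lemma ip_finE x y N : (forall j, (N <= j.1)%N -> x j * conjc (y j) = 0) ->
  ip x y = \sum_(n < N) \sum_(b : bool) x (val n, b) * conjc (y (val n, b)).
Proof.
move=> y0; rewrite /ip; apply: (@norm_lim_near_cst _ (R[i]^o)); exists N => // M NM.
rewrite -!(big_mkord xpredT (fun n => \sum_(b : bool) x (n, b) * conjc (y (n, b)))).
rewrite (big_cat_nat _ NM) //= [X in _ + X]big1_seq ?addr0 // => n.
by rewrite mem_index_iota => /andP[_ /andP[Nn _]]; rewrite big1 // => b _; rewrite y0.
Qed.

Lemma ip_basisr x k : ip x (basis k) = x k.
Proof.
rewrite (@ip_finE _ _ k.1.+1); last first.
  move=> j kj; rewrite /= /basis_vec; case: eqP => [jk | _]; last by rewrite conjc0 mulr0.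
  by rewrite jk ltnn in kj.
rewrite big_ord_recr /= big1 ?add0r; last first.
  move=> i _; rewrite big1 // => b _; rewrite /= /basis_vec.
  case: eqP => [/(congr1 fst) /= ik | _].
    by have := ltn_eqF (ltn_ord i); rewrite ik eqxx.
  by rewrite conjc0 mulr0.
rewrite (bigD1 k.2) //= big1 ?addr0; last first.
  move=> b bk; rewrite /= /basis_vec; case: eqP => [ik | _].
    by move: bk; rewrite -ik eqxx.
  by rewrite conjc0 mulr0.
by rewrite -surjective_pairing /basis_vec eqxx conjc1 mulr1.
Qed.

Lemma ip_basisl k y : ip (basis k) y = conjc (y k).
Proof.
rewrite (@ip_finE _ _ k.1.+1); last first.
  move=> j kj; rewrite /= /basis_vec; case: eqP => [jk | _]; last by rewrite mul0r.
  by rewrite jk ltnn in kj.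
rewrite big_ord_recr /= big1 ?add0r; last first.
  move=> i _; rewrite big1 // => b _; rewrite /= /basis_vec.
  case: eqP => [/(congr1 fst) /= ik | _].
    by have := ltn_eqF (ltn_ord i); rewrite ik eqxx.
  by rewrite mul0r.
rewrite (bigD1 k.2) //= big1 ?addr0; last first.
  move=> b bk; rewrite /= /basis_vec; case: eqP => [ik | _].
    by move: bk; rewrite -ik eqxx.
  by rewrite mul0r.
by rewrite -surjective_pairing /basis_vec eqxx mul1r.
Qed.

(** The two sequences of partial sums agree term by term, so their [limn] agree and convergence need
    not be discussed. *)
Lemma diag_op_adjoint d : bounded_diag d ->
  adjoint_op (diag_op d : H -> H) (diag_op (fun j => conjc (d j))).
Proof.
move=> db x y; have db' : bounded_diag (fun j => conjc (d j)).
  by case: db => C C0 dC; exists C => // j; rewrite normcJ.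
apply: (congr1 (fun F : nat -> R[i]^o => limn F)); apply/funext => N.
apply: eq_bigr => n _; apply: eq_bigr => b _.
by rewrite !diag_opE // rmorphM /= conjcK; ring.
Qed.

Lemma cvg_realC (a : nat -> R) (l : R) : a @ \oo --> l ->
  (fun N => (a N)%:C : R[i]^o) @ \oo --> (l%:C : R[i]^o).
Proof.
move=> /cvgrPdist_lt al; apply/cvgrPdist_lt => e; rewrite ltcE /= => /andP[/eqP eI eR].
have := al _ eR; apply: filterS => N /= h.
rewrite -rmorphB normC normc_real ltcE /= eI eqxx; exact: h.
Qed.

Lemma site_sum N (F : site -> R) :
  \sum_(n < N) \sum_(b : bool) F (val n, b) =
  \sum_(j \in `I_N `*` [set: bool]) F j.
Proof.
transitivity (\sum_(p \in `I_N `*` [set: bool]) F (p.1, p.2)); last first.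
  by apply: eq_fsbigr => -[].
rewrite -(@pair_fsbig _ _ _ _ _ `I_N [set: bool] (fun n b => F (n, b))) //; last exact: finite_finset.
rewrite (fsbig_ord _ _ (fun n => \sum_(b : bool) F (n, b))).
apply: eq_fsbigr => n _; rewrite big_bool.
have -> : [set: bool] = [set` [:: true; false]] by apply/seteqP; split=> [[]|].
by rewrite -fsbig_seq // big_cons big_seq1.
Qed.

(** Here convergence does matter: the partial sums are real, nondecreasing and bounded by
    [C * ell2_norm x ^+ 2], so the limit exists and inherits their sign. *)
Lemma diag_op_positive d : bounded_diag d -> (forall j, 0 <= d j) ->
  positive_op (diag_op d : H -> H).
Proof.
move=> db d0; split; first exact: diag_op_bounded.
move=> x; have [C C0 dC] := db.
pose a n := \sum_(b : bool) complex.Re (d (n, b)) * normc (x (n, b)) ^+ 2.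
have dR j : d j = (complex.Re (d j))%:C.
  by have := d0 j; rewrite lecE => /andP[/eqP]; case: (d j) => u v /= ->.
have R0 j : 0 <= complex.Re (d j) by have := d0 j; rewrite lecE => /andP[].
have a0 n : 0 <= a n by apply: sumr_ge0 => b _; rewrite mulr_ge0 ?sqr_ge0.
pose S N := \sum_(n < N) a n.
have Smono : {homo S : N M / (N <= M)%N >-> N <= M}.
  move=> N M NM; rewrite /S -!(big_mkord xpredT a) (big_cat_nat _ NM) //= lerDl.
  exact: sumr_ge0.
have Sub : has_ubound (range S).
  exists (C * ell2_norm x ^+ 2) => _ [N _ <-].
  apply: le_trans (_ : C * \sum_(j \in `I_N `*` [set: bool]) normc (x j) ^+ 2 <= _).
    rewrite -site_sum mulr_sumr; apply: ler_sum => n _; rewrite mulr_sumr.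
    apply: ler_sum => b _; apply: ler_wpM2r; first exact: sqr_ge0.
    by apply: le_trans (dC (val n, b)); apply: le_trans (Re_le_normc _); apply: ler_norm.
  rewrite ler_pM2l //; apply: ell2_norm_ge.
  by apply: finite_setX => //; exact: finite_finset.
have Sl := nondecreasing_is_cvgn Smono Sub.
have -> : ip (diag_op d x) x = (limn S)%:C.
  rewrite /ip; apply: (@norm_cvg_lim _ (R[i]^o)) => //.
  under eq_fun => N.
    under eq_bigr => n _.
      under eq_bigr => b _ do rewrite diag_opE // dR -mulrA mul_conjc -rmorphM.
      rewrite -rmorph_sum.
      over.
    rewrite -rmorph_sum.
    over.
  exact: cvg_realC.
rewrite lecE /= eqxx /=; apply: limr_ge => //.
by near=> N; apply: sumr_ge0.
Unshelve. all: by end_near.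
Qed.

End Ell2Facts.

(** * Singular values of diagonal operators *)

Section DiagOp.
Context {R : realType}.
Local Notation H := (ell2 R).
Local Notation normc := (@Normc.normc R).
Implicit Types (x y : H) (d : site -> R[i]).

Lemma positive_diag_op d : bounded_diag d ->
  positive_op (diag_op d : H -> H) -> forall j, 0 <= d j.
Proof.
move=> db [_ h] j; have := h (basis j).
by rewrite ip_basisr diag_opE // basisE eqxx mulr1.
Qed.

(** [A] is any positive operator whose square is [T^* T]; uniqueness of the square root is avoided.
    Pairing [A (A x) = l^2 x] with the basis vector at [j] gives [|d j|^2 x j = l^2 x j]. *)
Let eigenvector_support d (A : H -> H) x l : bounded_diag d ->
  abs_op (diag_op d) A -> 0 <= l -> A x = l%:C *: x ->
  forall j, x j != 0 -> normc (d j) = l.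
Proof.
move=> db [[[Alin _] _] [S TS AS]] l0 Ax j xj.
have db' : bounded_diag (fun j => conjc (d j)).
  by case: db => C C0 dC; exists C => // i; rewrite normcJ.
have AZ a y : A (a *: y) = a *: A y.
  have A0 : A 0 = 0 by have := Alin (-1) 0 0; rewrite scaler0 addr0 scaleN1r addNr.
  by have := Alin a y 0; rewrite A0 !addr0.
have := ip_basisl j (A (A x)); rewrite [in LHS]AS -TS.
rewrite (_ : diag_op d (basis j) = d j *: basis j); last first.
  apply: ell2_ext => i; rewrite diag_opE //.
  have -> : (d j *: basis j) i = d j * basis j i by [].
  by rewrite !basisE; case: eqP => [->|]; rewrite ?mulr0.
have -> : ip (d j *: basis j) (diag_op d x) =
    ip (basis j) (diag_op (fun j => conjc (d j)) (diag_op d x)).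
  apply: (congr1 (fun F : nat -> R[i]^o => limn F)); apply/funext => N.
  apply: eq_bigr => n _; apply: eq_bigr => b _.
  have -> : (d j *: basis j) (val n, b) = d j * basis j (val n, b) by [].
  rewrite !diag_opE // basisE; case: eqP => [->|]; last by rewrite mulr0 !mul0r.
  by rewrite !rmorphM /= conjcK; ring.
rewrite ip_basisl Ax AZ Ax scalerA !diag_opE // => /(can_inj (@conjcK _)).
have -> : ((l%:C * l%:C) *: x) j = (l%:C * l%:C) * x j by [].
rewrite mulrA => /(mulIf xj); rewrite mulrC mul_conjc -rmorphM => /complexI.
by rewrite -expr2 => /eqP; rewrite eqrXn2 ?normc_ge0 // => /eqP.
Qed.

(** The vectors form a matrix with rows indexed by finitely many sites. Orthonormality provides a
    left inverse, so the column rank is full and [k + 1] linearly independent rows can be selected;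
    an independent row is non-zero. *)
Let eigen_sites k (v : 'I_k.+1 -> H) N : Defs.orthonormal v ->
  (forall i j, (N <= j.1)%N -> v i j = 0) ->
  exists e : 'I_k.+1 -> site, injective e /\ forall i, exists i', v i' (e i) != 0.
Proof.
move=> vo vN; pose P : finType := ('I_N * bool)%type.
pose st (c : 'I_#|P|) : site := (val (enum_val c).1, (enum_val c).2).
pose V : 'M[R[i]]_(#|P|, k.+1) := \matrix_(c, i) v i (st c).
have Vfull : row_full V.
  apply/row_fullP; exists (\matrix_(i, c) conjc (v i (st c))).
  apply/matrixP => i i'; rewrite !mxE.
  under eq_bigr => c _ do rewrite !mxE.
  transitivity (\sum_(p : P) conjc (v i (val p.1, p.2)) * v i' (val p.1, p.2)).
    by rewrite [RHS](reindex _ (onW_bij _ (@enum_val_bij P))).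
  rewrite eq_sym -vo.
  rewrite (@ip_finE _ _ _ N); last by move=> j jN; rewrite vN // mul0r.
  rewrite pair_bigA /=; apply: eq_bigr => p _; exact: mulrC.
exists (st \o fullrankfun Vfull); split.
  apply: inj_comp; last exact: fullrankfun_inj.
  move=> c c' [/val_inj h1 h2]; apply: enum_val_inj.
  by move: h1 h2; case: (enum_val c) => ? ?; case: (enum_val c') => ? ? /= -> ->.
move=> i; apply: contrapT => nex.
have : row i (rowsub (fullrankfun Vfull) V) = 0.
  apply/rowP => i'; rewrite !mxE; apply/eqP/negPn/negP => ne; apply: nex.
  by exists i'.
have := fullrowsub_unit Vfull; rewrite -row_free_unit => /row_freeP[B VB] ri.
have : row i (rowsub (fullrankfun Vfull) V *m B) = 0 by rewrite row_mul ri mul0mx.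
rewrite VB => /rowP /(_ i); rewrite !mxE eqxx => /eqP.
by rewrite oner_eq0.
Qed.

(** Admissible [t] in the supremum correspond to [k + 1] distinct sites with [|d|] at least [t]:
    basis vectors give one direction, [eigen_sites] the other. The latter takes [t > 0], for then
    the eigenvectors live on a finite set of sites. *)
Lemma sing_diag_op d : bounded_diag d ->
  (forall t, 0 < t -> finite_set [set j | t <= normc (d j)]) ->
  rearranged (fun j => normc (d j)) (sing (diag_op d)).
Proof.
move=> db dfin.
pose E k := [set t : R | 0 <= t /\
    exists A (v : 'I_k.+1 -> H) (l : 'I_k.+1 -> R),
      [/\ abs_op (diag_op d) A, Defs.orthonormal v
        & forall i, A (v i) = (l i)%:C *: v i /\ t <= l i]].
have upper k t : 0 < t -> E k t -> exists e : 'I_k.+1 -> site,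
    injective e /\ forall i, t <= normc (d (e i)).
  move=> t0 [_ [A [v [l [Aabs vo vl]]]]].
  have vs i j : v i j != 0 -> t <= normc (d j).
    have [Av tl] := vl i; have l0 : 0 <= l i := le_trans (ltW t0) tl.
    by move/(eigenvector_support db Aabs l0 Av) => ->.
  have [N _ NP] := finite_set_ub (fun j : site => j.1%:R : R) (dfin _ t0).
  have [M NM] : exists M, N < M%:R.
    by exists (Num.truncn N).+1; exact: truncnS_gt.
  have [|e [e_inj eP]] := @eigen_sites k v M vo.
    move=> i j Mj; apply/eqP/negPn/negP => /vs /NP.
    rewrite leNgt => /negP; apply; apply: lt_le_trans NM _.
    by rewrite ler_nat.
  by exists e; split=> // i; have [i' /vs] := eP i.
have lower k t : 0 <= t -> (exists e : 'I_k.+1 -> site,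
    injective e /\ forall i, t <= normc (d (e i))) -> E k t.
  move=> t0 [e [e_inj eP]]; split=> //.
  have ab : bounded_diag (fun j => (normc (d j))%:C).
    by case: db => C C0 dC; exists C => // j; rewrite normc_real ger0_norm ?normc_ge0.
  have db' : bounded_diag (fun j => conjc (d j)).
    by case: db => C C0 dC; exists C => // j; rewrite normcJ.
  exists (diag_op (fun j => (normc (d j))%:C)), (fun i => basis (e i)),
    (fun i => normc (d (e i))); split.
  - split.
      by apply: diag_op_positive => // j; rewrite lecR normc_ge0.
    exists (diag_op (fun j => conjc (d j))); first exact: diag_op_adjoint.
    move=> x; apply: ell2_ext => j; rewrite !diag_opE // !mulrA.
    by rewrite [conjc _ * _]mulrC mul_conjc -rmorphM.
  - move=> i j; rewrite ip_basisr basisE (inj_eq e_inj) eq_sym.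
    by rewrite eq_sym.
  - move=> i; split=> //; apply: ell2_ext => j; rewrite diag_opE //.
    have -> : ((normc (d (e i)))%:C *: basis (e i)) j =
       (normc (d (e i)))%:C * basis (e i) j by [].
    by rewrite basisE; case: eqP => [->|]; rewrite ?mulr0.
have [C C0 dC] := db.
have E0 k : E k 0.
  apply: lower => //; exists (fun i => (val i, true)).
  split=> [i j [/val_inj]//|i]; exact: normc_ge0.
have Eub k : has_sup (E k).
  split; first by exists 0.
  exists C => t Et; have [t0 | t0] := leP t 0; first exact: le_trans (ltW C0).
  have [e [_ eP]] := upper k t t0 Et.
  exact: le_trans (eP ord0) (dC _).
split=> [k | k t t0 ex | k t /andP[t0 ts]].
- exact: (sup_upper_bound (Eub k)).
- by apply: (sup_upper_bound (Eub k)); apply: lower.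
have [t' Et' tt'] := sup_gt (ex_intro _ 0 (E0 k)) ts.
have [e [e_inj eP]] := upper k t' (lt_trans t0 tt') Et'.
by exists e; split=> // i; apply: le_trans (ltW tt') (eP i).
Qed.

End DiagOp.

Lemma fsum_subset (R : realType) (T : choiceType) (A B : set T) (f : T -> R) :
  finite_set B -> A `<=` B -> (forall x, 0 <= f x) ->
  \sum_(x \in A) f x <= \sum_(x \in B) f x.
Proof.
move=> Bf AB f0; rewrite (fsbigID A B) // (_ : B `&` A = A); last first.
  by apply/seteqP; split => [x []|x Ax] //; split => //; exact: AB.
by rewrite lerDl fsumr_ge0.
Qed.

(** * Compactness of diagonal operators with entries tending to 0 *)

Section Compactness.
Context {R : realType}.
Local Notation H := (ell2 R).
Local Notation normc := (@Normc.normc R).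

Let bounded_ultra_cvg (G : set_system nat) (f : nat -> R) (B : R) :
  UltraFilter G -> (forall n, `|f n| <= B) -> exists l : R, f @ G --> l.
Proof.
move=> GU fB.
have GP : ProperFilter G := @ultra_proper _ _ GU.
have G1 : Filter G := @filter_filter _ _ GP.
have fG : (f @ G) `[- B, B]%classic.
  apply: (@filterS _ G G1 setT) => [n _ /=|]; last exact: filterT.
  by rewrite in_itv /= -ler_norml.
have [l [_ fl]] := @segment_compact R (- B) B (f @ G) _ fG.
exists l => V Vl; have [//|GV] := in_ultra_setVsetC (f @^-1` V) GU.
by have [x []] := fl (~` V) V GV Vl.
Qed.

(** Along an ultrafilter finer than [\oo] every bounded coordinate converges, which replaces a
    diagonal extraction. The limit is in l^2 because its finite partial sums of squares are
    uniformly bounded. *)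
Let coordinatewise_limit (u : nat -> H) (B : R) :
  (forall n, ell2_norm (u n) <= B) ->
  exists (G : set_system nat) (p : H), [/\ ProperFilter G, \oo `<=` G &
    forall A, finite_set A ->
    (fun n => \sum_(j \in A) normc ((u n - p) j) ^+ 2) @ G --> (0 : R)].
Proof.
move=> uB; have [G [GU oG]] := ultraFilterLemma (@eventually_filter).
have GP : ProperFilter G := @ultra_proper _ _ GU.
have B0 : 0 <= B by apply: le_trans (uB 0%N); exact: ell2_norm_ge0.
have cB n j : normc (u n j) <= B := le_trans (normc_le_ell2_norm _ _) (uB n).
have /boolp.choice [p pP] : forall j, exists l : R[i],
    (fun n => complex.Re (u n j)) @ G --> complex.Re l /\
    (fun n => complex.Im (u n j)) @ G --> complex.Im l.
  move=> j.
  have [a ua] := bounded_ultra_cvg GU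
    (fun n => le_trans (Re_le_normc (u n j)) (cB n j)).
  have [b ub] := bounded_ultra_cvg GU
    (fun n => le_trans (Im_le_normc (u n j)) (cB n j)).
  by exists (a +i* b).
have small A : finite_set A ->
    (fun n => \sum_(j \in A) normc (u n j - p j) ^+ 2) @ G --> (0 : R).
  move=> Af; under eq_fun do rewrite fsbig_finite //.
  elim: (finmap.enum_fset _) => [|j s IH].
    by under eq_fun do rewrite big_nil; exact: cvg_cst.
  under eq_fun do rewrite big_cons normcE2.
  have [ra rb] := pP j.
  have z (f : nat -> R) (l : R) : f @ G --> l ->
      (fun n => (f n - l) ^+ 2) @ G --> (0 : R).
    move=> fl; rewrite [X in _ --> X](_ : 0 = (l - l) * (l - l)); last first.
      by rewrite subrr mulr0.
    under eq_fun do rewrite expr2.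
    by apply: cvgM; apply: cvgB => //; exact: cvg_cst.
  have e0 : (0 : R) = (0 + 0) + 0 by rewrite !addr0.
  rewrite [in nbhs 0]e0; apply: cvgD => //.
  have E n : u n j - p j = (complex.Re (u n j) - complex.Re (p j)) +i*
      (complex.Im (u n j) - complex.Im (p j)).
    by case: (u n j) (p j) => ? ? [].
  under eq_fun do rewrite E /=.
  by apply: cvgD; apply: z.
have pH : p \in @sqsummable R.
  rewrite inE /=; apply: (@le_lt_trans _ _ (2 * B ^+ 2 + 2)%:E); last exact: ltry.
  apply/sqsum_le_fin => A Af.
  have /cvgrPdist_lt /(_ _ ltr01) /filter_ex [n] := small A Af.
  rewrite /= sub0r normrN ger0_norm; last by apply: fsumr_ge0 => j _; exact: sqr_ge0.
  move=> hn; have := le_trans (ell2_norm_ge (u n) Af)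
     (_ : ell2_norm (u n) ^+ 2 <= B ^+ 2).
  rewrite ler_pXn2r ?nnegrE ?ell2_norm_ge0 // uB => /(_ isT).
  move: hn; rewrite !fsbig_finite // => h1 h2.
  apply: le_trans (_ : \sum_(j <- finmap.enum_fset (fset_set A))
     (2 * normc (u n j) ^+ 2 + 2 * normc (u n j - p j) ^+ 2) <= _).
    apply: ler_sum => j _; rewrite -[in leLHS](subrKC (u n j) (p j)).
    apply: le_trans (normc_sqrD _ _) _; rewrite lerD2l.
    by rewrite -[p j - _]opprB normcN.
  by rewrite big_split /= -!mulr_sumr; lra.
by exists G, (Ell2 pH).
Qed.

(** The sites split into the finite set where [|d|] is at least [t], on which coordinatewise
    convergence suffices, and the rest, where the small factor [t] beats the bounded norm. *)
Lemma diag_op_compact (d : site -> R[i]) : bounded_diag d ->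
  (forall t, 0 < t -> finite_set [set j | t <= normc (d j)]) ->
  compact_op (diag_op d : H -> H).
Proof.
move=> db dfin; split; first exact: diag_op_linear.
move=> u [M uM]; have [C C0 dC] := db.
have [G [p [GP oG small]]] := coordinatewise_limit uM.
pose g n := ell2_norm (diag_op d (u n) - diag_op d p).
have gG e : 0 < e -> G [set n | g n <= e].
  move=> e0.
  pose D := 2 * M ^+ 2 + 2 * ell2_norm p ^+ 2 + 1.
  have D0 : 0 < D by rewrite ltr_wpDl // addr_ge0 // mulr_ge0 ?sqr_ge0.
  (* Chosen so that [t ^+ 2 * D = e ^+ 2 / 2]: each of the two parts of the squared norm receives
     half of [e ^+ 2]. *)
  pose t := Num.sqrt (e ^+ 2 / (2 * D)).
  have t0 : 0 < t by rewrite sqrtr_gt0 divr_gt0 ?exprn_gt0 ?mulr_gt0.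
  have Jf := dfin t t0; set J := [set j | _] in Jf.
  have h0 : 0 < e ^+ 2 / (2 * C ^+ 2) by rewrite divr_gt0 ?mulr_gt0 ?exprn_gt0.
  have /cvgrPdist_lt /(_ _ h0) := small J Jf.
  apply: filterS => n /=; set z := u n - p.
  rewrite sub0r normrN ger0_norm; last by apply: fsumr_ge0 => j _; exact: sqr_ge0.
  rewrite ltr_pdivlMr ?mulr_gt0 ?exprn_gt0 // => zJ0.
  have zJ : (\sum_(j \in J) normc (z j) ^+ 2) * (2 * C ^+ 2) < e ^+ 2 := zJ0.
  have zD A : finite_set A -> \sum_(j \in A) normc (z j) ^+ 2 <= D.
    move=> Af; apply: le_trans (_ : 2 * \sum_(j \in A) normc (u n j) ^+ 2 +
      2 * \sum_(j \in A) normc (p j) ^+ 2 <= _).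
      rewrite !fsbig_finite // !mulr_sumr -big_split /=; apply: ler_sum => j _.
      by rewrite -[X in _ + 2 * X ^+ 2]normcN (le_trans (normc_sqrD _ _)).
    have := ell2_norm_ge (u n) Af; have := ell2_norm_ge p Af.
    have : ell2_norm (u n) ^+ 2 <= M ^+ 2.
      by rewrite ler_pXn2r ?nnegrE ?ell2_norm_ge0 ?(le_trans (ell2_norm_ge0 _) (uM n)).
    by rewrite /D; lra.
  apply: ell2_norm_le; first exact: ltW.
  move=> A Af; rewrite (eq_fsbigr (fun j => normc (d j) ^+ 2 * normc (z j) ^+ 2)).
    rewrite (fsbigID J A) //.
    have l1 : \sum_(j \in A `&` J) normc (d j) ^+ 2 * normc (z j) ^+ 2 <=
        C ^+ 2 * \sum_(j \in J) normc (z j) ^+ 2.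
      apply: le_trans (_ : \sum_(j \in J) normc (d j) ^+ 2 * normc (z j) ^+ 2 <= _).
        by apply: fsum_subset => // j; rewrite mulr_ge0 ?sqr_ge0.
      rewrite !fsbig_finite // mulr_sumr; apply: ler_sum => j _.
      rewrite ler_wpM2r ?sqr_ge0 // ler_pXn2r ?nnegrE ?normc_ge0 //.
      exact: ltW.
    have l2 : \sum_(j \in A `&` ~` J) normc (d j) ^+ 2 * normc (z j) ^+ 2 <=
        t ^+ 2 * D.
      have AJf : finite_set (A `&` ~` J) by exact: finite_setIl.
      apply: le_trans (_ : t ^+ 2 * \sum_(j \in A `&` ~` J) normc (z j) ^+ 2 <= _).
        rewrite !fsbig_finite // mulr_sumr big_seq [leRHS]big_seq.
        apply: ler_sum => j; rewrite in_fset_set // => /set_mem [_ /negP].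
        rewrite -ltNge => /ltW dt.
        by rewrite ler_wpM2r ?sqr_ge0 // ler_pXn2r ?nnegrE ?normc_ge0 // ltW.
      by rewrite ler_wpM2l ?sqr_ge0 // zD.
    have tE : t ^+ 2 * D = e ^+ 2 / 2.
      rewrite sqr_sqrtr; last by rewrite divr_ge0 ?sqr_ge0 // mulr_ge0 // ltW.
      by field; rewrite gt_eqF.
    by apply: le_trans (lerD l1 l2) _; lra.
  move=> j _; rewrite ell2_funB !diag_opE // -mulrBr Normc.normcM exprMn.
  by rewrite /z ell2_funB.
(* Back from the filter to a subsequence: its sets are non-empty, and it contains all tails, so good
   indices exist beyond any [N]. *)
have /boolp.choice [nx nxP] : forall kN : nat * nat, exists n,
    (kN.2 < n)%N /\ g n <= harmonic kN.1.
  move=> [k N] /=.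
  have hk : 0 < harmonic k :> R by rewrite invr_gt0.
  have : G [set n | (N < n)%N] by apply: oG; exists N.+1.
  by move/(filterI (gG _ hk)) => /filter_ex [n [? ?]]; exists n.
pose phi := fix phi k := if k is k'.+1 then nx (k, phi k') else nx (0%N, 0%N).
exists phi, (diag_op d p); split.
  by apply: homo_ltn => [|k]; [exact: ltn_trans | have [] := nxP (k.+1, phi k)].
apply: (@squeeze_cvgr _ _ _ _ (fun=> 0) harmonic).
- apply: nearW => k; rewrite ell2_norm_ge0 /=.
  by case: k => [|k]; [have [] := nxP (0%N, 0%N)|have [] := nxP (k.+1, phi k)].
- exact: cvg_cst.
- exact: cvg_harmonic.
Qed.

End Compactness.

(** * Geometry of the self-similar set *)

Record ifs (R : realType) (m : nat) (psi : 'I_m.+1 -> R -> R)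
    (r : 'I_m.+1 -> R) (F : set R) : Prop := Ifs {
  ifs_ratio : forall i, 0 < r i < 1;
  ifs_similarity : forall i, similarity (r i) (psi i);
  ifs_ordered : ordered_pieces psi;
  ifs_set : selfsimilar_set psi F }.

Section Geometry.
Context {R : realType} {m : nat} (psi : 'I_m.+1 -> R -> R) (r : 'I_m.+1 -> R).
Context (F : set R) (bm bp : nat -> R).
Context (ifsF : ifs psi r F).
Context (hI : complementary_intervals F bm bp).

Let hr := ifs_ratio ifsF.
Let hpsi := ifs_similarity ifsF.
Let hord := ifs_ordered ifsF.
Let hF := ifs_set ifsF.

Let r0 i : 0 < r i. Proof. by case/andP: (hr i). Qed.
Let r1 i : r i < 1. Proof. by case/andP: (hr i). Qed.

(** The difference of the squared distance equations to the images of 0 and 1 is linear in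
    [psi i x]; [psi i 0 < psi i 1] selects the slope [+ r i]. *)
Lemma psiE i x : psi i x = psi i 0 + r i * x.
Proof.
have [_ _ /(_ i) p01 _] := hord; have ri := r0 i.
have h1 : psi i 1 - psi i 0 = r i.
  have := hpsi i 1 0; rewrite subr0 normr1 mulr1 gtr0_norm //.
  by rewrite subr_gt0.
have h2 := congr1 (fun z => z ^+ 2) (hpsi i x 0).
have h3 := congr1 (fun z => z ^+ 2) (hpsi i x 1).
rewrite /= !exprMn !real_normK ?num_real // in h2 h3.
have : 2 * r i * (psi i x - psi i 0 - r i * x) = 0.
  have E1 : psi i 1 = psi i 0 + r i by rewrite -h1; ring.
  by rewrite E1 in h3; lra.
by move=> /eqP; rewrite mulf_eq0 mulf_eq0 gt_eqF //= gt_eqF //= => /eqP; lra.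
Qed.

Lemma psi_le i x y : (psi i x <= psi i y) = (x <= y).
Proof. by rewrite psiE [psi i y]psiE lerD2l ler_pM2l. Qed.

Lemma psi_lt i x y : (psi i x < psi i y) = (x < y).
Proof. by rewrite psiE [psi i y]psiE ltrD2l ltr_pM2l. Qed.

Lemma psi_inj i : injective (psi i).
Proof. by move=> x y xy; apply/eqP; rewrite eq_le -(psi_le i x y) -(psi_le i y x) xy lexx. Qed.

Lemma psi_surj i y : exists x, y = psi i x.
Proof.
exists ((y - psi i 0) / r i); rewrite psiE mulrC divfK ?gt_eqF //; lra.
Qed.

Lemma psi_ord (i j : 'I_m.+1) : (i < j)%N -> psi i 1 < psi j 0.
Proof.
have [_ _ p01 pm] := hord.
have step (k : nat) (k0 : (k < m)%N) (a b : 'I_m.+1) : a = k :> nat ->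
    b = k.+1 :> nat -> psi a 1 < psi b 0.
  move=> ak bk; have := pm (Ordinal k0).
  have -> : lidx (Ordinal k0) = a by apply: val_inj; rewrite /= ak.
  by have -> : ridx (Ordinal k0) = b by apply: val_inj; rewrite /= bk.
case: j => j jm; elim: j jm => [//|j IH] jm /=; rewrite ltnS leq_eqVlt.
have jm' : (j < m.+1)%N by exact: ltnW.
case/orP => [/eqP ij | ij]; first exact: (step j).
apply: lt_trans (IH jm' ij) _; apply: lt_trans (p01 _) _.
exact: (step j).
Qed.

Lemma psi0_ge0 i : 0 <= psi i 0.
Proof.
have [p0 _ p01 _] := hord; have [->|/eqP i0] := eqVneq i ord0; first by rewrite p0.
have : (0 < i)%N by rewrite lt0n; apply/eqP => h; apply: i0; exact: val_inj.
move=> /(@psi_ord ord0) /ltW; apply: le_trans.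
by rewrite -p0 ltW.
Qed.

Lemma psi1_le1 i : psi i 1 <= 1.
Proof.
have [_ p1 p01 _] := hord; have [->|/eqP i0] := eqVneq i ord_max.
  by rewrite p1.
have : (i < @ord_max m)%N.
  rewrite ltn_neqAle -ltnS ltn_ord andbT; apply/eqP => h; apply: i0.
  exact: val_inj.
move=> /psi_ord /ltW /le_trans; apply.
by rewrite -p1 ltW.
Qed.

(** A single map would fix both 0 and 1 and have ratio 1. The second piece is what later makes every
    weight smaller than 1. *)
Lemma m_gt0 : (0 < m)%N.
Proof.
rewrite lt0n; apply/eqP => m0; have [p0 p1 _ _] := hord.
have E : ord_max = ord0 :> 'I_m.+1 by apply: val_inj; rewrite /= m0.
rewrite E in p1; have := psiE ord0 1; rewrite p0 p1 add0r mulr1 => h.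
by have := r1 ord0; rewrite -h ltxx.
Qed.

Lemma F_psi i x : F x -> F (psi i x).
Proof.
move=> Fx; have [_ _ FE] := hF; rewrite FE; exists i => //; exists x => //.
Qed.

Lemma F_cover y : F y -> exists i x, F x /\ y = psi i x.
Proof.
by have [_ _ FE] := hF; rewrite {1}FE => -[i _ [x Fx <-]]; exists i, x.
Qed.

Let F_bounded : has_ubound F /\ has_lbound F.
Proof.
have [_ /compact_bounded [M [_ FM0]] _] := hF.
have M1 : M < M + 1 by rewrite ltrDl.
have FM := FM0 _ M1; split.
  by exists (M + 1) => x /FM /=; apply: le_trans; exact: ler_norm.
by exists (- (M + 1)) => x /FM /=; rewrite ler_norml => /andP[].
Qed.

(** If [inf F] were negative, all pieces would lie above [r i * inf F], with [i] of largest ratio,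
    and this exceeds [inf F]. The argument at the other end is the same for [sup F - 1]. *)
Lemma F01 x : F x -> 0 <= x <= 1.
Proof.
have [Fn _ _] := hF; have [ubF lbF] := F_bounded => Fx.
apply/andP; split.
  apply: le_trans (inf_lbound lbF Fx); rewrite leNgt; apply/negP => i0.
  have [i imin] : exists i : 'I_m.+1, forall j, r j * inf F >= r i * inf F.
    have [i _ iP] := arg_maxP r (isT : xpredT ord0); exists i => j.
    by rewrite ler_nM2r //; apply: iP.
  have : inf F < r i * inf F.
    rewrite -subr_gt0 (_ : _ - _ = (1 - r i) * (- inf F)); last by ring.
    by rewrite mulr_gt0 ?subr_gt0 // oppr_gt0.
  move=> /(inf_lt Fn) [y Fy]; rewrite ltNge => /negP; apply.
  have [j [x' [Fx' ->]]] := F_cover Fy; rewrite psiE.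
  have := psi0_ge0 j; have := imin j; have := inf_lbound lbF Fx'.
  by rewrite -(ler_pM2l (r0 j)); lra.
apply: le_trans (sup_ubound ubF Fx) _; rewrite leNgt; apply/negP => s1.
have [i imax] : exists i : 'I_m.+1, forall j, r j * (sup F - 1) <= r i * (sup F - 1).
  have [i _ iP] := arg_maxP r (isT : xpredT ord0); exists i => j.
  by rewrite ler_pM2r ?subr_gt0 //; apply: iP.
have : 1 + r i * (sup F - 1) < sup F.
  rewrite -subr_gt0 (_ : _ - _ = (1 - r i) * (sup F - 1)); last by ring.
  by rewrite mulr_gt0 ?subr_gt0.
move=> /(sup_gt Fn) [y Fy]; rewrite ltNge => /negP; apply.
have [j [x' [Fx' ->]]] := F_cover Fy; rewrite psiE.
have := psi1_le1 j; rewrite psiE; have := imax j; have := sup_ubound ubF Fx'.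
by rewrite -(ler_pM2l (r0 j)); lra.
Qed.

Lemma F_closed : closed F.
Proof. by have [_ Fc _] := hF; apply: compact_closed Fc; exact: Rhausdorff. Qed.

Lemma F0 : F 0.
Proof.
have [[x Fx] _ _] := hF; have [p0 _ _ _] := hord.
have key n : F (r ord0 ^+ n * x).
  elim: n => [|n IH]; first by rewrite mul1r.
  by have := F_psi ord0 IH; rewrite psiE p0 add0r mulrA -exprS.
apply: (@closed_cvg _ _ \oo _ (fun n => r ord0 ^+ n * x) F F_closed).
  by apply: nearW => n; exact: key.
rewrite -[X in _ --> X](mul0r x); apply: cvgMl.
by apply: cvg_expr; rewrite gtr0_norm.
Qed.

Lemma F1 : F 1.
Proof.
have [[x Fx] _ _] := hF; have [_ p1 _ _] := hord.
have key n : F (1 - r ord_max ^+ n * (1 - x)).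
  elim: n => [|n IH]; first by rewrite mul1r subKr.
  have := F_psi ord_max IH; rewrite psiE => h.
  have E : psi ord_max 0 = 1 - r ord_max.
    by rewrite -[X in X - _]p1 [psi ord_max 1]psiE mulr1 addrK.
  rewrite E in h; rewrite exprS; apply: eq_ind h _ _; ring.
apply: (@closed_cvg _ _ \oo _ (fun n => 1 - r ord_max ^+ n * (1 - x)) F F_closed).
  by apply: nearW => n; exact: key.
have -> : nbhs (1 : R) = nbhs (1 - 0 * (1 - x)) by rewrite mul0r subr0.
apply: cvgB; first exact: cvg_cst; apply: cvgMl.
by apply: cvg_expr; rewrite gtr0_norm.
Qed.

Lemma pieces_ltn (i j : 'I_m.+1) x y : 0 <= x <= 1 -> 0 <= y <= 1 ->
  psi i x <= psi j y -> (i <= j)%N.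
Proof.
move=> /andP[x0 x1] /andP[y0 y1] xy; rewrite leqNgt; apply/negP => /psi_ord.
rewrite ltNge => /negP; apply.
have : psi j y <= psi j 1 by rewrite psi_le.
have : psi i 0 <= psi i x by rewrite psi_le.
lra.
Qed.

Lemma pieces_disjoint (i j : 'I_m.+1) x y : 0 <= x <= 1 -> 0 <= y <= 1 ->
  psi i x = psi j y -> i = j.
Proof.
move=> x01 y01 xy; apply: val_inj; apply/eqP; rewrite eqn_leq /=.
by rewrite (pieces_ltn x01 y01) ?xy // (pieces_ltn y01 x01) ?xy.
Qed.

Lemma F_piece i x : 0 <= x <= 1 -> F (psi i x) -> F x.
Proof.
move=> x01 /F_cover [j [y [Fy xy]]].
have ij := pieces_disjoint x01 (F01 Fy) xy; subst j.
by rewrite (psi_inj xy).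
Qed.

(** This [delta] is the source of the smallness thresholds in [cell_term_rec] and
    [density_irregular]. *)
Lemma pieces_gap : exists2 delta, 0 < delta &
  forall (i j : 'I_m.+1) x y, i != j -> 0 <= x <= 1 -> 0 <= y <= 1 ->
    delta <= `|psi i x - psi j y|.
Proof.
pose g (ij : 'I_m.+1 * 'I_m.+1) :=
  if (ij.1 < ij.2)%N then psi ij.2 0 - psi ij.1 1 else 1.
have g0 ij : 0 < g ij.
  by rewrite /g; case: ifP => // /psi_ord; rewrite subr_gt0.
have [c c0 cP] := finite_set_lb (@finite_finset _ [set: 'I_m.+1 * 'I_m.+1]) g0.
exists c => // i j x y ij /andP[x0 x1] /andP[y0 y1].
have a1 : psi i 0 <= psi i x by rewrite psi_le.
have a2 : psi i x <= psi i 1 by rewrite psi_le.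
have a3 : psi j 0 <= psi j y by rewrite psi_le.
have a4 : psi j y <= psi j 1 by rewrite psi_le.
case: (ltngtP i j) => [ij'|ij'|/val_inj/eqP]; last by rewrite (negbTE ij).
  have := cP (i, j) I; rewrite /g /= ij' distrC => h.
  by rewrite (le_trans h) // (le_trans _ (ler_norm _)) //; lra.
have := cP (j, i) I; rewrite /g /= ij' => h.
by rewrite (le_trans h) // (le_trans _ (ler_norm _)) //; lra.
Qed.

(** A complementary interval described without its number, so that images under [psi i] can be
    recognised as complementary intervals. *)
Definition is_gap s t := [/\ F s, F t, s < t & forall x, s < x < t -> ~ F x].

Lemma gap_unique s t s' t' x : is_gap s t -> is_gap s' t' ->
  s < x < t -> s' < x < t' -> s = s' /\ t = t'.
Proof.
move=> [Fs Ft st nF] [Fs' Ft' st' nF'] /andP[sx xt] /andP[s'x xt'].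
split; apply/eqP; rewrite eq_le; apply/andP; split; rewrite leNgt; apply/negP => h.
- by apply: (nF' s) => //; rewrite h (lt_trans sx).
- by apply: (nF s') => //; rewrite h (lt_trans s'x).
- by apply: (nF t') => //; rewrite h andbT (lt_trans sx).
- by apply: (nF' t) => //; rewrite h andbT (lt_trans s'x).
Qed.

(** An endpoint outside [F] would lie in some open complementary interval, which would then overlap
    the [n]-th one and hence coincide with it, although no open interval contains its own
    endpoint. *)
Lemma interval_gap n : is_gap (bm n) (bp n).
Proof.
have [blt btriv bU _] := hI; have bn := blt n.
have nF x : bm n < x < bp n -> 0 <= x <= 1 /\ ~ F x.
  move=> xn; have : (\bigcup_n `]bm n, bp n[%classic) x by exists n => //=; rewrite in_itv.
  by rewrite -bU => -[]; rewrite /= in_itv.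
have mid : bm n < (bm n + bp n) / 2 < bp n by apply/andP; split; lra.
have [/andP[mid0 mid1] _] := nF _ mid.
have bm0 : 0 <= bm n.
  rewrite leNgt; apply/negP => b0.
  by have [] := nF (bm n / 2); [apply/andP; split; lra | move=> /andP[]; lra].
have bp1 : bp n <= 1.
  rewrite leNgt; apply/negP => b1.
  have [] := nF ((1 + bp n) / 2); first by apply/andP; split; lra.
  by move=> /andP[]; lra.
have covered x : 0 <= x <= 1 -> ~ F x -> exists k, bm k < x < bp k.
  move=> x01 nFx; have : (`[0, 1]%classic `\` F) x by split => //=; rewrite in_itv.
  by rewrite bU => -[k _ /=]; rewrite in_itv; exists k.
have meet k x : bm n < x < bp n -> bm k < x < bp k -> n = k.
  by move=> h1 h2; apply: btriv => //; exists x; split; rewrite /= in_itv.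
split => //; last by move=> x /nF [].
  apply: contrapT => /covered [|k /andP[kb bk]]; first by apply/andP; split; lra.
  suff nk : n = k by move: kb; rewrite nk ltxx.
  apply: (meet k ((bm n + Num.min (bp n) (bp k)) / 2));
    by case: (leP (bp n) (bp k)) => ?; apply/andP; split; lra.
apply: contrapT => /covered [|k /andP[kb bk]]; first by apply/andP; split; lra.
suff nk : n = k by move: bk; rewrite nk ltxx.
apply: (meet k ((bp n + Num.max (bm n) (bm k)) / 2));
  by case: (leP (bm n) (bm k)) => ?; apply/andP; split; lra.
Qed.

Lemma gap_interval s t : is_gap s t -> exists n, bm n = s /\ bp n = t.
Proof.
move=> st_gap; have [Fs Ft st nF] := st_gap; have [_ _ bU _] := hI.
have /andP[s0 _] := F01 Fs; have /andP[_ t1] := F01 Ft.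
have mid : s < (s + t) / 2 < t by apply/andP; split; lra.
have : (`[0, 1]%classic `\` F) ((s + t) / 2).
  by split; [rewrite /= in_itv /=; apply/andP; split; lra | exact: nF].
rewrite bU => -[n _ /=]; rewrite in_itv /= => nmid; exists n.
exact: (gap_unique (interval_gap n) st_gap nmid mid).
Qed.

Lemma interval_inj n k : bm n = bm k -> n = k.
Proof.
have [blt btriv _ _] := hI; have := blt n; have := blt k => bk bn nk.
apply: btriv => //; exists ((bm n + Num.min (bp n) (bp k)) / 2); split;
  rewrite /= in_itv /=;
  by case: (leP (bp n) (bp k)) => ?; apply/andP; split; lra.
Qed.

Lemma psi_gap i s t : F s -> F t -> is_gap (psi i s) (psi i t) <-> is_gap s t.
Proof.
move=> Fs Ft; have /andP[s0 _] := F01 Fs; have /andP[_ t1] := F01 Ft.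
split=> -[_ _ st nF]; split=> //; try exact: F_psi; rewrite ?psi_lt in st *; try by [].
  by move=> x xst /(F_psi i); apply: nF; rewrite !psi_lt.
move=> y; have [x ->] := psi_surj i y; rewrite !psi_lt => xst Fx.
apply: (nF x xst); apply: F_piece Fx.
by case/andP: xst => ? ?; apply/andP; split; lra.
Qed.

Lemma psi_gap_interval i n : exists k, bm k = psi i (bm n) /\ bp k = psi i (bp n).
Proof.
have ng := interval_gap n; have [Fs Ft _ _] := ng.
by apply: gap_interval; apply/psi_gap.
Qed.

Let psi1_mono (i j : 'I_m.+1) : (i <= j)%N -> psi i 1 <= psi j 1.
Proof.
rewrite leq_eqVlt => /orP[/eqP/val_inj -> // | /psi_ord /ltW /le_trans]; apply.
by rewrite psi_le.
Qed.

Let psi0_mono (i j : 'I_m.+1) : (i <= j)%N -> psi i 0 <= psi j 0.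
Proof.
rewrite leq_eqVlt => /orP[/eqP/val_inj -> // | /psi_ord /ltW]; apply: le_trans.
by rewrite psi_le.
Qed.

Lemma middle_gap (i : 'I_m) : is_gap (psi (lidx i) 1) (psi (ridx i) 0).
Proof.
have [_ _ _ pm] := hord; split; [exact/F_psi/F1 | exact/F_psi/F0 | exact: pm |].
move=> x /andP[x1 x2] /F_cover [j [y [/F01 /andP[y0 y1] xy]]].
rewrite {}xy in x1 x2; have [ji|ij] := leqP j (lidx i).
  have := psi1_mono ji; have : psi j y <= psi j 1 by rewrite psi_le.
  lra.
have := psi0_mono (ij : (ridx i <= j)%N).
have : psi j 0 <= psi j y by rewrite psi_le.
lra.
Qed.

(** Endpoints in one piece pull back to a gap of [F]. Endpoints in different pieces leave no room
    for a piece in between, so the interval fills the space between two neighbours. *)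
Lemma interval_cases n :
  (exists i k, bm n = psi i (bm k) /\ bp n = psi i (bp k)) \/
  (exists i : 'I_m, bm n = psi (lidx i) 1 /\ bp n = psi (ridx i) 0).
Proof.
have ng := interval_gap n; have [Fs Ft st nF] := ng.
have [i [x [Fx xE]]] := F_cover Fs; have [j [y [Fy yE]]] := F_cover Ft.
have [ij | ij] := eqVneq i j.
  subst j; left; move: ng; rewrite xE yE => /(psi_gap i Fx Fy) /gap_interval.
  by move=> [k [<- <-]]; exists i, k.
right; have /andP[x0 x1] := F01 Fx; have /andP[y0 y1] := F01 Fy.
have {ij}ij : (i < j)%N.
  rewrite ltn_neqAle ij (pieces_ltn (F01 Fx) (F01 Fy)) //.
  by rewrite -xE -yE ltW.
have im : (i < m)%N by rewrite (leq_trans ij) // -ltnS.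
pose i0 := Ordinal im; have iE : lidx i0 = i by exact: val_inj.
exists i0; rewrite iE.
have rj : (ridx i0 <= j)%N by [].
have h1 := psi_ord ij; have h2 := psi0_mono rj.
have h3 : psi j 0 <= bp n by rewrite yE psi_le.
have h4 : bm n <= psi i 1 by rewrite xE psi_le.
have [_ _ _ /(_ i0)] := hord; rewrite iE => h5.
have h6 : psi i 1 <= bm n.
  by rewrite leNgt; apply/negP => h; apply: (nF (psi i 1)); [lra | exact/F_psi/F1].
have h7 : bp n <= psi (ridx i0) 0.
  by rewrite leNgt; apply/negP => h; apply: (nF (psi (ridx i0) 0));
    [lra | exact/F_psi/F0].
by split; lra.
Qed.

Lemma interval_cases_excl i k (j : 'I_m) : psi i (bm k) <> psi (lidx j) 1.
Proof.
have [Fs Ft st _] := interval_gap k; have /andP[_ t1] := F01 Ft => E.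
have ij := pieces_disjoint (F01 Fs) (F01 F1) E; rewrite ij in E.
by have := psi_inj E; lra.
Qed.

Lemma psi_preimage_enlarge a i s t :
  psi i @^-1` (enlarge a (psi i s) (psi i t)) = enlarge a s t.
Proof.
apply/seteqP; split => x; rewrite /enlarge /= !in_itv /=.
  rewrite [psi i s]psiE [psi i t]psiE [psi i x]psiE => /andP[h1 h2].
  by apply/andP; split; rewrite -(ler_pM2l (r0 i)); lra.
move=> /andP[/(ler_wpM2l (ltW (r0 i))) h1 /(ler_wpM2l (ltW (r0 i))) h2].
rewrite [psi i s]psiE [psi i t]psiE [psi i x]psiE.
by apply/andP; split; lra.
Qed.

Lemma psi_measurable i : measurable_fun [set: measurableTypeR R]
  (psi i : measurableTypeR R -> measurableTypeR R).
Proof.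
rewrite (_ : psi i = fun x => psi i 0 + r i * x); last first.
  by apply/funext => x; exact: psiE.
by apply: measurable_funD => //; apply: measurable_funM.
Qed.

Lemma F_measurable : measurable (F : set (measurableTypeR R)).
Proof. by apply: closed_measurable; exact: F_closed. Qed.

End Geometry.

(** * Self-similar measures *)

Section SelfSimilarMeasure.
Context {R : realType} {m : nat} (psi : 'I_m.+1 -> R -> R) (r : 'I_m.+1 -> R).
Context (F : set R).
Context (ifsF : ifs psi r F).
Context (p : 'I_m.+1 -> R) (mu : probability (measurableTypeR R) R).
Context (hmu : selfsimilar_measure F psi p mu).
Implicit Types A J : set (measurableTypeR R).

Let mF := F_measurable ifsF.

Lemma psi_preimage_measurable i A : measurable A -> measurable (psi i @^-1` A).
Proof.
move=> mA; have := psi_measurable ifsF i measurableT mA.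
by rewrite setTI.
Qed.

Lemma selfsimilar_null A : measurable A -> (forall x, F x -> ~ A x) -> mu A = 0%E.
Proof.
move=> mA FA; have [muF _] := hmu.
apply/eqP; rewrite eq_le measure_ge0 andbT.
have <- : mu (~` F) = 0%E by rewrite probability_setC // muF subee.
by apply: le_measure; rewrite ?inE //; [exact: measurableC | move=> x Ax /FA].
Qed.

(** The preimages of [J] under the other maps miss [F] and are null, so one term of the
    self-similarity relation survives. *)
Lemma selfsimilar_local i J : measurable J ->
  (forall j, j != i -> forall x, F x -> ~ J (psi j x)) ->
  mu J = ((p i)%:E * mu (psi i @^-1` J))%E.
Proof.
move=> mJ Jloc; have [_ muE] := hmu.
rewrite muE // (bigD1 i) //= big1 ?adde0 // => j ji.
rewrite selfsimilar_null ?mule0 //; first exact: psi_preimage_measurable.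
by move=> x Fx; exact: Jloc.
Qed.

Lemma selfsimilar_local_fine i J : measurable J ->
  (forall j, j != i -> forall x, F x -> ~ J (psi j x)) ->
  fine (mu J) = p i * fine (mu (psi i @^-1` J)).
Proof.
move=> mJ Jloc; rewrite (selfsimilar_local mJ Jloc) fineM //.
by rewrite fin_num_measure //; exact: psi_preimage_measurable.
Qed.

Lemma selfsimilar_fine A : measurable A ->
  fine (mu A) = \sum_i p i * fine (mu (psi i @^-1` A)).
Proof.
move=> mA; have [_ muE] := hmu; rewrite muE // -sum_fine; last first.
  by move=> i _; rewrite fin_numM // fin_num_measure //; exact: psi_preimage_measurable.
apply: eq_bigr => i _; rewrite fineM // fin_num_measure //.
exact: psi_preimage_measurable.
Qed.

Lemma fine_mono A J : measurable A -> measurable J -> A `<=` J ->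
  fine (mu A) <= fine (mu J).
Proof.
move=> mA mJ AJ; apply: fine_le; rewrite ?fin_num_measure //.
by apply: le_measure; rewrite ?inE.
Qed.

Lemma fine_le1 A : measurable A -> fine (mu A) <= 1.
Proof.
move=> mA; rewrite -lee_fin fineK ?fin_num_measure //.
exact: probability_le1.
Qed.

(** If [x = psi i y], the ball of radius [e] about [x] pulls back to contain the ball of radius
    [e / r i] about [y], at the price of a factor [p i]. At radius 1 the ball contains all of
    [F]. *)
Lemma ball_mass (hp : forall i, 0 < p i) e : 0 < e -> exists2 c, 0 < c &
  forall x, F x -> c <= fine (mu `[x - e, x + e]%classic).
Proof.
move=> e0; have [rho rho01 rhoP] := ord_lt1_ub (ifs_ratio ifsF).
have [c c0 cP] := finite_set_lb (@finite_finset _ [set: 'I_m.+1]) hp.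
suff key k : forall e, rho ^+ k <= e -> forall x, F x ->
    c ^+ k <= fine (mu `[x - e, x + e]%classic).
  have [k kP] := expr_lt_eps rho01 e0.
  by exists (c ^+ k); [rewrite exprn_gt0 | apply: key; exact: ltW].
elim: k => [|k IH] {}e {}e0 x Fx.
  rewrite expr0 in e0 *; rewrite [leLHS](_ : 1 = fine (mu F)); last by case: hmu => ->.
  apply: fine_mono => //.
  move=> y Fy; have /andP[x0 x1] := F01 ifsF Fx.
  have /andP[y0 y1] := F01 ifsF Fy.
  by rewrite /= in_itv /=; apply/andP; split; lra.
have [i [y [Fy xE]]] := F_cover ifsF Fx.
have ri0 : 0 < r i by case/andP: (ifs_ratio ifsF i).
have step : rho ^+ k <= e / r i.
  rewrite ler_pdivlMr // (le_trans _ e0) // exprSr ler_wpM2l //.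
  by rewrite exprn_ge0 // ltW; case/andP: rho01.
have sub : `[y - e / r i, y + e / r i]%classic `<=`
    psi i @^-1` `[x - e, x + e]%classic.
  move=> z; rewrite /= !in_itv /= => /andP[h1 h2].
  rewrite xE (psiE ifsF i y) (psiE ifsF i z).
  move: (ler_wpM2l (ltW ri0) h1) (ler_wpM2l (ltW ri0) h2).
  by rewrite mulrBr mulrDr (mulrC (r i) (e / r i)) divfK ?gt_eqF // => *;
    apply/andP; split; lra.
have mP j := @psi_preimage_measurable j `[x - e, x + e]%classic (measurable_itv _).
have h : c ^+ k.+1 <= p i * fine (mu (psi i @^-1` `[x - e, x + e]%classic)).
  rewrite exprS; apply: ler_pM; rewrite ?exprn_ge0 // ?cP //; try exact: ltW.
  apply: le_trans (IH _ step y Fy) _.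
  apply: fine_mono; [exact: measurable_itv | exact: mP | exact: sub].
rewrite selfsimilar_fine // (bigD1 i) //= (le_trans h) // lerDl sumr_ge0 // => j _.
by rewrite mulr_ge0 ?fine_ge0 // ltW.
Qed.

End SelfSimilarMeasure.

(** * The moment function *)

Section PowR.
Context {R : realType}.
Implicit Types x y t : R.

Lemma powR_exp x y : 0 < x -> x `^ y = expR (y * ln x).
Proof. by move=> x0; rewrite /powR gt_eqF. Qed.

Lemma powR_two_sided s u y : 0 < s -> exists2 D, 0 < D &
  forall x, s <= x <= u -> D^-1 <= x `^ y <= D.
Proof.
move=> s0; exists (expR (`|y| * (`|ln s| + `|ln u|))); first exact: expR_gt0.
move=> x /andP[sx xu]; have x0 : 0 < x := lt_le_trans s0 sx.
rewrite powR_exp // -expRN !ler_expR -ler_norml normrM ler_wpM2l //.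
have : ln s <= ln x by rewrite ler_ln.
have : ln x <= ln u by rewrite ler_ln // posrE (lt_le_trans x0).
move: (ler_norm (ln u)) (ler_norm (- ln s)) (normr_ge0 (ln u)) (normr_ge0 (ln s)).
by rewrite normrN ler_norml => *; apply/andP; split; lra.
Qed.

Lemma powR_small (y e : R) : 0 < y -> 0 < e ->
  exists2 u, 0 < u & forall x, 0 < x <= u -> x `^ y <= e.
Proof.
move=> y0 e0; exists (expR (ln e / y)); first exact: expR_gt0.
move=> x /andP[x0 xu]; rewrite powR_exp // -[leRHS](@lnK R) ?posrE // ler_expR.
by rewrite mulrC -ler_pdivlMr // -[leRHS]expRK ler_ln // posrE expR_gt0.
Qed.

End PowR.

Section MomentSum.
Context {R : realType} {m : nat} (psi : 'I_m.+1 -> R -> R) (r : 'I_m.+1 -> R).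
Context (F : set R) (ifsF : ifs psi r F).
Context (p : 'I_m.+1 -> R) (mu : probability (measurableTypeR R) R).
Context (hp : forall i, 0 < p i) (hmu : selfsimilar_measure F psi p mu).
Context (q beta b : R) (b0 : 0 < b).
Context (hbeta : \sum_i p i `^ q * r i `^ beta = 1).

Let r0 i : 0 < r i. Proof. by case/andP: (ifs_ratio ifsF i). Qed.

(* The mesh is allowed to be shifted by [s], so that the family of shifted meshes
   is stable under the maps [psi i]. *)
Definition cell (t s : R) (k : int) : set (measurableTypeR R) :=
  `[k%:~R * t + s, (k + 1)%:~R * t + s]%classic.

Definition big_cell (t s : R) (k : int) : set (measurableTypeR R) :=
  enlarge b (k%:~R * t + s) ((k + 1)%:~R * t + s).

Definition cell_term t s k : R :=
  if (0 < mu (cell t s k))%E then fine (mu (big_cell t s k)) `^ q else 0.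

Lemma cell_measurable t s k : measurable (cell t s k).
Proof. exact: measurable_itv. Qed.

Lemma big_cell_measurable t s k : measurable (big_cell t s k).
Proof. exact: measurable_itv. Qed.
Local Hint Resolve cell_measurable big_cell_measurable : core.

Lemma cell_term_ge0 t s k : 0 <= cell_term t s k.
Proof. by rewrite /cell_term; case: ifP => // _; exact: powR_ge0. Qed.

Lemma big_cellE t s k x : big_cell t s k x <->
  (k%:~R - b / 2) * t + s <= x <= (k%:~R + 1 + b / 2) * t + s.
Proof.
rewrite /big_cell /enlarge /= in_itv /= rmorphD /=.
by split=> /andP[h1 h2]; apply/andP; split; lra.
Qed.

Lemma cellE t s k x : cell t s k x <->
  k%:~R * t + s <= x <= (k%:~R + 1) * t + s.
Proof. by rewrite /cell /= in_itv /= rmorphD. Qed.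

Lemma cell_sub t s k : 0 < t -> cell t s k `<=` big_cell t s k.
Proof.
move=> t0 x /cellE /andP[h1 h2]; apply/big_cellE.
have : 0 <= b / 2 * t by rewrite mulr_ge0 ?divr_ge0 // ltW.
by move=> h; apply/andP; split; lra.
Qed.

(** Pulling back changes the size and the shift of the mesh but keeps the index [k], so sums over
    one index set can be compared term by term. *)
Lemma cell_preimage i t s k :
  psi i @^-1` (cell t s k) = cell (t / r i) ((s - psi i 0) / r i) k /\
  psi i @^-1` (big_cell t s k) = big_cell (t / r i) ((s - psi i 0) / r i) k.
Proof.
have E c : c * (t / r i) + (s - psi i 0) / r i = (c * t + s - psi i 0) / r i.
  by ring.
have P x c : (c * (t / r i) + (s - psi i 0) / r i <= x) = (c * t + s <= psi i x).
  by rewrite E ler_pdivrMr // (psiE ifsF i x) lerBlDl [x * _]mulrC.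
have Q x c : (x <= c * (t / r i) + (s - psi i 0) / r i) = (psi i x <= c * t + s).
  by rewrite E ler_pdivlMr // (psiE ifsF i x) lerBrDl [x * _]mulrC.
split; apply/seteqP; split => x.
- by move/cellE => h; apply/cellE; rewrite P Q.
- by move/cellE; rewrite P Q => h; apply/cellE.
- by move/big_cellE => h; apply/big_cellE; rewrite P Q.
- by move/big_cellE; rewrite P Q => h; apply/big_cellE.
Qed.

Lemma cell_null t s k : 0 < t ->
  (forall x, F x -> ~ big_cell t s k x) -> mu (cell t s k) = 0%E.
Proof.
move=> t0 nF; apply: (selfsimilar_null ifsF hmu) => // x Fx.
by move/(cell_sub t0); exact: nF.
Qed.

(** An enlarged cell has length [(1 + b) * t < delta] and meets at most one piece, so at most one
    term on the right is non-zero. *)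
Lemma cell_term_rec : exists2 t0, 0 < t0 & forall t s k, 0 < t < t0 ->
  cell_term t s k =
  \sum_i p i `^ q * cell_term (t / r i) ((s - psi i 0) / r i) k.
Proof.
have [delta d0 dP] := pieces_gap ifsF.
exists (delta / (1 + b)); first by rewrite divr_gt0 // ltr_wpDl // ltW.
move=> t s k /andP[t0]; rewrite ltr_pdivlMr; last by rewrite ltr_wpDl // ltW.
move=> td.
have ti i : 0 < t / r i by rewrite divr_gt0.
have null_i i : (forall x, F x -> ~ big_cell t s k (psi i x)) ->
    cell_term (t / r i) ((s - psi i 0) / r i) k = 0.
  move=> nF; rewrite /cell_term cell_null ?ltxx // => x Fx.
  by rewrite -(cell_preimage i t s k).2; exact: nF.
have [[i [x [Fx xB]]] | none] :=
    pselect (exists i x, F x /\ big_cell t s k (psi i x)); last first.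
  rewrite big1 => [|i _]; last first.
    by rewrite null_i ?mulr0 // => x Fx xB; apply: none; exists i, x.
  rewrite /cell_term cell_null ?ltxx // => y /(F_cover ifsF) [i [x [Fx ->]]] xB.
  by apply: none; exists i, x.
have other j y : j != i -> F y -> ~ big_cell t s k (psi j y).
  move=> ji Fy /big_cellE /andP[h1 h2]; have /big_cellE /andP[h3 h4] := xB.
  have := dP _ _ _ _ ji (F01 ifsF Fy) (F01 ifsF Fx).
  by rewrite leNgt => /negP; apply; rewrite ltr_norml; apply/andP; split; lra.
rewrite (bigD1 i) //= big1 ?addr0 => [|j ji]; last first.
  by rewrite null_i ?mulr0 // => y Fy; exact: other.
rewrite /cell_term; have [<- <-] := cell_preimage i t s k.
rewrite (selfsimilar_local ifsF hmu (i := i)) //; last first.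
  by move=> j ji y Fy /(cell_sub t0); exact: other.
rewrite (selfsimilar_local_fine ifsF hmu (i := i)) //; last first.
  by move=> j ji y Fy; exact: other.
rewrite pmule_rgt0 ?lte_fin //; case: ifP => _; last by rewrite mulr0.
by rewrite powRM ?fine_ge0 // ltW.
Qed.

(** The start of the induction on scales. A term is a [q]-th power with [q] of either sign, so both
    bounds need the mass of the enlarged cell to lie between a positive constant and 1. *)
Let cell_term_bounds t0 u : 0 < t0 -> exists c C, [/\ 0 < c, 0 < C &
  forall t s, t0 <= t <= u -> (exists k, c <= cell_term t s k) /\
    forall A, finite_set A -> \sum_(k \in A) cell_term t s k <= C].
Proof.
move=> t00; have e0 : 0 < t0 / 2 by rewrite divr_gt0.
have be0 : 0 < b * t0 / 2 by rewrite divr_gt0 // mulr_gt0.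
have [c1 c10 c1P] := ball_mass ifsF hmu hp e0.
have [c2 c20 c2P] := ball_mass ifsF hmu hp be0.
have c120 : 0 < c1 / 2 by rewrite divr_gt0.
have [D1 D10 D1P] := powR_two_sided 1 q c120.
have [D2 D20 D2P] := powR_two_sided 1 q c20.
have [N NP] : exists N : nat, t0^-1 + 2 < N%:R.
  by exists (Num.truncn (t0^-1 + 2)).+1; exact: truncnS_gt.
exists D1^-1, (D2 *+ N.+1); split; first by rewrite invr_gt0.
  by rewrite mulrn_wgt0.
move=> t s /andP[tt0 tu]; have tp : 0 < t := lt_le_trans t00 tt0.
split.
  (* The cell containing [- (t0 / 2)]. As [t >= t0], it and its right neighbour cover the ball of
     radius [t0 / 2] about 0, a point of [F], and one of them carries at least half of its mass. *)
  pose k := Num.floor ((- (t0 / 2) - s) / t).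
  have /andP[k1 k2] := floor_itv ((- (t0 / 2) - s) / t).
  rewrite -/k ler_pdivlMr // in k1; rewrite -/k ltr_pdivrMr // rmorphD /= in k2.
  have sub : (`[0 - t0 / 2, 0 + t0 / 2]%classic : set (measurableTypeR R)) `<=`
      cell t s k `|` cell t s (k + 1).
    move=> x /=; rewrite in_itv /= => /andP[x1 x2].
    have [xk | kx] := leP x ((k%:~R + 1) * t + s).
      by left; apply/cellE; apply/andP; split; lra.
    right; apply/cellE; rewrite rmorphD /=; apply/andP; split; lra.
  have [k' k'P] : exists k', c1 / 2 <= fine (mu (cell t s k')).
    have h : c1 <= fine (mu (cell t s k)) + fine (mu (cell t s (k + 1))).
      apply: le_trans (c1P 0 (F0 ifsF)) _.
      rewrite -fineD ?fin_num_measure //; apply: fine_le.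
      - by apply: fin_num_measure; exact: measurable_itv.
      - by rewrite fin_numD !fin_num_measure.
      apply: (@le_trans _ _ (mu (cell t s k `|` cell t s (k + 1)))).
        apply: le_measure; [rewrite inE; exact: measurable_itv | rewrite inE; exact: measurableU | exact: sub].
      exact: measureU2.
    have [h1 | h1] := leP (c1 / 2) (fine (mu (cell t s k))); first by exists k.
    by exists (k + 1); lra.
  exists k'; rewrite /cell_term ifT; last first.
    rewrite -(@fineK _ (mu (cell t s k'))) ?fin_num_measure // lte_fin.
    exact: lt_le_trans k'P.
  have /D1P /andP[] // : c1 / 2 <= fine (mu (big_cell t s k')) <= 1.
  rewrite (fine_le1 mu) // andbT (le_trans k'P) //; apply: fine_mono => //.
  exact: cell_sub.
have supp k : cell_term t s k != 0 -> exists x, F x /\ cell t s k x.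
  move=> nz; apply: contrapT => nex; move: nz; rewrite /cell_term.
  rewrite (selfsimilar_null ifsF hmu) ?ltxx ?eqxx // => x Fx kx.
  by apply: nex; exists x.
have term_le k : cell_term t s k <= D2.
  have [->|nz] := eqVneq (cell_term t s k) 0; first exact: ltW.
  have [x [Fx /cellE /andP[x1 x2]]] := supp k nz.
  rewrite /cell_term; case: ifP => _; last exact: ltW.
  have /D2P /andP[] // : c2 <= fine (mu (big_cell t s k)) <= 1.
  rewrite (fine_le1 mu) // andbT; apply: le_trans (c2P x Fx) _.
  apply: fine_mono => //.
  have : b * t0 / 2 <= b / 2 * t.
    by rewrite mulrAC ler_wpM2l // divr_ge0 // ltW.
  move=> h y; rewrite /= in_itv /= => /andP[y1 y2]; apply/big_cellE.
  by apply/andP; split; lra.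
(* A cell meeting [[0, 1]] has [k] between [- s / t - 1] and [(1 - s) / t]; counted from [K0], these
   indices stay below [t0^-1 + 2 < N]. *)
pose K0 := Num.floor (- s / t - 1).
pose I := (fun j : nat => K0 + j%:Z) @` `I_N.+1.
have If : finite_set I by exact/finite_image.
have suppI k : ~ I k -> cell_term t s k = 0.
  move=> nI; apply/eqP/negPn/negP => /supp [x [/(F01 ifsF) /andP[x0 x1]]].
  move/cellE => /andP[xk1 xk2]; apply: nI.
  have /andP[K1 K2] := floor_itv (- s / t - 1); rewrite -/K0 rmorphD /= in K1 K2.
  have k1 : - s / t - 1 <= k%:~R.
    rewrite lerBlDr ler_pdivrMr //; lra.
  have k2 : k%:~R <= (1 - s) / t by rewrite ler_pdivlMr //; lra.
  have kK : K0 <= k by rewrite -(ler_int R) (le_trans K1).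
  exists `|k - K0|%N; last by rewrite /= gez0_abs ?subr_ge0 // subrKC.
  rewrite /= -(ltr_nat R) -natr1 ltr_pwDr //.
  have -> : `|k - K0|%:R = (k - K0)%:~R :> R.
    by rewrite -[in RHS](gez0_abs (_ : 0 <= k - K0)) ?subr_ge0.
  rewrite rmorphB /=; have : t^-1 <= t0^-1 by rewrite lef_pV2.
  have : (1 - s) / t - (- s / t) = t^-1 by field; rewrite gt_eqF.
  lra.
move=> A Af.
apply: (@le_trans _ _ (\sum_(k \in A `|` I) cell_term t s k)).
  by apply: fsum_subset; rewrite ?finite_setU //; move=> k; exact: cell_term_ge0.
rewrite -(fsbig_widen I) //; last first.
  by move=> k [_ nI]; exact: suppI.
rewrite fsbig_image; last by move=> i j _ _ /addrI [].
rewrite -fsbig_ord -[X in _ *+ X]card_ord -sumr_const; apply: ler_sum => j _.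
exact: term_le.
Qed.

(** By [hbeta], multiples of [t ^ (- beta)] solve the recursion exactly, so bounds by them pass from
    the sizes [t / r i] to [t]. The claim covers all shifts [s] because the recursion changes the
    shift. *)
Lemma moment_bounds : exists c C u, [/\ 0 < c, 0 < C, 0 < u &
  forall t s, 0 < t <= u ->
    (exists2 A, finite_set A &
       c * t `^ (- beta) <= \sum_(k \in A) cell_term t s k) /\
    forall A, finite_set A -> \sum_(k \in A) cell_term t s k <= C * t `^ (- beta)].
Proof.
have [t0 t00 rec] := cell_term_rec.
have [u0 u00 u0P] := ord_ub (fun i => t0 / r i).
have [c [C [c0 C0 cC]]] := cell_term_bounds u0 t00.
have [D D0 DP] := powR_two_sided u0 (- beta) t00.
exists (c / D), (C * D), u0; split; rewrite ?divr_gt0 ?mulr_gt0 //.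
move=> t s tu; move: t tu s.
apply: (scale_induction (ifs_ratio ifsF) t00 u0P).
  move=> t tt s; have [[k kc] AC] := cC t s tt; have /andP[D1 D2] := DP t tt.
  split.
    exists [set k] => //; rewrite fsbig_set1 (le_trans _ kc) //.
    by rewrite -mulrA ger_pMr // ler_pdivrMl // mulr1.
  move=> A /AC /le_trans; apply.
  by rewrite -mulrA ler_peMr ?(ltW C0) // -ler_pdivrMl // mulr1.
move=> t /andP[tp tt0] IH s.
have powE i : (t / r i) `^ (- beta) = t `^ (- beta) * r i `^ beta.
  rewrite !powR_exp ?divr_gt0 // ln_div ?posrE // -expRD; congr expR; ring.
have recE A : finite_set A -> \sum_(k \in A) cell_term t s k =
    \sum_i p i `^ q *
      \sum_(k \in A) cell_term (t / r i) ((s - psi i 0) / r i) k.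
  move=> Af; rewrite [LHS]fsbig_finite //.
  rewrite (eq_bigr _ (fun k _ => rec t s k _)); last by move=> *; rewrite tp.
  by rewrite exchange_big; apply: eq_bigr => i _; rewrite fsbig_finite // mulr_sumr.
have total e : e * t `^ (- beta) =
    \sum_i p i `^ q * (e * (t / r i) `^ (- beta)).
  rewrite -[LHS]mulr1 -hbeta mulr_sumr; apply: eq_bigr => i _.
  by rewrite powE; ring.
split; last first.
  move=> A Af; rewrite recE // total; apply: ler_sum => i _.
  by rewrite ler_wpM2l ?powR_ge0 //; apply: (IH i _).2.
have /boolp.choice [A AP] : forall i, exists A, finite_set A /\
    c / D * (t / r i) `^ (- beta) <=
    \sum_(k \in A) cell_term (t / r i) ((s - psi i 0) / r i) k.
  by move=> i; have [[A ? ?] _] := IH i ((s - psi i 0) / r i); exists A.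
(* The pulled-back sums share the index [k], and terms are non-negative, so the union of the index
   sets serves all [i] at once. *)
have Uf : finite_set (\bigcup_i A i).
  by apply: bigcup_finite => // i _; have [] := AP i.
exists (\bigcup_i A i) => //; rewrite recE // total; apply: ler_sum => i _.
rewrite ler_wpM2l ?powR_ge0 // (le_trans (AP i).2) //.
apply: fsum_subset => //; first by move=> k Ak; exists i.
by move=> k; exact: cell_term_ge0.
Qed.

End MomentSum.

Section Moment.
Context {R : realType} {m : nat} (psi : 'I_m.+1 -> R -> R) (r : 'I_m.+1 -> R).
Context (F : set R) (ifsF : ifs psi r F).
Context (p : 'I_m.+1 -> R) (mu : probability (measurableTypeR R) R).
Context (hp : forall i, 0 < p i) (hmu : selfsimilar_measure F psi p mu).
Context (q beta : R) (hbeta : \sum_i p i `^ q * r i `^ beta = 1).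

Lemma moment_sumE b t : moment_sum mu b q t =
  \esum_(k in [set: int]) (cell_term mu q b t 0 k)%:E.
Proof.
rewrite /moment_sum [LHS]esum_mkcond; apply: eq_esum => k _.
rewrite /cell_term /cell /big_cell !addr0 /mesh; case: ifPn => h.
  by rewrite ifT //; move/set_mem: h.
by rewrite ifF //; apply/negbTE; apply: contra h => h; apply/mem_set.
Qed.

Lemma moment_sum_bounds b : 0 < b -> exists c C u, [/\ 0 < c, 0 < C, 0 < u &
  forall t, 0 < t <= u -> ((c * t `^ (- beta))%:E <= moment_sum mu b q t <=
    (C * t `^ (- beta))%:E)%E].
Proof.
move=> b0; have [c [C [u [c0 C0 u0 uP]]]] := moment_bounds ifsF hp hmu b0 hbeta.
exists c, C, u; split=> // t /(uP t 0) [[A Af cA] CA]; rewrite moment_sumE.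
apply/andP; split.
  by apply: esum_ge; exists A => //; rewrite fsumEFin.
apply: ge_ereal_sup => _ [B [Bf _] <-].
by rewrite fsumEFin // lee_fin; apply: CA.
Qed.

Let moment_fun b t (x : R) : \bar R := ((x `^ t)%:E * moment_sum mu b q x)%E.

Let moment_fun_ge0 b t x : (0 <= moment_fun b t x)%E.
Proof.
rewrite mule_ge0 ?lee_fin ?powR_ge0 //; apply: esum_ge0 => k _.
by rewrite lee_fin powR_ge0.
Qed.

Let moment_fun_bounds b : 0 < b -> exists c C u, [/\ 0 < c, 0 < C, 0 < u &
  forall t x, 0 < x <= u -> ((c * x `^ (t - beta))%:E <= moment_fun b t x <=
    (C * x `^ (t - beta))%:E)%E].
Proof.
move=> b0; have [c [C [u [c0 C0 u0 uP]]]] := moment_sum_bounds b0.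
exists c, C, u; split=> // t x xu; have /andP[x0 _] := xu.
have E e : (e * x `^ (t - beta))%:E = ((x `^ t)%:E * (e * x `^ (- beta))%:E)%E.
  rewrite -EFinM powRD; last by rewrite (gt_eqF x0) implybT.
  by congr _%:E; ring.
have /andP[h1 h2] := uP x xu; rewrite !E.
by apply/andP; split; apply: lee_wpmul2l => //; rewrite lee_fin powR_ge0.
Qed.

Let near0_ex (V : set R) (u : R) : (0 : R)^'+ V -> 0 < u ->
  exists2 x, V x & 0 < x <= u.
Proof.
move=> V0 u0; have : (0 : R)^'+ (V `&` [set x | 0 < x <= u]).
  apply: filterI => //; near=> x; rewrite /=; apply/andP; split.
    by near: x; exact: nbhs_right_gt.
  by near: x; exact: nbhs_right_le.
by move/filter_ex => [x [? ?]]; exists x.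
Unshelve. all: by end_near.
Qed.

Let moment_limsup_le b t e u : 0 < u ->
  (forall x, 0 < x <= u -> (moment_fun b t x <= e)%E) ->
  (moment_limsup mu b q t <= e)%E.
Proof.
move=> u0 ue; rewrite /moment_limsup limf_esupE.
apply: (@le_trans _ _ (ereal_sup [set moment_fun b t x | x in [set x | 0 < x <= u]])).
  apply: ereal_inf_lbound; exists [set x | 0 < x <= u] => //.
  near=> x; rewrite /=; apply/andP; split.
    by near: x; exact: nbhs_right_gt.
  by near: x; exact: nbhs_right_le.
by apply: ge_ereal_sup => _ [x xu <-]; exact: ue.
Unshelve. all: by end_near.
Qed.

Let moment_limsup_ge b t e u : 0 < u ->
  (forall x, 0 < x <= u -> (e <= moment_fun b t x)%E) ->
  (e <= moment_limsup mu b q t)%E.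
Proof.
move=> u0 ue; rewrite /moment_limsup limf_esupE.
apply: le_ereal_inf_tmp => _ [V V0 <-].
have [x Vx xu] := near0_ex V0 u0.
apply: le_trans (ue x xu) _; apply: ereal_sup_ubound; exists x => //.
Qed.

Lemma moment_limsup_gt b t : 0 < b -> beta < t -> moment_limsup mu b q t = 0%E.
Proof.
move=> b0 bt; have [c [C [u [c0 C0 u0 uP]]]] := moment_fun_bounds b0.
apply/eqP; rewrite eq_le; apply/andP; split; last first.
  apply: limf_esup_ge0 => [|x]; last exact: moment_fun_ge0.
  exact: filter_not_empty.
apply/lee_addgt0Pr => e e0; rewrite add0e.
have [v v0 vP] := powR_small (y := t - beta) (ltac:(by rewrite subr_gt0)) (divr_gt0 e0 C0).
apply: (@moment_limsup_le b t _ (Num.min u v)); first by rewrite lt_min u0.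
move=> x /andP[x0]; rewrite le_min => /andP[xu xv].
have /andP[_ h] := uP t x (ltac:(by rewrite x0 xu)).
apply: le_trans h _; rewrite lee_fin mulrC -ler_pdivlMr //.
by apply: vP; rewrite x0.
Qed.

Lemma moment_limsup_lt b t : 0 < b -> t < beta -> moment_limsup mu b q t = +oo%E.
Proof.
move=> b0 bt; have [c [C [u [c0 C0 u0 uP]]]] := moment_fun_bounds b0.
apply/eqyP => M M0.
have [v v0 vP] := powR_small (y := beta - t) (ltac:(by rewrite subr_gt0)) (divr_gt0 c0 M0).
apply: (@moment_limsup_ge b t _ (Num.min u v)); first by rewrite lt_min u0.
move=> x /andP[x0]; rewrite le_min => /andP[xu xv].
have /andP[h _] := uP t x (ltac:(by rewrite x0 xu)).
apply: le_trans h; rewrite lee_fin -(opprB beta t) powRN.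
rewrite ler_pdivlMr ?powR_gt0 // mulrC -ler_pdivlMr //.
by apply: vP; rewrite x0.
Qed.

Lemma moment_limsup_eq b : 0 < b -> exists c C : R,
  0 < c /\ (c%:E <= moment_limsup mu b q beta <= C%:E)%E.
Proof.
move=> b0; have [c [C [u [c0 C0 u0 uP]]]] := moment_fun_bounds b0.
exists c, C; split=> //; apply/andP; split.
  apply: (@moment_limsup_ge b beta _ u) => // x /(uP beta) /andP[].
  by rewrite subrr powRr0 mulr1.
apply: (@moment_limsup_le b beta _ u) => // x /(uP beta) /andP[_].
by rewrite subrr powRr0 mulr1.
Qed.

(** At [beta] itself the upper limit is positive and finite, so [beta] belongs to neither set: they
    are the open half-lines on its two sides. *)
Lemma selfsimilar_moment : is_moment mu q beta.
Proof.
move=> b b0; have [c [C [c0 /andP[h1 h2]]]] := moment_limsup_eq b0.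
have -> : [set t | moment_limsup mu b q t = 0%E] = [set t | beta < t].
  apply/seteqP; split=> t /=; last exact: moment_limsup_gt.
  case: (ltgtP beta t) => // [tb | <-] E.
    by move: E; rewrite moment_limsup_lt.
  by move: h1; rewrite E lee_fin leNgt c0.
have -> : [set t | moment_limsup mu b q t = +oo%E] = [set t | t < beta].
  apply/seteqP; split=> t /=; last exact: moment_limsup_lt.
  case: (ltgtP t beta) => // [tb | ->] E.
    by move: E; rewrite moment_limsup_gt.
  by move: h2; rewrite E.
split; apply/eqP; rewrite eq_le; apply/andP; split.
- apply/lee_addgt0Pr => e e0; apply: ereal_inf_lbound.
  by exists (beta + e); rewrite //= ltrDl.
- by apply: le_ereal_inf_tmp => _ [t /= /ltW bt <-]; rewrite lee_fin.
- by apply: ge_ereal_sup => _ [t /= /ltW bt <-]; rewrite lee_fin.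
- apply/lee_subgt0Pr => e e0; apply: ereal_sup_ubound.
  by exists (beta - e); rewrite //= ltrBlDr ltrDl.
Qed.

End Moment.

(** * The complementary intervals as a renewal system *)

Section SiteSums.
Context {R : realType}.

Lemma fsum_setT_ord (n : nat) (f : 'I_n -> R) :
  \sum_(i \in [set: 'I_n]) f i = \sum_i f i.
Proof.
have -> : [set: 'I_n] = [set` index_enum 'I_n].
  by apply/seteqP; split=> // i _ /=; rewrite mem_index_enum.
by rewrite -fsbig_seq // index_enum_uniq.
Qed.

Lemma fsum_site (B : set nat) (h : nat -> R) : finite_set B ->
  \sum_(x \in B `*` [set: bool]) h x.1 = 2 * \sum_(n \in B) h n.
Proof.
move=> Bf.
rewrite -(@pair_fsbig _ _ _ _ _ B [set: bool] (fun n b => h n)) //; last first.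
  exact: finite_finset.
rewrite fsbig_distrr //; apply: eq_fsbigr => n _.
have -> : [set: bool] = [set` [:: true; false]] by apply/seteqP; split=> [[]|].
by rewrite -fsbig_seq // big_cons big_seq1 /= mulr_natl mulr2n.
Qed.

Lemma fsum_siteT (h : nat -> R) : finite_set [set n | h n != 0] ->
  \sum_(x \in [set: site]) h x.1 = 2 * \sum_(n \in [set: nat]) h n.
Proof.
move=> hf; rewrite (@fsum_widen _ _ (fun x : site => h x.1)
   ([set n | h n != 0] `*` [set: bool])); last first.
  move=> [n b] /= nh; apply/eqP/negPn/negP => h0; exact: nh.
rewrite fsum_site // (@fsum_widen _ _ h [set n | h n != 0]) //.
by move=> n /= /negP/negPn/eqP.
Qed.

End SiteSums.

Section IntervalRenewal.
Context {R : realType} {m : nat} (psi : 'I_m.+1 -> R -> R) (r : 'I_m.+1 -> R).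
Context (F : set R) (bm bp : nat -> R) (ifsF : ifs psi r F).
Context (hI : complementary_intervals F bm bp).
Context (kap : 'I_m.+1 -> nat -> nat) (gap : 'I_m -> nat).
Context (kapP : forall i n,
  bm (kap i n) = psi i (bm n) /\ bp (kap i n) = psi i (bp n)).
Context (gapP : forall i,
  bm (gap i) = psi (lidx i) 1 /\ bp (gap i) = psi (ridx i) 0).
Context (p : 'I_m.+1 -> R) (mu : probability (measurableTypeR R) R).
Context (hp : forall i, 0 < p i) (hmu : selfsimilar_measure F psi p mu).
Context (q beta a : R) (a0 : 0 < a).
Context (hbeta : \sum_i p i `^ q * r i `^ beta = 1).

Let r0 i : 0 < r i. Proof. by case/andP: (ifs_ratio ifsF i). Qed.
Let r1 i : r i < 1. Proof. by case/andP: (ifs_ratio ifsF i). Qed.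

Definition weight i : R := p i `^ q * r i `^ beta.

Definition density n : R :=
  fine (mu (enlarge a (bm n) (bp n))) `^ q * (bp n - bm n) `^ beta.

Definition site_kap i (j : site) : site := (kap i j.1, j.2).

Let len0 n : 0 < bp n - bm n.
Proof. by rewrite subr_gt0; have [] := interval_gap hI n. Qed.

Let len_kap i n : bp (kap i n) - bm (kap i n) = r i * (bp n - bm n).
Proof.
by have [-> ->] := kapP i n; rewrite (psiE ifsF i (bp n)) (psiE ifsF i (bm n)); ring.
Qed.

Let kap_inj i j n k : kap i n = kap j k -> i = j /\ n = k.
Proof.
move=> E; have [b1 _] := kapP i n; have [b2 _] := kapP j k.
rewrite E b2 in b1.
have [Fn _ _ _] := interval_gap hI n; have [Fk _ _ _] := interval_gap hI k.
have ij := pieces_disjoint ifsF (F01 ifsF Fk) (F01 ifsF Fn) b1; subst j.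
by split=> //; apply: (interval_inj hI); apply/esym/(psi_inj ifsF b1).
Qed.

Let kap_gap n : ~ range gap n <-> exists i k, n = kap i k.
Proof.
split=> [ngap | [i [k ->]] [j _ jE]].
  have [[i [k [b1 _]]] | [i [b1 _]]] := interval_cases ifsF hI n.
    by exists i, k; apply: (interval_inj hI); rewrite b1; case: (kapP i k).
  exfalso; apply: ngap; exists i => //; apply: (interval_inj hI).
  by rewrite b1; case: (gapP i).
apply: (interval_cases_excl ifsF hI (i := i) (k := k) (j := j)).
by have [<- _] := kapP i k; have [<- _] := gapP j; rewrite jE.
Qed.

(** Numbers are ordered by decreasing length and [psi i] strictly shortens, so the number itself can
    serve as [renewal_rank]. *)
Let kap_gt i n : (n < kap i n)%N.
Proof.
rewrite ltnNge; apply/negP => kn; have [_ _ _ /(_ _ _ kn)] := hI.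
by rewrite len_kap leNgt gtr_pMl ?r1.
Qed.

Lemma interval_length_vanish t : 0 < t -> finite_set [set n | t <= bp n - bm n].
Proof.
have Xf : finite_set (range gap) by apply: finite_image; exact: finite_finset.
apply: (decay_vanish (ifs_ratio ifsF) len0 Xf kap_gt) => n /kap_gap [i [k ->]].
by exists i, k.
Qed.

Lemma enlarge_mass_gt0 n : 0 < fine (mu (enlarge a (bm n) (bp n))).
Proof.
have [Fn _ _ _] := interval_gap hI n.
have e0 : 0 < a / 2 * (bp n - bm n) by rewrite !mulr_gt0 // invr_gt0.
pose e := Num.min (a / 2 * (bp n - bm n)) (bp n - bm n).
have ep : 0 < e by rewrite lt_min e0 len0.
have [c c0 cP] := ball_mass ifsF hmu hp ep.
apply: lt_le_trans c0 _; apply: le_trans (cP _ Fn) _.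
apply: fine_mono; [exact: measurable_itv | exact: measurable_itv |].
have e1 : e <= a / 2 * (bp n - bm n) by rewrite ge_min lexx.
have e2 : e <= bp n - bm n by rewrite ge_min lexx orbT.
move=> x; rewrite /enlarge /= !in_itv /= => /andP[x1 x2].
by apply/andP; split; lra.
Qed.

Lemma density_gt0 n : 0 < density n.
Proof. by rewrite mulr_gt0 // powR_gt0 // enlarge_mass_gt0. Qed.

Lemma weight_gt0 i : 0 < weight i.
Proof. by rewrite mulr_gt0 // powR_gt0. Qed.

Lemma weight_lt1 i : weight i < 1.
Proof.
have [j ji] : exists j, j != i.
  have [i0|] := eqVneq i ord0; last by rewrite eq_sym; exists ord0.
  exists ord_max; rewrite i0 -val_eqE /= -lt0n.
  exact: m_gt0 ifsF.
rewrite -hbeta (bigD1 i) //= ltrDl (bigD1 j) //= ltr_pwDl ?weight_gt0 //.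
by apply: sumr_ge0 => k _; rewrite ltW // weight_gt0.
Qed.

(** For a short interval the enlargement of its image protrudes by less than [delta]. A point of
    another piece inside it would be closer than [delta] to an endpoint of the image, which lies in
    piece [i], or would lie in the gap. *)
Lemma density_irregular i :
  finite_set [set n | density (kap i n) != weight i * density n].
Proof.
have [delta d0 dP] := pieces_gap ifsF.
have h0 : 0 < delta / (a / 2 * r i) by rewrite divr_gt0 // !mulr_gt0 // invr_gt0.
apply: sub_finite_set (interval_length_vanish h0) => n /=; apply: contraR.
rewrite -ltNge ltr_pdivlMr ?mulr_gt0 ?invr_gt0 // => small; apply/eqP.
have [b1 b2] := kapP i n; rewrite /density len_kap b1 b2.
have [Fm Fp st nF] := interval_gap hI (kap i n).
rewrite b1 in Fm st nF; rewrite b2 in Fp st nF.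
have [Fn Fn' _ _] := interval_gap hI n.
have len : psi i (bp n) - psi i (bm n) = r i * (bp n - bm n).
  by rewrite -len_kap b1 b2.
rewrite (selfsimilar_local_fine ifsF hmu (i := i)); last 2 first.
- exact: measurable_itv.
- move=> j ji x Fx; rewrite /enlarge /= in_itv /= len => /andP[x1 x2].
  have := dP j i x (bm n) ji (F01 ifsF Fx) (F01 ifsF Fn).
  have := dP j i x (bp n) ji (F01 ifsF Fx) (F01 ifsF Fn').
  have [y1 | y1] := leP (psi j x) (psi i (bm n)).
    by move=> _; rewrite ler0_norm; lra.
  have [y2 | y2] := leP (psi i (bp n)) (psi j x).
    by rewrite ger0_norm; lra.
  by case: (nF (psi j x)); [rewrite y1 y2 | exact: (F_psi ifsF)].
rewrite (psi_preimage_enlarge ifsF) /weight !powRM ?fine_ge0 ?(ltW (len0 n)) //;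
  last 2 first.
- exact: ltW.
- exact: ltW.
by ring.
Qed.

Lemma interval_renewal :
  renewal site_kap weight (fun j : site => density j.1) (range gap `*` [set: bool]).
Proof.
split.
- by move=> i; rewrite weight_gt0 weight_lt1.
- exact: hbeta.
- by move=> i j [n b] [k b'] [/kap_inj[-> ->] ->].
- apply: finite_setX; last exact: finite_finset.
  by apply: finite_image; exact: finite_finset.
- move=> [n b]; split=> [nZ | [i [[k b'] [-> ->]]] [/= gk _]].
    have /kap_gap [i [k kE]] : ~ range gap n by move=> h; apply: nZ.
    by exists i, (k, b); rewrite /site_kap /= kE.
  by apply: (kap_gap (kap i k)).2 gk; exists i, k.
- by move=> j; exact: density_gt0.
- move=> i; apply: (@sub_finite_set _ _
   ([set n | density (kap i n) != weight i * density n] `*` [set: bool])).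
    by move=> [n b].
  by apply: finite_setX; [exact: density_irregular | exact: finite_finset].
- by exists fst => i [n b]; exact: kap_gt.
Qed.

(** The intervals inside piece [i] are the images under [psi i]: the midpoint of a gap between
    neighbouring pieces lies in no piece, and that of an image in another piece is not in piece
    [i]. *)
Let r0_rangeE i : r0_range psi bm bp i = range (kap i).
Proof.
apply/seteqP; split=> n.
  rewrite /r0_range /= => sub.
  have [Fm Fp st nF] := interval_gap hI n.
  have : (psi i @` `[0, 1]%classic) ((bm n + bp n) / 2).
    by apply: sub; rewrite /= in_itv /=; apply/andP; split; lra.
  case=> y /=; rewrite in_itv /= => y01 yE.
  have [[j [k [b1 b2]]] | [j [b1 b2]]] := interval_cases ifsF hI n.
    have [Fk1 Fk2 _ _] := interval_gap hI k.
    have /andP[k1 _] := F01 ifsF Fk1; have /andP[_ k2] := F01 ifsF Fk2.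
    have [z zE] := psi_surj ifsF j ((bm n + bp n) / 2).
    have z1 : bm k <= z by rewrite -(psi_le ifsF j) -zE -b1; lra.
    have z2 : z <= bp k by rewrite -(psi_le ifsF j) -zE -b2; lra.
    have z01 : 0 <= z <= 1 by apply/andP; split; lra.
    have ij : i = j by apply: (pieces_disjoint ifsF y01 z01); rewrite yE.
    subst j; exists k => //; apply: (interval_inj hI).
    by rewrite b1; case: (kapP i k).
  have /andP[y0 y1] := y01.
  have i1 : (lidx j <= i)%N.
    apply: (pieces_ltn ifsF (x := 1) (y := y)) => //; first by rewrite ler01 lexx.
    by rewrite -b1 yE; lra.
  have i2 : (i <= ridx j)%N.
    apply: (pieces_ltn ifsF (x := y) (y := 0)) => //; first by rewrite ler01 lexx.
    by rewrite -b2 yE; lra.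
  move: i1; rewrite leq_eqVlt => /orP[/eqP/val_inj E | i1].
    have : psi i y <= psi i 1 by rewrite (psi_le ifsF).
    by rewrite yE -E -b1; lra.
  have E : ridx j = i by apply: val_inj; apply/eqP; rewrite eqn_leq i2 andbT.
  have : psi i 0 <= psi i y by rewrite (psi_le ifsF).
  by rewrite yE -E -b2; lra.
case=> k _ <- x /=; rewrite in_itv /=; have [-> ->] := kapP i k.
have [y ->] := psi_surj ifsF i x; rewrite !(psi_lt ifsF) => /andP[y1 y2].
exists y => //; rewrite in_itv /=.
have [Fk1 Fk2 _ _] := interval_gap hI k.
have /andP[k1 _] := F01 ifsF Fk1; have /andP[_ k2] := F01 ifsF Fk2.
by apply/andP; split; lra.
Qed.

Let r0_term_kap i n : r0_term psi p bm bp mu a q beta i (kap i n) =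
  density (kap i n) - weight i * density n.
Proof.
rewrite /r0_term /density /weight !len_kap; have [-> ->] := kapP i n.
rewrite (psi_preimage_enlarge ifsF) [(r i * _) `^ beta]powRM ?(ltW (r0 i)) ?(ltW (len0 n)) //.
by ring.
Qed.

Lemma r0_term_finite i : finite_set [set n | r0_range psi bm bp i n /\
  r0_term psi p bm bp mu a q beta i n != 0].
Proof.
rewrite r0_rangeE; apply: sub_finite_set (finite_image (kap i) (density_irregular i)).
move=> _ [[n _ <-]]; rewrite r0_term_kap subr_eq0 => ne.
by exists n.
Qed.

(** The factor 2 counts the two sites of each interval, which share one density. *)
Lemma renewal_mass_r0 :
  renewal_mass site_kap weight (fun j : site => density j.1)
    (range gap `*` [set: bool]) = 2 * Defs.r0 psi p bm bp mu a q beta.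
Proof.
rewrite /renewal_mass /Defs.r0 fsum_site; last by apply: finite_image; exact: finite_finset.
rewrite mulrDr addrC; congr (_ + _).
  rewrite mulr_sumr; apply: eq_bigr => i _.
  rewrite (@fsum_siteT _ (fun n => density (kap i n) - weight i * density n)).
    rewrite r0_rangeE fsbig_image; last by move=> n k _ _ /kap_inj [].
    by congr (_ * _); apply: eq_fsbigr => n _; rewrite r0_term_kap.
  by apply: sub_finite_set (density_irregular i) => n /=; rewrite subr_eq0.
congr (_ * _); rewrite fsbig_image; last first.
  move=> i j _ _ E; have [g1 _] := gapP i; have [g2 _] := gapP j.
  rewrite E g2 in g1; have o01 := F01 ifsF (F1 ifsF).
  have := congr1 val (pieces_disjoint ifsF o01 o01 g1).
  by move=> /= /esym; exact: val_inj.
rewrite fsum_setT_ord; apply: eq_bigr => i _.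
by rewrite /density; have [-> ->] := gapP i; rewrite mulrC.
Qed.

End IntervalRenewal.

(** * Integrals of continuous functions *)

Section SelfSimilarIntegral.
Context {R : realType} {m : nat} (psi : 'I_m.+1 -> R -> R) (r : 'I_m.+1 -> R).
Context (F : set R) (ifsF : ifs psi r F).
Context (w : 'I_m.+1 -> R) (nu : probability (measurableTypeR R) R).
Context (w0 : forall i, 0 <= w i) (hnu : selfsimilar_measure F psi w nu).
Local Notation T := (measurableTypeR R).

Let mF : measurable (F : set T) := F_measurable ifsF.

Let psim i : {mfun T >-> T} :=
  HB.pack (psi i : T -> T) (isMeasurableFun.Build _ _ _ _ _ (psi_measurable ifsF i)).

Let measurable_psi (g : T -> R) i : measurable_fun (F : set T) g ->
  measurable_fun (F : set T) (g \o psi i).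
Proof.
move=> mg; apply: (measurable_comp mF) => //.
  by move=> _ [x Fx <-]; exact: (F_psi ifsF).
exact: measurable_funTS (psi_measurable ifsF i).
Qed.

Let ge0_integral_selfsimilar (g : T -> R) : measurable_fun (F : set T) g ->
  (forall x, F x -> 0 <= g x) ->
  (\int[nu]_(x in F) (g x)%:E =
   \sum_i (w i)%:E * \int[nu]_(x in F) (g (psi i x))%:E)%E.
Proof.
move=> mg g0; have [nuF nuE] := hnu.
(* [msum] takes a sequence of measures indexed by [nat]; [inord] converts, and only indices below
   [m.+1] are summed. *)
pose m_ (k : nat) : {measure set T -> \bar R} :=
  mscale (NngNum (w0 (inord k))) (distribution nu (psim (inord k))).
have mgE : measurable_fun (F : set T) (EFin \o g) by exact/measurable_EFinP.
have gE0 x : F x -> (0 <= (EFin \o g) x)%E by move=> /g0; rewrite /= lee_fin.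
rewrite (eq_measure_integral (msum m_ m.+1)); last first.
  move=> A mA _; apply: etrans (nuE A mA) _; rewrite /msum; apply: eq_bigr => i _.
  by rewrite /m_ /mscale /= inord_val.
rewrite ge0_integral_measure_sum //; apply: eq_bigr => i _.
rewrite /m_ ge0_integral_mscale //= inord_val; congr (_ * _)%E.
rewrite (ge0_integral_pushforward (psi_measurable ifsF i)) //; last first.
  by move=> x /set_mem /gE0.
have mP : measurable (psi i @^-1` F : set T).
  exact: (psi_preimage_measurable ifsF).
have mgP : measurable_fun (psi i @^-1` F : set T) ((EFin \o g) \o psi i).
  apply: (measurable_comp mF) => //.
    by move=> _ [x Fx <-].
  exact: measurable_funTS (psi_measurable ifsF i).
have mN : measurable (~` F : set T) by exact: measurableC.
have N0 : nu (~` F) = 0%E by rewrite probability_setC // nuF subee.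
(* The preimage of [F] under [psi i] contains [F] and exceeds it by a null set only. *)
have -> := @ge0_negligible_integral _ T R nu _ _ _ mN mP mgP (fun x Px => gE0 _ Px) N0.
congr (integral _ _ _); apply/seteqP; split=> [x [Fx /contrapT] // | x Fx].
by split; [exact: (F_psi ifsF) | exact].
Qed.

Let bounded_integrable (g : T -> R) (B : R) : measurable_fun (F : set T) g ->
  (forall x, F x -> `|g x| <= B) -> nu.-integrable F (EFin \o g).
Proof.
move=> mg gB; apply: measurable_bounded_integrable => //.
  by apply: le_lt_trans (probability_le1 nu mF) (ltry _).
exists B; split; first exact: num_real.
by move=> M BM x /= Fx; apply: le_trans (gB x Fx) (ltW BM).
Qed.

Let w1 : \sum_i w i = 1.
Proof.
have [_ nuE] := hnu; have := nuE setT measurableT; have E : nu setT = 1%E by exact: probability_setT.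
move=> h; have {h} : (1 = \sum_i (w i)%:E)%E.
  apply: etrans (esym E) (etrans h _); apply: eq_bigr => i _.
  by rewrite -[RHS]mule1; congr (_ * _)%E; exact: E.
by rewrite sumEFin => -[].
Qed.

Let Rcst (c : R) : \int[nu]_(x in F) c = c.
Proof.
transitivity (c * fine (nu F)); first exact: Rintegral_cst.
by have [-> _] := hnu; rewrite mulr1.
Qed.

(** Adding [B] reduces to a non-negative integrand; since the weights sum to 1, the added constant
    cancels. *)
Lemma Rintegral_selfsimilar (g : T -> R) (B : R) : measurable_fun (F : set T) g ->
  (forall x, F x -> `|g x| <= B) ->
  \int[nu]_(x in F) g x = \sum_i w i * \int[nu]_(x in F) g (psi i x).
Proof.
move=> mg gB; have [nuF nuE] := hnu.
have B0 : 0 <= B := le_trans (normr_ge0 _) (gB 0 (F0 ifsF)).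
have mgi i := measurable_psi i mg.
have gBi i x : F x -> `|(g \o psi i) x| <= B by move=> Fx; apply/gB/(F_psi ifsF).
have icst : nu.-integrable F (EFin \o (fun=> B)).
  by apply: (@bounded_integrable (fun=> B) B) => // x _; rewrite ger0_norm.
have h : \int[nu]_(x in F) (g x + B) = \sum_i w i * \int[nu]_(x in F) (g (psi i x) + B).
  have mgB : measurable_fun (F : set T) (fun x => g x + B).
    by apply: measurable_funD.
  have gB0 x : F x -> 0 <= g x + B.
    by move=> /gB; rewrite ler_norml => /andP[? _]; lra.
  rewrite /Rintegral (ge0_integral_selfsimilar mgB gB0) -sum_fine.
    apply: eq_bigr => i _; rewrite fineM //.
    apply: integrable_fin_num => //.
    have := integrableD mF (bounded_integrable (mgi i) (gBi i)) icst.
    by apply: eq_integrable.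
  move=> i _; rewrite fin_numM //.
  apply: integrable_fin_num => //.
  have := integrableD mF (bounded_integrable (mgi i) (gBi i)) icst.
  by apply: eq_integrable.
have split_int (g' : T -> R) : nu.-integrable F (EFin \o g') ->
    \int[nu]_(x in F) (g' x + B) = \int[nu]_(x in F) g' x + B.
  by move=> ig; rewrite RintegralD // Rcst.
rewrite split_int in h; last exact: bounded_integrable gB.
have h2 : \sum_i w i * \int[nu]_(x in F) (g (psi i x) + B) =
    \sum_i w i * \int[nu]_(x in F) g (psi i x) + B.
  rewrite -[X in _ = _ + X]mul1r -w1 mulr_suml -big_split /=.
  apply: eq_bigr => i _; rewrite -mulrDr.
  by rewrite -(split_int (g \o psi i) (bounded_integrable (mgi i) (gBi i))).
by move: h; rewrite h2 => /addIr.
Qed.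

Context (bm bp : nat -> R) (kap : 'I_m.+1 -> nat -> nat).
Context (hI : complementary_intervals F bm bp).
Context (kapP : forall i n,
  bm (kap i n) = psi i (bm n) /\ bp (kap i n) = psi i (bp n)).

Lemma endpoint_kap i (j : site) :
  endpoint bm bp (site_kap kap i j) = psi i (endpoint bm bp j).
Proof. by rewrite /endpoint /site_kap /=; have [-> ->] := kapP i j.1; case: ifP. Qed.

Lemma F_endpoint j : F (endpoint bm bp j).
Proof. by rewrite /endpoint; have [? ? _ _] := interval_gap hI j.1; case: ifP. Qed.

(** The tolerance is a power of [rho] so that composing with one [psi i] lowers [k] by one, in step
    with [level_osc] and [wavg]. *)
Definition modulus rho (k : nat) (f : R -> R) (eps : R) :=
  forall x y, F x -> F y -> `|x - y| <= rho ^+ k -> `|f x - f y| <= eps.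

Lemma modulus_psi rho k f eps i : (forall i, r i <= rho) ->
  modulus rho k.+1 f eps -> modulus rho k (f \o psi i) eps.
Proof.
move=> rrho fm x y Fx Fy xy; apply: fm; [exact: (F_psi ifsF)|exact: (F_psi ifsF)|].
have ri : 0 < r i by case/andP: (ifs_ratio ifsF i).
rewrite (ifs_similarity ifsF) exprS; apply: ler_pM => //; exact: ltW.
Qed.

Lemma modulus_level_osc rho k f eps x0 : (forall i, r i <= rho) ->
  modulus rho k f eps -> level_osc (site_kap kap) x0 k (f \o endpoint bm bp) eps.
Proof.
move=> rrho; elim: k f => [|k IH] f fm /=.
  move=> j; apply: fm; try exact: F_endpoint; rewrite expr0.
  have /andP[a0 a1] := F01 ifsF (F_endpoint j).
  have /andP[b0 b1] := F01 ifsF (F_endpoint x0).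
  by rewrite ler_norml; apply/andP; split; lra.
move=> i; have -> : (f \o endpoint bm bp) \o site_kap kap i =
    (f \o psi i) \o endpoint bm bp.
  by apply/funext => j; rewrite /= endpoint_kap.
by apply: IH; exact: modulus_psi.
Qed.

Lemma integral_wavg rho k (f : R -> R) eps x0 (B : R) : (forall i, r i <= rho) ->
  measurable_fun (F : set T) (f : T -> R) -> (forall x, F x -> `|f x| <= B) ->
  modulus rho k f eps ->
  `|\int[nu]_(x in F) f x - wavg (site_kap kap) w x0 k (f \o endpoint bm bp)|
    <= eps.
Proof.
move=> rrho; elim: k f => [|k IH] f mf fB fm /=.
  set v := f _.
  have icst c : nu.-integrable F (EFin \o (fun=> c)).
    by apply: (@bounded_integrable (fun=> c) `|c|) => // x _.
  have fi := bounded_integrable mf fB.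
  have osc x : F x -> `|f x - v| <= eps.
    move=> Fx; apply: fm => //; first exact: F_endpoint.
    have /andP[a0 a1] := F01 ifsF Fx; have /andP[b0 b1] := F01 ifsF (F_endpoint x0).
    by rewrite expr0 ler_norml; apply/andP; split; lra.
  have hi : \int[nu]_(x in F) f x <= \int[nu]_(x in F) (v + eps).
    by apply: le_Rintegral => // x /osc; rewrite ler_norml => /andP[_ ?]; lra.
  have lo : \int[nu]_(x in F) (v - eps) <= \int[nu]_(x in F) f x.
    by apply: le_Rintegral => // x /osc; rewrite ler_norml => /andP[? _]; lra.
  rewrite !Rcst in hi lo.
  by rewrite ler_norml; apply/andP; split; lra.
rewrite (Rintegral_selfsimilar mf fB); apply: (weighted_dist w0 w1) => i.
have -> : (f \o endpoint bm bp) \o site_kap kap i =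
    (f \o psi i) \o endpoint bm bp.
  by apply/funext => j; rewrite /= endpoint_kap.
apply: (IH (f \o psi i)).
- exact: measurable_psi.
- by move=> x Fx; apply/fB/(F_psi ifsF).
- exact: modulus_psi.
Qed.

End SelfSimilarIntegral.

Section ContinuousOn.
Context {R : realType} {m : nat} (psi : 'I_m.+1 -> R -> R) (r : 'I_m.+1 -> R).
Context (F : set R) (ifsF : ifs psi r F).

Definition cont_on (g : R -> R) : Prop := forall x, F x -> forall e, 0 < e ->
  exists2 delta, 0 < delta & forall y, F y -> `|x - y| < delta -> `|g x - g y| < e.

Lemma cont_on_modulus g rho e : cont_on g -> 0 < rho < 1 -> 0 < e ->
  exists k, modulus F rho k g e.
Proof.
move=> gc rho01 e0; have [_ Fc _] := ifs_set ifsF.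
move/compact_near_coveringP: Fc => Fcov.
pose P (delta x : R) := F x -> forall y, F y -> `|x - y| <= delta -> `|g x - g y| <= e.
have : \forall delta \near (0 : R)^'+, F `<=` P delta.
  apply: Fcov => x Fx; have [d d0 dP] := gc x Fx (e / 2) (divr_gt0 e0 (ltr0n _ 2)).
  exists (ball x (d / 2), [set delta | delta < d / 2]).
    split => /=; first by apply: nbhsx_ballx; rewrite divr_gt0.
    by apply: nbhs_right_lt; rewrite divr_gt0.
  move=> [x' delta] /= [xx' dd] Fx' y Fy x'y.
  rewrite /ball /= in xx'.
  have h1 : `|g x - g x'| < e / 2.
    by apply: dP => //; apply: lt_le_trans xx' _; rewrite ler_pdivrMr // ler_peMr ?ler1n // ltW.
  have h2 : `|g x - g y| < e / 2.
    apply: dP => //; rewrite -(subrKA x') (le_lt_trans (ler_normD _ _)) //.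
    by have := le_lt_trans x'y dd; lra.
  rewrite -(subrKA (g x)) (le_trans (ler_normD _ _)) // [X in X + _]distrC.
  by lra.
move=> ev; have : \forall delta \near (0 : R)^'+, 0 < delta /\ F `<=` P delta.
  by apply: filterI => //; exact: nbhs_right_gt.
move=> /filter_ex [delta [d0 dP]]; have [k kd] := expr_lt_eps rho01 d0.
exists k => x y Fx Fy xy; apply: (dP x) => //.
by apply: le_trans xy (ltW kd).
Qed.

(** [F] has diameter at most 1, so tolerance 1 at [k = 0] bounds the function; each further [k]
    splits [F] into its pieces. *)
Lemma cont_on_bounded g : cont_on g -> exists2 B, 0 < B & forall x, F x -> `|g x| <= B.
Proof.
move=> gc; have [rho rho01 rhoP] := ord_lt1_ub (ifs_ratio ifsF).
have [k] := cont_on_modulus gc rho01 ltr01.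
elim: k g {gc} => [|k IH] g gm.
  exists (1 + `|g 0|); first by rewrite ltr_pwDl.
  move=> x Fx; have /andP[x0 x1] := F01 ifsF Fx.
  have : `|g x - g 0| <= 1.
    apply: gm => //; first exact: (F0 ifsF).
    by rewrite subr0 expr0 ger0_norm.
  by have := ler_normD (g x - g 0) (g 0); rewrite subrK; lra.
have /boolp.choice [B BP] : forall i, exists B, forall x, F x -> `|g (psi i x)| <= B.
  by move=> i; have [B _ BP] := IH _ (modulus_psi ifsF i rhoP gm); exists B.
have [C C0 CP] := ord_ub B; exists C => // y /(F_cover ifsF) [i [x [Fx ->]]].
exact: le_trans (BP i x Fx) (CP i).
Qed.

Lemma cont_on_measurable g : cont_on g ->
  measurable_fun (F : set (measurableTypeR R)) (g : measurableTypeR R -> R).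
Proof.
move=> gc; have mF : measurable (F : set (measurableTypeR R)) := F_measurable ifsF.
apply: (subspace_continuous_measurable_fun mF).
apply/subspace_continuousP => x Fx; apply/cvgrPdist_lt => e e0.
have [d d0 dP] := gc x Fx e e0; apply/nbhs_ballP; exists d => // y xy Fy.
exact: dP.
Qed.

Lemma within_continuous_complex (f : R -> R[i]^o) : {within F, continuous f} ->
  forall x, F x -> forall e, 0 < e -> exists2 delta, 0 < delta &
    forall y, F y -> `|x - y| < delta -> Normc.normc (f x - f y) < e.
Proof.
move=> /subspace_continuousP fc x Fx e e0.
have e0' : 0 < e%:C :> R[i] by rewrite ltcR.
have := fc x Fx; move=> /(@cvgrPdist_lt _ (R[i]^o)) /(_ _ e0').
move=> /nbhs_ballP [d d0 dP]; exists d => // y Fy xy.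
by have := dP y xy Fy; rewrite /= normC ltcR.
Qed.

End ContinuousOn.

(** The sum is continuous and strictly decreasing in [t]. It is at most 1 where every term is at
    most [1 / (n + 1)], and at least 1 where the term of [ord0] alone equals 1. *)
Lemma moment_exponent (R : realType) (n : nat) (P r : 'I_n.+1 -> R) :
  (forall i, 0 < P i) -> (forall i, 0 < r i < 1) ->
  exists beta, forall t, \sum_i P i * r i `^ t = 1 <-> t = beta.
Proof.
move=> P0 r01; pose phi t := \sum_i P i * r i `^ t.
have r0 i : 0 < r i by case/andP: (r01 i).
have lr i : ln (r i) < 0 by rewrite ln_lt0.
have term_decr i s t : s < t -> P i * r i `^ t < P i * r i `^ s.
  by move=> st; rewrite ltr_pM2l // !powR_exp // ltr_expR ltr_nM2r.
have phi_decr s t : s < t -> phi t < phi s.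
  move=> st; rewrite /phi (bigD1 ord0) //= [ltRHS](bigD1 ord0) //=.
  by apply: ltr_leD; [exact: term_decr | apply: ler_sum => i _; exact/ltW/term_decr].
have term_cont i : continuous (fun t => P i * r i `^ t).
  rewrite (_ : (fun t => _) = fun t => P i * expR (t * ln (r i))); last first.
    by apply/funext => t; rewrite powR_exp.
  move=> t; apply: cvgM; first exact: cvg_cst.
  apply: continuous_comp; last exact: continuous_expR.
  by apply: cvgM; [exact: cvg_id | exact: cvg_cst].
have phi_cont : continuous phi.
  rewrite /phi; elim: (index_enum _) => [|i s IH].
    rewrite (_ : (fun t => _) = fun=> 0); last by apply/funext => t; rewrite big_nil.
    by move=> t; exact: cvg_cst.
  rewrite (_ : (fun t => _) =
      fun t => P i * r i `^ t + \sum_(j <- s) P j * r j `^ t); last first.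
    by apply/funext => t; rewrite big_cons.
  by move=> t; apply: cvgD; [exact: term_cont | exact: IH].
have [t1 t1P] : exists t1, phi t1 <= 1.
  have [T _ TP] := ord_ub (fun i => - ln (P i * n.+1%:R) / ln (r i)).
  exists T; apply: (@le_trans _ _ (\sum_(i < n.+1) n.+1%:R^-1)).
    apply: ler_sum => i _; have Pn : 0 < P i * n.+1%:R by rewrite mulr_gt0.
    rewrite -[leRHS]div1r ler_pdivlMr // mulrAC powR_exp //.
    rewrite -[P i * _]lnK ?posrE // -expRD -[leRHS]expR0 ler_expR.
    have := TP i; rewrite ler_ndivrMr //; lra.
  by rewrite sumr_const card_ord -(mulr_natr (n.+1%:R^-1)) mulVf.
have [t2 t2P] : exists t2, 1 <= phi t2.
  exists (- ln (P ord0) / ln (r ord0)); rewrite /phi (bigD1 ord0) //=.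
  rewrite powR_exp // divfK ?lt_eqF // expRN lnK ?posrE // mulfV ?gt_eqF // lerDl.
  by apply: sumr_ge0 => i _; rewrite mulr_ge0 ?powR_ge0 // ltW.
have t21 : t2 <= t1.
  by rewrite leNgt; apply/negP => /phi_decr; lra.
have phi_within : {within `[t2, t1], continuous phi} by exact: continuous_subspaceT.
have between : Num.min (phi t2) (phi t1) <= 1 <= Num.max (phi t2) (phi t1).
  by rewrite ge_min le_max t1P t2P orbT.
have [beta _ betaP] := IVT t21 phi_within between.
exists beta => t; split=> [tP|-> //].
case: (ltgtP t beta) => // /phi_decr; rewrite betaP {1}/phi tP ltxx //.
Qed.

(** * Dixmier traces *)

Section DixmierTraces.
Context {R : realType} {m : nat} (psi : 'I_m.+1 -> R -> R) (r : 'I_m.+1 -> R).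
Context (F : set R) (bm bp : nat -> R) (ifsF : ifs psi r F).
Context (hI : complementary_intervals F bm bp).
Context (kap : 'I_m.+1 -> nat -> nat) (gap : 'I_m -> nat).
Context (kapP : forall i n,
  bm (kap i n) = psi i (bm n) /\ bp (kap i n) = psi i (bp n)).
Context (gapP : forall i,
  bm (gap i) = psi (lidx i) 1 /\ bp (gap i) = psi (ridx i) 0).
Context (p : 'I_m.+1 -> R) (mu : probability (measurableTypeR R) R).
Context (hp : forall i, 0 < p i) (hmu : selfsimilar_measure F psi p mu).
Context (q beta a : R) (a0 : 0 < a).
Context (hbeta : \sum_i p i `^ q * r i `^ beta = 1).
Local Notation H := (ell2 R).
Local Notation normc := (@Normc.normc R).
Local Notation e := (endpoint bm bp).
Local Notation w := (weight r p q beta).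
Local Notation dens := (fun j : site => density bm bp mu q beta a j.1).
Local Notation x0 := ((0%N, false) : site).
Local Notation mean := (wmean (site_kap kap) w x0).
Local Notation rate :=
  (renewal_rate (site_kap kap) w dens (range gap `*` [set: bool])).

Let rnw := interval_renewal ifsF hI kapP gapP hp hmu a0 hbeta.
Let w0 i : 0 <= w i := ltW (weight_gt0 ifsF hp q beta i).
Let dens0 j : 0 < dens j := renewal_d0 rnw j.

Definition ccont_on (f : R -> R[i]) : Prop := forall x, F x -> forall eps, 0 < eps ->
  exists2 delta, 0 < delta &
    forall y, F y -> `|x - y| < delta -> normc (f x - f y) < eps.

Lemma ccont_on_cont_on (f : R -> R[i]) (g : R -> R) : ccont_on f ->
  (forall x y, `|g x - g y| <= normc (f x - f y)) -> cont_on F g.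
Proof.
move=> fc gf x Fx eps /(fc x Fx) [d d0 dP]; exists d => // y Fy xy.
exact: le_lt_trans (gf x y) (dP y Fy xy).
Qed.

Lemma ccont_on_real (g : R -> R) : cont_on F g -> ccont_on (fun x => (g x)%:C).
Proof.
move=> gc x Fx eps /(gc x Fx) [d d0 dP]; exists d => // y Fy xy.
by rewrite -rmorphB normc_real dP.
Qed.

Lemma ccont_on_lincomb (b : R[i]) f g : ccont_on f -> ccont_on g ->
  ccont_on (fun x => b * f x + g x).
Proof.
move=> fc gc x Fx eps eps0.
have b0 : 0 < normc b + 1 by rewrite ltr_wpDl ?normc_ge0.
have [d d0 dP] := fc x Fx (eps / 2 / (normc b + 1)) (ltac:(by rewrite !divr_gt0)).
have [d' d'0 d'P] := gc x Fx (eps / 2) (ltac:(by rewrite divr_gt0)).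
exists (Num.min d d'); first by rewrite lt_min d0.
move=> y Fy; rewrite lt_min => /andP[/(dP y Fy) h1 /(d'P y Fy) h2].
have -> : b * f x + g x - (b * f y + g y) = b * (f x - f y) + (g x - g y) by ring.
apply: (le_lt_trans (le_normcD _ _)); rewrite Normc.normcM.
have : normc b * normc (f x - f y) <= eps / 2.
  rewrite ltr_pdivlMr // in h1; apply: le_trans (ltW h1).
  by rewrite mulrC ler_wpM2l ?normc_ge0 // lerDl.
lra.
Qed.

Lemma cont_on_vanishing_osc g : cont_on F g ->
  vanishing_osc (site_kap kap) x0 (g \o e).
Proof.
move=> gc eps eps0; have [rho rho01 rhoP] := ord_lt1_ub (ifs_ratio ifsF).
have [k km] := cont_on_modulus ifsF gc rho01 eps0.
by exists k; apply: (modulus_level_osc ifsF hI kapP x0 rhoP km).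
Qed.

Lemma mean_integral (nu : probability (measurableTypeR R) R) g :
  selfsimilar_measure F psi w nu -> cont_on F g ->
  \int[nu]_(x in F) g x = mean (g \o e).
Proof.
move=> hnu gc; have [rho rho01 rhoP] := ord_lt1_ub (ifs_ratio ifsF).
have [B _ gB] := cont_on_bounded ifsF gc.
apply/eqP; rewrite -subr_eq0 -normr_le0; apply/ler_addgt0Pr => eps eps0.
rewrite add0r; have eps2 : 0 < eps / 2 by rewrite divr_gt0.
have [k km] := cont_on_modulus ifsF gc rho01 eps2.
have h1 := integral_wavg ifsF w0 hnu hI kapP x0 rhoP
  (cont_on_measurable ifsF gc) gB km.
have osc := modulus_level_osc ifsF hI kapP x0 rhoP km.
have h2 := wmean_dist w0 hbeta eps2 (cont_on_vanishing_osc gc) osc.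
rewrite -(subrKA (wavg (site_kap kap) w x0 k (g \o e))).
by rewrite (le_trans (ler_normD _ _)) //; lra.
Qed.

Definition xiGqD_op (f : R -> R[i]) : H -> H := diag_op (fun j => f (e j) * (dens j)%:C).

Let ccont_on_norm f : ccont_on f -> cont_on F (normc \o f).
Proof.
move=> fc; apply: (ccont_on_cont_on fc) => x y; rewrite /=.
have h u v : normc u <= normc (u - v) + normc v.
  by apply: le_trans (le_normcD _ _); rewrite subrK.
have := h (f x) (f y); have := h (f y) (f x).
by rewrite -(normcN (f y - f x)) opprB ler_norml => *; apply/andP; split; lra.
Qed.

Let ccont_on_bounded f : ccont_on f -> bounded_weight (fun j => normc (f (e j))).
Proof.
move=> fc; have [B B0 BP] := cont_on_bounded ifsF (ccont_on_norm fc).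
exists B => // j; rewrite normc_ge0.
by apply: le_trans (ler_norm _) (BP _ (F_endpoint hI j)).
Qed.

Let normc_diag f j : normc (f (e j) * (dens j)%:C) = normc (f (e j)) * dens j.
Proof. by rewrite Normc.normcM normc_real gtr0_norm. Qed.

Let xiGqD_op_bounded f : ccont_on f -> bounded_diag (fun j => f (e j) * (dens j)%:C).
Proof.
move=> fc; have [B B0 BP] := ccont_on_bounded fc.
have [C C0 CP] : exists2 C, 0 < C & forall j, dens j <= C.
  have fin1 := renewal_vanish rnw ltr01.
  have [C C0 CP] := finite_set_ub dens fin1.
  exists (C + 1); first by rewrite ltr_wpDl // ltW.
  move=> j; have [|/ltW j1] := leP 1 (dens j).
    by move/CP => h; rewrite (le_trans h) // lerDl.
  by rewrite (le_trans j1) // lerDr ltW.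
exists (B * C) => [|j]; first exact: mulr_gt0.
rewrite normc_diag; apply: ler_pM => //; [exact: normc_ge0 | exact: ltW |].
by case/andP: (BP j).
Qed.

Let xiGqD_op_vanish f : ccont_on f -> forall t, 0 < t ->
  finite_set [set j | t <= normc (f (e j) * (dens j)%:C)].
Proof.
move=> fc t t0; have := weighted_vanish rnw (ccont_on_bounded fc) t0.
by apply: sub_finite_set => j /=; rewrite normc_diag.
Qed.

Lemma xiGqD_op_log_average f : ccont_on f ->
  log_average (xiGqD_op f) @ \oo --> rate * mean (normc \o f \o e).
Proof.
move=> fc; have sing := sing_diag_op (xiGqD_op_bounded fc) (xiGqD_op_vanish fc).
apply: (rearranged_log_average sing (xiGqD_op_vanish fc)) => eps eps0.
have [K KP] := tail_sum_wmean rnw (ccont_on_bounded fc)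
  (cont_on_vanishing_osc (ccont_on_norm fc)) eps0.
exists K => t /KP; rewrite /tail_sum.
by under eq_fsbigr => j _ do rewrite -normc_diag.
Qed.

Let xiGqD_op_log_average_EFin f : ccont_on f ->
  (EFin \o log_average (xiGqD_op f)) @ \oo --> (rate * mean (normc \o f \o e))%:E.
Proof.
move=> fc; apply: cvg_EFin; first exact: nearW.
exact: xiGqD_op_log_average.
Qed.

Lemma xiGqD_op_ideal f : ccont_on f -> dixmier_ideal (xiGqD_op f).
Proof.
move=> fc; split.
  exact: diag_op_compact (xiGqD_op_bounded fc) (xiGqD_op_vanish fc).
have := cvg_limn_einf_sup (xiGqD_op_log_average_EFin fc).
by move=> [_ ->]; exact: ltry.
Qed.

(** For a positive operator the trace lies between the lower and upper limits of the logarithmic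
    averages, and these coincide. *)
Let dixmier_real omega tau g : dixmier_trace omega tau -> cont_on F g ->
  (forall x, 0 <= g x) -> tau (xiGqD_op (fun x => (g x)%:C)) = (rate * mean (g \o e))%:C.
Proof.
move=> dt gc g0; have fc := ccont_on_real gc; have id := xiGqD_op_ideal fc.
have pos : positive_op (xiGqD_op (fun x => (g x)%:C)).
  apply: diag_op_positive; first exact: xiGqD_op_bounded fc.
  by move=> j; rewrite -rmorphM /= lecR mulr_ge0 // ltW.
rewrite (dixmier_omega dt id pos); congr (_%:C); apply: EFin_inj.
have [h1 h2] := cvg_limn_einf_sup (xiGqD_op_log_average_EFin fc).
have /andP[] := dixmier_bounds dt id pos; rewrite h1 h2 => l1 l2.
have -> : g \o e = normc \o (fun x => (g x)%:C) \o e.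
  by apply/funext => j; rewrite /= expr0n addr0 sqrtr_sqr ger0_norm.
by apply/eqP; rewrite eq_le l1 l2.
Qed.

Let tau_lincomb omega tau b f g : dixmier_trace omega tau -> ccont_on f -> ccont_on g ->
  tau (xiGqD_op (fun x => b * f x + g x)) = b * tau (xiGqD_op f) + tau (xiGqD_op g).
Proof.
move=> dt fc gc; rewrite -(dixmier_linear dt b (xiGqD_op_ideal fc) (xiGqD_op_ideal gc)).
congr (tau _); apply/funext => x; apply: ell2_ext => j.
have bf := xiGqD_op_bounded fc; have bg := xiGqD_op_bounded gc.
have bfg := xiGqD_op_bounded (ccont_on_lincomb b fc gc).
by rewrite ell2_fun_lincomb !diag_opE //; ring.
Qed.

Let mean_lincomb b g h : cont_on F g -> cont_on F h ->
  mean (fun j => b * g (e j) + h (e j)) = b * mean (g \o e) + mean (h \o e).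
Proof.
move=> gc hc; apply: (wmean_lincomb w0 hbeta b).
  exact: cont_on_vanishing_osc.
exact: cont_on_vanishing_osc.
Qed.

Let tau_real omega tau g : dixmier_trace omega tau -> cont_on F g ->
  tau (xiGqD_op (fun x => (g x)%:C)) = (rate * mean (g \o e))%:C.
Proof.
move=> dt gc.
pose gp x := Num.max (g x) 0; pose gm x := Num.max (- g x) 0.
have max_dist (u v : R) : `|Num.max u 0 - Num.max v 0| <= `|u - v|.
  have := ler_norm (u - v); have := ler_norm (v - u); rewrite distrC ler_norml.
  by case: (leP u 0) => ?; case: (leP v 0) => ? ? ?; apply/andP; split; lra.
have cpos (h : R -> R) : cont_on F h -> cont_on F (fun x => Num.max (h x) 0).
  move=> hc x Fx eps /(hc x Fx) [d d0 dP]; exists d => // y Fy xy.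
  exact: le_lt_trans (max_dist _ _) (dP y Fy xy).
have gpc : cont_on F gp by exact: cpos.
have gmc : cont_on F gm.
  apply: cpos => x Fx eps /(gc x Fx) [d d0 dP]; exists d => // y Fy xy.
  by rewrite -opprD normrN; exact: dP.
have gE x : g x = -1 * gm x + gp x.
  by rewrite /gp /gm; case: (leP (g x) 0) => ?; case: (leP (- g x) 0) => ?; lra.
have -> : (fun x => (g x)%:C) = fun x => -1 * (gm x)%:C + (gp x)%:C.
  by apply/funext => x; rewrite {1}gE rmorphD rmorphM rmorphN1.
rewrite (tau_lincomb (-1) dt (ccont_on_real gmc) (ccont_on_real gpc)).
rewrite (dixmier_real dt gmc); last by move=> x; rewrite le_max lexx orbT.
rewrite (dixmier_real dt gpc); last by move=> x; rewrite le_max lexx orbT.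
have -> : g \o e = fun j => -1 * gm (e j) + gp (e j).
  by apply/funext => j; rewrite /= gE.
by rewrite mean_lincomb // mulrDr rmorphD !rmorphM rmorphN1; ring.
Qed.

Definition cmean (f : R -> R[i]) : R[i] :=
  mean (fun j => complex.Re (f (e j))) +i* mean (fun j => complex.Im (f (e j))).

Let Re_cont f : ccont_on f -> cont_on F (fun x => complex.Re (f x)).
Proof.
move=> fc; apply: (ccont_on_cont_on fc) => x y.
by apply: le_trans (Re_le_normc _); case: (f x) (f y) => ? ? [].
Qed.

Let Im_cont f : ccont_on f -> cont_on F (fun x => complex.Im (f x)).
Proof.
move=> fc; apply: (ccont_on_cont_on fc) => x y.
by apply: le_trans (Im_le_normc _); case: (f x) (f y) => ? ? [].
Qed.

Lemma xiGqD_op_trace omega tau f : dixmier_trace omega tau -> ccont_on f ->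
  tau (xiGqD_op f) = rate%:C * cmean f.
Proof.
move=> dt fc; have rc := Re_cont fc; have ic := Im_cont fc.
have fE : f = fun x => 'i%C * (complex.Im (f x))%:C + (complex.Re (f x))%:C.
  by apply/funext => x; rewrite [LHS]complexE addrC.
rewrite (congr1 xiGqD_op fE) (tau_lincomb _ dt (ccont_on_real ic) (ccont_on_real rc)).
rewrite (tau_real dt ic) (tau_real dt rc) !rmorphM [cmean f]complexE.
by rewrite /cmean /=; ring.
Qed.

(** In the last clause, positivity of the operator and of the densities makes [f] real and
    non-negative at all endpoints; there [|f|] equals its real part, and the limit found for [|f|]
    is the claimed one. *)
Lemma xiGqD_op_nc_integral f : ccont_on f ->
  has_nc_integral (xiGqD_op f) (rate%:C * cmean f).
Proof.
move=> fc; split; first exact: xiGqD_op_ideal.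
  by move=> omega tau dt; exact: xiGqD_op_trace dt fc.
move=> pos; have fj := positive_diag_op (xiGqD_op_bounded fc) pos.
have fR j : (normc \o f \o e) j = complex.Re (f (e j)).
  have := fj j; rewrite pmulr_lge0 ?ltcR // /comp.
  case: (f (e j)) => u v; rewrite lecE /= => /andP[/eqP -> u0].
  by rewrite expr0n addr0 sqrtr_sqr ger0_norm.
have -> : complex.Re (rate%:C * cmean f) = rate * mean (normc \o f \o e).
  rewrite /cmean /= mul0r subr0; congr (_ * mean _).
  by apply/funext => j; rewrite fR.
exact: xiGqD_op_log_average.
Qed.

Lemma cmean_integral (nu : probability (measurableTypeR R) R) f :
  selfsimilar_measure F psi w nu -> ccont_on f -> cmean f = cintegral nu F f.
Proof.
move=> hnu fc; rewrite /cintegral (mean_integral hnu (Re_cont fc)).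
by rewrite (mean_integral hnu (Im_cont fc)).
Qed.

Lemma xi_GqD f : ccont_on f -> xi bm bp f \o GqD bm bp mu a q beta = xiGqD_op f.
Proof.
move=> fc; have [B B0 BP] := ccont_on_bounded fc.
have fb : bounded_diag (f \o e) by exists B => // j; case/andP: (BP j).
have one : ccont_on (fun=> 1).
  by move=> x Fx eps eps0; exists 1 => // y _ _; rewrite subrr Normc.normc0.
have db : bounded_diag (fun j => (dens j)%:C).
  have [C C0 CP] := xiGqD_op_bounded one; exists C => // j.
  by have := CP j; rewrite mul1r.
exact: (diag_op_comp fb db).
Qed.

End DixmierTraces.

Theorem theorem6 (R : realType) (m : nat) (psi : 'I_m.+1 -> R -> R)
    (r p : 'I_m.+1 -> R) (F : set R) (bm bp : nat -> R) (lambda q a : R)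
    (mu : probability (measurableTypeR R) R)
    (hr : forall i, 0 < r i < 1)
    (hpsi : forall i, similarity (r i) (psi i))
    (hord : ordered_pieces psi)
    (hF : selfsimilar_set psi F)
    (hI : complementary_intervals F bm bp)
    (hlambda : 0 < lambda <= 1)
    (hlac : lacunary F bm bp lambda)
    (hp : forall i, 0 < p i)
    (hp1 : \sum_i p i = 1)
    (hmu : selfsimilar_measure F psi p mu)
    (ha : 2 / lambda <= a) :
  exists beta : R,
    let w := fun i => p i `^ q * r i `^ beta in
    let c := 2 * r0 psi p bm bp mu a q beta / \sum_i w i * ln (1 / w i) in
    [/\ is_moment mu q beta,
        forall t : R, \sum_i p i `^ q * r i `^ t = 1 <-> t = beta,
        forall i, finite_set [set n | r0_range psi bm bp i n /\
                                      r0_term psi p bm bp mu a q beta i n != 0]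
      & forall f : R -> R[i]^o, {within F, continuous f} ->
          let T := xi bm bp f \o GqD bm bp mu a q beta in
          measurable_op T /\
          forall nu : probability (measurableTypeR R) R,
            selfsimilar_measure F psi w nu ->
            has_nc_integral T (c%:C * cintegral nu F f)].
Proof.
have ifsF : ifs psi r F by split.
have a0 : 0 < a.
  by apply: lt_le_trans ha; rewrite divr_gt0 //; case/andP: hlambda.
have [beta betaP] := moment_exponent (fun i => powR_gt0 q (hp i)) hr.
have hbeta : \sum_i p i `^ q * r i `^ beta = 1 by apply/betaP.
have /boolp.choice [kap' kapP'] : forall ik : 'I_m.+1 * nat, exists k,
    bm k = psi ik.1 (bm ik.2) /\ bp k = psi ik.1 (bp ik.2).
  by move=> ik; exact: (psi_gap_interval ifsF hI).
pose kap i n := kap' (i, n).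
have kapP i n : bm (kap i n) = psi i (bm n) /\ bp (kap i n) = psi i (bp n).
  exact: (kapP' (i, n)).
have /boolp.choice [gap gapP] : forall i : 'I_m, exists k,
    bm k = psi (lidx i) 1 /\ bp k = psi (ridx i) 0.
  by move=> i; apply: (gap_interval ifsF hI); exact: (middle_gap ifsF).
exists beta => w c; split.
- exact: (selfsimilar_moment ifsF hp hmu hbeta).
- exact: betaP.
- exact: (r0_term_finite ifsF hI kapP gapP hp hmu q beta a0).
move=> f fcont T.
have fc : ccont_on F f by exact: within_continuous_complex.
have rateE : renewal_rate (site_kap kap) (weight r p q beta)
    (fun j : site => density bm bp mu q beta a j.1) (range gap `*` [set: bool]) = c.
  by rewrite /renewal_rate (renewal_mass_r0 ifsF hI kapP gapP hp hmu q beta a0).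
have nc := xiGqD_op_nc_integral ifsF hI kapP gapP hp hmu a0 hbeta fc.
rewrite rateE -(xi_GqD ifsF hI kapP gapP hp hmu a0 hbeta fc) in nc.
(* The value [cmean f] does not refer to a measure, which gives measurability; a given [nu] then
   turns it into an integral. *)
split; first by eexists; exact: nc.
move=> nu hnu.
by rewrite -(cmean_integral ifsF hI kapP hp hbeta hnu fc).
Qed.
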